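(* The following are equivalent over $\mathsf{RCA}_0$: 1. $\mathrm{B}\Sigma^0_2$. 2. $\Sigma^0_1\text{-}\mathrm{WKL}(pf\text{-}bd)$: for every infinite $\Sigma^0_1$ tree $T\subseteq 2^{<\mathbb{N}}$, if there exists $c\in\mathbb{N}$ such that $|P|\le c$ for every prefix-free set $P\subseteq T$, then $T$ has a path. 3. $\mathrm{KL}(pf\text{-}bd)$: for every infinite tree $T\subseteq \mathbb{N}^{<\mathbb{N}}$, if there exists $c\in\mathbb{N}$ such that $|P|\le c$ for every prefix-free set $P\subseteq T$, then $T$ has a path.
   Context: $\mathsf{RCA}_0$ is the usual base system of second-order arithmetic and $\mathrm{B}\Sigma^0_2$ is the $\Sigma^0_2$ bounding (collection) scheme (with set parameters); the equivalences are provable in $\mathsf{RCA}_0$. A tree is a collection of finite sequences (from $2^{<\mathbb{N}}$ or $\mathbb{N}^{<\mathbb{N}}$) closed under initial segments. In item 3, $T$ is a set. A $\Sigma^0_1$ tree $T\subseteq 2^{<\mathbb{N}}$ need not exist as a set: it is given by an enumeration of binary strings $\{\sigma_i\}_{i\in\mathbb{N}}$ such that $T=\{\sigma_i\mid i\in\mathbb{N}\}$ is a tree. A path of $T$ is a function (existing as a second-order object) all of whose finite initial segments are in $T$. A set $P$ of finite sequences is prefix-free if no element of $P$ is a proper initial segment of another element of $P$. $|P|\le c$ means that every finite set $F\subseteq P$ (coded by a natural number) satisfies $|F|\le c$. *)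

(* Defs.v *)
From Stdlib Require Import List.

(** * Second-order arithmetic: the two-sorted language L_2

    Variables are de Bruijn indices, numbered separately for the two sorts:
    [All1] binds number variable 0 and leaves the set variables alone, [All2]
    binds set variable 0 and leaves the number variables alone.  Equality is
    primitive for numbers only; the set terms are the set variables. *)

Inductive tm : Type :=
| Var (i : nat)
| Zero
| One
| Plus (t u : tm)
| Times (t u : tm).

Inductive form : Type :=
| Bot
| Eq (t u : tm)
| Lt (t u : tm)
| Mem (t : tm) (X : nat)
| Imp (p q : form)
| All1 (p : form)
| All2 (p : form).

Fixpoint tsubst (s : nat -> tm) (t : tm) : tm :=
  match t with
  | Var i => s i
  | Zero => Zero
  | One => One
  | Plus t u => Plus (tsubst s t) (tsubst s u)
  | Times t u => Times (tsubst s t) (tsubst s u)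
  end.

Definition lift (k : nat) (t : tm) : tm := tsubst (fun i => Var (k + i)) t.

Definition up1 (s : nat -> tm) (i : nat) : tm :=
  match i with 0 => Var 0 | S j => lift 1 (s j) end.

Definition up2 (r : nat -> nat) (i : nat) : nat :=
  match i with 0 => 0 | S j => S (r j) end.

(** Simultaneous substitution of terms for number variables and of set
    variables for set variables. *)
Fixpoint subst (s : nat -> tm) (r : nat -> nat) (p : form) : form :=
  match p with
  | Bot => Bot
  | Eq t u => Eq (tsubst s t) (tsubst s u)
  | Lt t u => Lt (tsubst s t) (tsubst s u)
  | Mem t X => Mem (tsubst s t) (r X)
  | Imp p q => Imp (subst s r p) (subst s r q)
  | All1 p => All1 (subst (up1 s) r p)
  | All2 p => All2 (subst s (up2 r) p)
  end.

Definition id2 (X : nat) : nat := X.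

Definition inst1 (t : tm) (p : form) : form :=
  subst (fun i => match i with 0 => t | S j => Var j end) id2 p.

Definition inst2 (Y : nat) (p : form) : form :=
  subst Var (fun X => match X with 0 => Y | S Z => Z end) p.

Definition shift1 (p : form) : form := subst (fun i => Var (S i)) id2 p.
Definition shift2 (p : form) : form := subst Var S p.

(** The remaining connectives are the usual classical abbreviations. *)
Definition Neg (p : form) : form := Imp p Bot.
Definition And (p q : form) : form := Neg (Imp p (Neg q)).
Definition Or (p q : form) : form := Imp (Neg p) q.
Definition Iff (p q : form) : form := And (Imp p q) (Imp q p).
Definition Ex1 (p : form) : form := Neg (All1 (Neg p)).
Definition Ex2 (p : form) : form := Neg (All2 (Neg p)).

(** [Ball t p] is (forall x < t) p and [Bex t p] is (exists x < t) p, where x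
    is number variable 0 of [p]; the bound [t] lives outside the binder. *)
Definition Ball (t : tm) (p : form) : form := All1 (Imp (Lt (Var 0) (lift 1 t)) p).
Definition Bex (t : tm) (p : form) : form := Neg (Ball t (Neg p)).

Declare Scope fm_scope.
Delimit Scope fm_scope with fm.
Bind Scope fm_scope with tm.
Bind Scope fm_scope with form.

Notation "$ i" := (Var i) (at level 1, i at level 0, format "$ i") : fm_scope.
Notation "t ↑ k" := (lift k t) (at level 2, k at level 0, left associativity, format "t ↑ k") : fm_scope.
Notation "t ⊕ u" := (Plus t u) (at level 50, left associativity) : fm_scope.
Notation "t ⊗ u" := (Times t u) (at level 40, left associativity) : fm_scope.
Notation "t ≐ u" := (Eq t u) (at level 70) : fm_scope.
Notation "t ≺ u" := (Lt t u) (at level 70) : fm_scope.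
Notation "t ≼ u" := (Lt t (Plus u One)) (at level 70) : fm_scope.
Notation "t ∈ X" := (Mem t X) (at level 70) : fm_scope.
Notation "¬ p" := (Neg p) (at level 75, right associativity) : fm_scope.
Notation "p ∧ q" := (And p q) (at level 80, right associativity) : fm_scope.
Notation "p ∨ q" := (Or p q) (at level 85, right associativity) : fm_scope.
Notation "p ⇒ q" := (Imp p q) (at level 90, right associativity) : fm_scope.
Notation "p ⇔ q" := (Iff p q) (at level 95, no associativity) : fm_scope.
Notation "∀¹ p" := (All1 p) (at level 10, p at level 97) : fm_scope.
Notation "∃¹ p" := (Ex1 p) (at level 10, p at level 97) : fm_scope.
Notation "∀² p" := (All2 p) (at level 10, p at level 97) : fm_scope.
Notation "∃² p" := (Ex2 p) (at level 10, p at level 97) : fm_scope.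
Notation "∀≺ t , p" := (Ball t p) (at level 10, t at level 60, p at level 97) : fm_scope.
Notation "∃≺ t , p" := (Bex t p) (at level 10, t at level 60, p at level 97) : fm_scope.
Notation "∀≼ t , p" := (Ball (Plus t One) p) (at level 10, t at level 60, p at level 97) : fm_scope.
Notation "∃≼ t , p" := (Bex (Plus t One) p) (at level 10, t at level 60, p at level 97) : fm_scope.

Local Open Scope fm_scope.

(** * Provability

    Classical natural deduction with equality.  A theory is a set of formulas,
    and an axiom with free variables stands for its universal closure: this is
    why [P_ax] is available in every context, also below [P_all1_i] and
    [P_all2_i], where the hypotheses are shifted but the axioms are not. *)

Definition theory : Type := form -> Prop.

Inductive proves (A : theory) : list form -> form -> Prop :=
| P_hyp G p : List.In p G -> proves A G p
| P_ax G p : A p -> proves A G p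
| P_imp_i G p q : proves A (p :: G) q -> proves A G (p ⇒ q)
| P_imp_e G p q : proves A G (p ⇒ q) -> proves A G p -> proves A G q
| P_dn G p : proves A G (¬ ¬ p) -> proves A G p
| P_all1_i G p : proves A (map shift1 G) p -> proves A G (∀¹ p)
| P_all1_e G p t : proves A G (∀¹ p) -> proves A G (inst1 t p)
| P_all2_i G p : proves A (map shift2 G) p -> proves A G (∀² p)
| P_all2_e G p Y : proves A G (∀² p) -> proves A G (inst2 Y p)
| P_eq_refl G t : proves A G (t ≐ t)
| P_eq_e G p t u : proves A G (t ≐ u) -> proves A G (inst1 t p) -> proves A G (inst1 u p).

Definition provable (A : theory) (p : form) : Prop := proves A nil p.

Definition union (A B : theory) : theory := fun p => A p \/ B p.
Definition single (p : form) : theory := fun q => q = p.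

(** A principle may be a scheme, hence is itself a theory. *)
Definition implies_over (A P Q : theory) : Prop :=
  forall q, Q q -> provable (union A P) q.

Definition equivalent_over (A P Q : theory) : Prop :=
  implies_over A P Q /\ implies_over A Q P.

(** * The arithmetical hierarchy and RCA_0 *)

Inductive Delta0 : form -> Prop :=
| D0_bot : Delta0 Bot
| D0_eq t u : Delta0 (t ≐ u)
| D0_lt t u : Delta0 (t ≺ u)
| D0_in t X : Delta0 (t ∈ X)
| D0_imp p q : Delta0 p -> Delta0 q -> Delta0 (p ⇒ q)
| D0_ball t p : Delta0 p -> Delta0 (∀≺ t, p).

Definition Sigma01 (p : form) : Prop := exists q, Delta0 q /\ p = (∃¹ q).
Definition Pi01 (p : form) : Prop := exists q, Delta0 q /\ p = (∀¹ q).
Definition Sigma02 (p : form) : Prop := exists q, Pi01 q /\ p = (∃¹ q).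

Inductive basic_axiom : theory :=
| Ax_succ_nz : basic_axiom (¬ ($0 ⊕ One ≐ Zero))
| Ax_succ_inj : basic_axiom ($0 ⊕ One ≐ $1 ⊕ One ⇒ $0 ≐ $1)
| Ax_add_0 : basic_axiom ($0 ⊕ Zero ≐ $0)
| Ax_add_S : basic_axiom ($0 ⊕ ($1 ⊕ One) ≐ ($0 ⊕ $1) ⊕ One)
| Ax_mul_0 : basic_axiom ($0 ⊗ Zero ≐ Zero)
| Ax_mul_S : basic_axiom ($0 ⊗ ($1 ⊕ One) ≐ $0 ⊗ $1 ⊕ $0)
| Ax_lt_0 : basic_axiom (¬ ($0 ≺ Zero))
| Ax_lt_S : basic_axiom ($0 ≺ $1 ⊕ One ⇔ ($0 ≺ $1 ∨ $0 ≐ $1)).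

(** Induction for p(n), n being number variable 0 of [p]. *)
Definition induction (p : form) : form :=
  inst1 Zero p
  ∧ (∀¹ p ⇒ subst (fun i => match i with 0 => $0 ⊕ One | S j => Var (S j) end) id2 p)
  ⇒ ∀¹ p.

(** forall n (p(n) <-> q(n)) -> exists X forall n (n in X <-> p(n)). *)
Definition comprehension (p q : form) : form :=
  (∀¹ p ⇔ q) ⇒ ∃² ∀¹ ($0 ∈ 0 ⇔ shift2 p).

Inductive RCA0 : theory :=
| RCA0_basic p : basic_axiom p -> RCA0 p
| RCA0_induction p : Sigma01 p -> RCA0 (induction p)
| RCA0_comprehension p q : Sigma01 p -> Pi01 q -> RCA0 (comprehension p q).

(** * Bounding for Sigma^0_2 formulas

    forall n ((forall x < n) exists y p(x,y) ->
              exists b (forall x < n) (exists y < b) p(x,y)),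
    where y, x, n are number variables 0, 1, 2 of [p] and the others are
    parameters; the substitution makes room for the new variable b. *)
Definition bounding (p : form) : form :=
  ∀¹ (∀≺ $0, ∃¹ p)
     ⇒ ∃¹ ∀≺ $1, ∃≺ $1,
         subst (fun i => match i with
                         | 0 => $0 | 1 => $1 | S (S j) => Var (S (S (S j)))
                         end) id2 p.

Inductive BSigma2 : theory :=
| BSigma2_inst p : Sigma02 p -> BSigma2 (bounding p).

(** * Coding of finite sequences and finite sets

    [cpair] is injective but not onto.  The number <n,<a,b>> represents the
    sequence of length n whose i-th entry is the remainder of a modulo
    1 + (i+1)b (Goedel's beta function).  A sequence has many representations;
    [is_seq] singles out the least one as its code, so that codes correspond
    bijectively to sequences and can be counted and compared with [Eq]. *)

Definition cpair (t u : tm) : tm := (t ⊕ u) ⊗ (t ⊕ u) ⊕ t.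

(** s represents a sequence of length n *)
Definition len (s n : tm) : form :=
  ∃≼ s, ∃≼ s↑1, s↑2 ≐ cpair n↑2 (cpair $1 $0).

(** s represents a sequence of length > i whose i-th entry is x; the inner
    variables are n, a, b, q (outermost first) *)
Definition entry (s i x : tm) : form :=
  ∃≼ s, ∃≼ s↑1, ∃≼ s↑2,
    s↑3 ≐ cpair $2 (cpair $1 $0)
    ∧ i↑3 ≺ $2
    ∧ x↑3 ≺ One ⊕ (i↑3 ⊕ One) ⊗ $0
    ∧ ∃≼ $1, $2 ≐ $0 ⊗ (One ⊕ (i↑4 ⊕ One) ⊗ $1) ⊕ x↑4.

(** the sequence represented by t is an initial segment of that represented
    by s: with m, n the lengths of t, s, we have m <= n and the entries below
    m agree *)
Definition initial (t s : tm) : form :=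
  ∃≼ t, ∃≼ s↑1,
    len t↑2 $1 ∧ len s↑2 $0 ∧ $1 ≼ $0
    ∧ ∀≺ $1, ∃≼ s↑3, entry t↑4 $1 $0 ∧ entry s↑4 $1 $0.

(** s is (the code of) an element of N^{<N} *)
Definition is_seq (s : tm) : form :=
  (∃≼ s, len s↑1 $0)
  ∧ ∀≺ s, ¬ (initial $0 s↑1 ∧ initial s↑1 $0).

(** s is an element of 2^{<N} *)
Definition binary (s : tm) : form :=
  is_seq s ∧ ∀¹ ∀¹ entry s↑2 $1 $0 ⇒ $0 ≺ One ⊕ One.

(** A finite set is coded by its strictly increasing enumeration, and its
    cardinality is the length of that enumeration. *)
Definition finset (s : tm) : form :=
  is_seq s ∧ ∀¹ ∀¹ ∀¹ ∀¹ ($3 ≺ $2 ∧ entry s↑4 $3 $1 ∧ entry s↑4 $2 $0 ⇒ $1 ≺ $0).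

(** every finite set F included in P satisfies |F| <= c *)
Definition card_le (P : nat) (c : tm) : form :=
  ∀¹ (finset $0 ∧ (∀¹ ∀¹ entry $2 $1 $0 ⇒ $0 ∈ P)
      ⇒ ∀¹ len $1 $0 ⇒ $0 ≼ c↑2).

(** the set F is a function from N to N *)
Definition function (F : nat) : form :=
  (∀¹ $0 ∈ F ⇒ ∃¹ ∃¹ $2 ≐ cpair $1 $0)
  ∧ (∀¹ ∃¹ (cpair $1 $0 ∈ F ∧ ∀¹ cpair $2 $0 ∈ F ⇒ $0 ≐ $1)).

(** * Trees

    A class of numbers is given by its membership formula [M X t], which says
    that t belongs to the class determined by the set variable X; apart from
    those in t it has no free number variables. *)

Definition class : Type := nat -> tm -> form.

(** the set X itself *)
Definition as_set : class := fun X t => t ∈ X.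

(** the range of the function X, i.e. the class enumerated by X *)
Definition as_range : class := fun X t => ∃¹ cpair $0 t↑1 ∈ X.

Definition tree (M : class) (T : nat) : form :=
  ∀¹ M T $0 ⇒ is_seq $0 ∧ ∀¹ (is_seq $0 ∧ initial $0 $1 ⇒ M T $0).

Definition infinite (M : class) (T : nat) : form :=
  ∀¹ ∃¹ $1 ≺ $0 ∧ M T $0.

Definition prefix_free (P : nat) : form :=
  ∀¹ ∀¹ ¬ ($1 ∈ P ∧ $0 ∈ P ∧ initial $1 $0 ∧ ¬ ($1 ≐ $0)).

(** there is c such that |P| <= c for every prefix-free set P included in T *)
Definition pf_bounded (M : class) (T : nat) : form :=
  ∃¹ ∀² prefix_free 0 ∧ (∀¹ $0 ∈ 0 ⇒ M (S T) $0) ⇒ card_le 0 $0.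

(** G is a function all of whose finite initial segments are in T *)
Definition path (M : class) (T G : nat) : form :=
  function G
  ∧ ∀¹ (is_seq $0 ∧ (∀¹ ∀¹ entry $2 $1 $0 ⇒ cpair $1 $0 ∈ G) ⇒ M T $0).

(** Set variable 0 is the enumeration of the tree, not the tree itself. *)
Definition Sigma01_WKL_pf_bd : form :=
  ∀² function 0
     ∧ (∀¹ as_range 0 $0 ⇒ binary $0)
     ∧ tree as_range 0
     ∧ infinite as_range 0
     ∧ pf_bounded as_range 0
     ⇒ ∃² path as_range 1 0.

Definition KL_pf_bd : form :=
  ∀² tree as_set 0
     ∧ infinite as_set 0
     ∧ pf_bounded as_set 0
     ⇒ ∃² path as_set 1 0.

(* Main.v *)
(** By completeness it suffices to argue in an arbitrary model of RCA0.

    Given bounding, take in the tree a finite prefix-free set of maximal size.  Every node is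
    comparable with one of its elements, so bounding provides an element that has unboundedly
    many extensions in the tree.  By maximality these extensions are pairwise comparable, and
    their union is a path.

    Conversely, suppose that every x < n has a witness w, given by a Pi^0_1 condition, but that
    the witnesses are unbounded.  The tree with one branch for each x < n that grows as long as
    the candidates w = 0, 1, 2, ... for x are refuted is then infinite.  Two nodes of the same
    branch are comparable, so prefix-free sets are bounded by the number of branches, and a path
    refutes all candidates for some x. *)

From HB Require Import structures.
From mathcomp Require Import all_boot all_order all_algebra.
From mathcomp Require Import boolp.
From mathcomp Require Import ring lra.
From Stdlib Require Import List Lia Cantor ClassicalEpsilon.
Require Import Defs.
Import Order.TTheory GRing.Theory Num.Theory.

Set Implicit Arguments.
Unset Strict Implicit.
Unset Printing Implicit Defensive.

Local Open Scope fm_scope.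
Local Notation form := Defs.form.
Local Notation lift := Defs.lift.
Local Notation subst := Defs.subst.
Local Notation In := List.In.
Local Notation incl := List.incl.
Local Notation map := List.map.

(** * Semantics and completeness *)

(** Models may be nonstandard and provide induction for Sigma^0_1 formulas only, which shapes every
    step. A maximal size can be spoken of because having a prefix-free set of size [k] is Sigma^0_1,
    even when the tree is merely enumerated. That all extensions of an element lie below [b] is
    Pi^0_1, so this is an instance of bounding: if every cone were bounded, one bound would serve
    for the whole tree. The path exists as a set because one long node of the cone decides
    [G(j) = x], which makes both this relation and its negation Sigma^0_1. In the converse, a
    Sigma^0_2 condition becomes Pi^0_1 by pairing the witness with that of the leading quantifier. A
    branch in N^{<N} can record the least refutations themselves, so that its tree is a set. A
    binary branch can only record how many candidates have been refuted, so its tree is merely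
    enumerated. *)

Definition scons {A : Type} (x : A) (e : nat -> A) (i : nat) : A :=
  match i with 0 => x | S j => e j end.

Notation "x .: e" := (scons x e) (at level 55, right associativity).

(* [mset] only serves to make the type of set valuations inhabited. *)
Record model := Model {
  dom :> Type;
  sets : Type;
  mzero : dom;
  mone : dom;
  madd : dom -> dom -> dom;
  mmul : dom -> dom -> dom;
  mlt : dom -> dom -> Prop;
  mset : sets;
  mem : dom -> sets -> Prop }.

Fixpoint eval (m : model) (e : nat -> m) (t : tm) : m :=
  match t with
  | Var i => e i
  | Zero => mzero m
  | One => mone m
  | Plus t u => madd (eval e t) (eval e u)
  | Times t u => mmul (eval e t) (eval e u)
  end.

Fixpoint sat (m : model) (e : nat -> m) (E : nat -> sets m) (p : form) : Prop :=
  match p with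
  | Bot => False
  | Eq t u => eval e t = eval e u
  | Lt t u => mlt (eval e t) (eval e u)
  | Mem t X => mem (eval e t) (E X)
  | Imp p q => sat e E p -> sat e E q
  | All1 p => forall x, sat (x .: e) E p
  | All2 p => forall X, sat e (X .: E) p
  end.

Definition models (m : model) (A : theory) : Prop :=
  forall p e E, A p -> sat (m := m) e E p.

(** * Calculus of substitutions and its semantics *)

Lemma tsubst_comp s s' t : tsubst s' (tsubst s t) = tsubst (fun i => tsubst s' (s i)) t.
Proof. by elim: t => //= t -> u ->. Qed.

Lemma tsubst_id t : tsubst Var t = t.
Proof. by elim: t => //= t -> u ->. Qed.

Lemma up1_comp s s' :
  (fun i => tsubst (up1 s') (up1 s i)) = up1 (fun i => tsubst s' (s i)).
Proof.
by apply: funext => -[|i] //=; rewrite /lift !tsubst_comp.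
Qed.

Lemma up1_id : up1 Var = Var.
Proof. by apply: funext => -[|i]. Qed.

Lemma up2_id : up2 id2 = id2.
Proof. by apply: funext => -[|i]. Qed.

Lemma subst_comp s r s' r' p :
  subst s' r' (subst s r p) = subst (fun i => tsubst s' (s i)) (fun X => r' (r X)) p.
Proof.
elim: p s r s' r' => //= [t u|t u|t X|p IHp q IHq|p IH|p IH] s r s' r';
  rewrite ?tsubst_comp ?IHp ?IHq ?IH //.
- by rewrite up1_comp.
- congr (All2 (subst _ _ _)).
  by apply: funext => -[|i].
Qed.

Lemma subst_id p : subst Var id2 p = p.
Proof.
elim: p => //= [t u|t u|t X|p -> q ->|p IH|p IH] //; rewrite ?tsubst_id //.
- by rewrite up1_id IH.
- by rewrite up2_id IH.
Qed.

Lemma inst1E t p : inst1 t p = subst (t .: Var) id2 p.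
Proof. by []. Qed.

Lemma inst2E Y p : inst2 Y p = subst Var (Y .: id2) p.
Proof. by []. Qed.

Lemma subst_inst1 s r t p :
  subst s r (inst1 t p) = inst1 (tsubst s t) (subst (up1 s) r p).
Proof.
rewrite !inst1E !subst_comp; congr (subst _ _ _).
by apply: funext => -[|i] //=; rewrite /lift tsubst_comp tsubst_id.
Qed.

Lemma subst_inst2 s r Y p :
  subst s r (inst2 Y p) = inst2 (r Y) (subst s (up2 r) p).
Proof.
rewrite !inst2E !subst_comp; congr (subst _ _ _); apply: funext.
- by move=> i /=; rewrite tsubst_id.
- by case.
Qed.

Lemma eval_subst (m : model) (e : nat -> m) s t :
  eval e (tsubst s t) = eval (fun i => eval e (s i)) t.
Proof. by elim: t => //= t -> u ->. Qed.

Lemma eval_up1 (m : model) (e : nat -> m) x s :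
  (fun i => eval (x .: e) (up1 s i)) = x .: (fun i => eval e (s i)).
Proof. by apply: funext => -[|i] //=; rewrite /lift eval_subst. Qed.

Lemma sat_subst (m : model) (e : nat -> m) E s r p :
  sat e E (subst s r p) <-> sat (fun i => eval e (s i)) (fun X => E (r X)) p.
Proof.
elim: p e E s r => //= [t u|t u|t X|p IHp q IHq|p IH|p IH] e E s r;
  rewrite ?eval_subst ?IHp ?IHq //.
- by split=> H x; move: (H x); rewrite IH eval_up1.
- have up2E X : (fun Y => (X .: E) (up2 r Y)) = X .: (fun Y => E (r Y)).
    by apply: funext => -[|i].
  by split=> H X; move: (H X); rewrite IH up2E.
Qed.

Lemma tfresh t : exists n, forall s s', (forall i, i < n -> s i = s' i) -> tsubst s t = tsubst s' t.
Proof.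
elim: t => [i|||t [n Hn] u [k Hk]|t [n Hn] u [k Hk]].
- by exists i.+1 => s s' /(_ i) /=; apply.
- by exists 0.
- by exists 0.
- exists (maxn n k) => s s' H /=; rewrite (Hn s s') ?(Hk s s') // => i Hi; apply: H;
    by rewrite leq_max Hi ?orbT.
- exists (maxn n k) => s s' H /=; rewrite (Hn s s') ?(Hk s s') // => i Hi; apply: H;
    by rewrite leq_max Hi ?orbT.
Qed.

(** All free variables of both sorts lie below [n]. This is expressed by the action of
    substitutions, the form in which freshness is used. *)
Definition bounded_vars (n : nat) (p : form) : Prop :=
  forall s s' r r', (forall i, i < n -> s i = s' i) -> (forall i, i < n -> r i = r' i) ->
  subst s r p = subst s' r' p.

Lemma bounded_vars_le n k p : n <= k -> bounded_vars n p -> bounded_vars k p.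
Proof.
move=> le H s s' r r' Hs Hr; apply: H => i Hi; [apply: Hs|apply: Hr]; exact: leq_trans le.
Qed.

Lemma fresh p : exists n, bounded_vars n p.
Proof.
elim: p => [|t u|t u|t X|p [n Hn] q [k Hk]|p [n Hn]|p [n Hn]].
- by exists 0.
- have [n Hn] := tfresh t; have [k Hk] := tfresh u.
  exists (maxn n k) => s s' r r' Hs _ /=.
  by rewrite (Hn s s') ?(Hk s s') // => i Hi; apply: Hs; rewrite leq_max Hi ?orbT.
- have [n Hn] := tfresh t; have [k Hk] := tfresh u.
  exists (maxn n k) => s s' r r' Hs _ /=.
  by rewrite (Hn s s') ?(Hk s s') // => i Hi; apply: Hs; rewrite leq_max Hi ?orbT.
- have [n Hn] := tfresh t.
  exists (maxn n X.+1) => s s' r r' Hs Hr /=.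
  rewrite (Hn s s') ?Hr //; first by rewrite leq_max leqnn orbT.
  by move=> i Hi; apply: Hs; rewrite leq_max Hi.
- exists (maxn n k) => s s' r r' Hs Hr /=.
  by rewrite (Hn s s' r r') ?(Hk s s' r r') // => i Hi;
     [apply: Hs|apply: Hr|apply: Hs|apply: Hr]; rewrite leq_max Hi ?orbT.
- exists n => s s' r r' Hs Hr /=; congr All1; apply: Hn => // -[|i] Hi //=.
  by rewrite Hs // ltnW.
- exists n => s s' r r' Hs Hr /=; congr All2; apply: Hn => // -[|i] Hi //=.
  by rewrite Hr // ltnW.
Qed.

Lemma fresh_list (G : list form) : exists n, forall p, In p G -> bounded_vars n p.
Proof.
elim: G => [|p G [n Hn]]; first by exists 0.
have [k Hk] := fresh p; exists (maxn n k) => q [<-|/Hn Hq].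
- by apply: bounded_vars_le Hk; rewrite leq_maxr.
- by apply: bounded_vars_le Hq; rewrite leq_maxl.
Qed.

(** ** Admissible rules *)

Lemma weaken A G p : proves A G p -> forall G', incl G G' -> proves A G' p.
Proof.
elim=> {G p}.
- by move=> G p H G' HG; apply: P_hyp; apply: HG.
- by move=> *; apply: P_ax.
- move=> G p q _ IH G' HG; apply/P_imp_i/IH => r [->|/HG Hr]; by [left|right].
- by move=> G p q _ IH _ IH' G' HG; apply: P_imp_e (IH _ HG) (IH' _ HG).
- by move=> G p _ IH G' HG; apply/P_dn/IH.
- move=> G p _ IH G' HG; apply/P_all1_i/IH => q /in_map_iff [r [<- /HG Hr]]; exact: in_map.
- by move=> G p t _ IH G' HG; apply/P_all1_e/IH.
- move=> G p _ IH G' HG; apply/P_all2_i/IH => q /in_map_iff [r [<- /HG Hr]]; exact: in_map.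
- by move=> G p t _ IH G' HG; apply/P_all2_e/IH.
- by move=> *; apply: P_eq_refl.
- by move=> G p t u _ IH _ IH' G' HG; apply: P_eq_e (IH _ HG) (IH' _ HG).
Qed.

(** Quantifying over all contexts makes generalisation free: the shifted context is just another
    context. *)
Definition valid (A : theory) (p : form) : Prop := forall G, proves A G p.

Lemma valid_inst1 A p t : valid A p -> valid A (inst1 t p).
Proof. by move=> H G; apply/P_all1_e/P_all1_i/H. Qed.

Lemma valid_inst2 A p Y : valid A p -> valid A (inst2 Y p).
Proof. by move=> H G; apply/P_all2_e/P_all2_i/H. Qed.

(* Simultaneous substitution by iterated instantiation: the first term is
   lifted past the instantiations still to come. *)
Lemma valid_subst1 A n p s :
  valid A p -> valid A (subst (fun i => if i < n then s i else Var (i - n)) id2 p).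
Proof.
elim: n p s => [|n IH] p s H.
  rewrite (_ : (fun i => _) = Var) ?subst_id //.
  by apply: funext => i; rewrite subn0.
have := IH _ (fun i => s i.+1) (valid_inst1 (lift n (s 0)) H).
rewrite inst1E subst_comp; congr (valid _ (subst _ _ _)).
apply: funext => -[|i] //=.
rewrite /lift tsubst_comp -[RHS]tsubst_id; congr tsubst; apply: funext => i /=.
rewrite plusE ltnNge leq_addr /=; congr Var; lia.
Qed.

Lemma valid_subst2 A n p r :
  valid A p -> valid A (subst Var (fun i => if i < n then r i else i - n) p).
Proof.
elim: n p r => [|n IH] p r H.
  rewrite (_ : (fun i => _) = id2) ?subst_id //.
  by apply: funext => i; rewrite subn0.
have := IH _ (fun i => r i.+1) (valid_inst2 (n + r 0) H).
rewrite inst2E subst_comp; congr (valid _ (subst _ _ _)).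
apply: funext => -[|i] //=.
rewrite ltnNge leq_addr /=; lia.
Qed.

(** Only finitely many variables matter to [p], so finitely many instantiations have the effect of
    an arbitrary substitution. *)
Lemma valid_subst A p s r : valid A p -> valid A (subst s r p).
Proof.
have [n Hn] := fresh p => H.
have := valid_subst1 n s (valid_subst2 n r H).
rewrite subst_comp /id2 /=; congr valid; apply: Hn => i Hi; by rewrite Hi.
Qed.

(** The axiom case rests on axioms standing for their universal closures: [valid_subst] instantiates
    them. *)
Lemma proves_subst A G p : proves A G p ->
  forall s r, proves A (map (subst s r) G) (subst s r p).
Proof.
elim=> {G p}.
- by move=> G p H s r; apply: P_hyp; apply: in_map.
- by move=> G p H s r; apply: valid_subst => G'; apply: P_ax.
- by move=> G p q _ IH s r; apply/P_imp_i/IH.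
- by move=> G p q _ IH _ IH' s r; apply: P_imp_e (IH s r) (IH' s r).
- by move=> G p _ IH s r; apply/P_dn/IH.
- move=> G p _ IH s r /=; apply: P_all1_i; have := IH (up1 s) r; congr proves.
  rewrite !List.map_map; apply: List.map_ext => q; rewrite /shift1 !subst_comp.
  by congr subst; apply: funext => i.
- by move=> G p t _ IH s r; rewrite subst_inst1; apply/P_all1_e/IH.
- move=> G p _ IH s r /=; apply: P_all2_i; have := IH s (up2 r); congr proves.
  rewrite !List.map_map; apply: List.map_ext => q; rewrite /shift2 !subst_comp.
  by congr subst; apply: funext => i /=; rewrite ?tsubst_id.
- by move=> G p t _ IH s r; rewrite subst_inst2; apply/P_all2_e/IH.
- by move=> *; apply: P_eq_refl.
- move=> G p t u _ IH _ IH' s r; rewrite subst_inst1; apply: P_eq_e (IH s r) _.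
  by rewrite -subst_inst1.
Qed.

Lemma all1_fresh A G p n :
  (forall q, In q G -> bounded_vars n q) -> bounded_vars n p ->
  proves A G (inst1 (Var n) p) -> proves A G (All1 p).
Proof.
move=> HG Hp H; apply: P_all1_i.
(* This renaming sends the fresh variable [n] to 0 and shifts all variables below it, so it turns
   [inst1 (Var n) p] back into [p] and [G] into its shift. *)
have := proves_subst H (fun i => if i < n then Var i.+1 else Var 0) id2.
rewrite (_ : map _ G = map shift1 G); last first.
  by apply: List.map_ext_in => q /HG; apply=> // i ->.
congr proves; rewrite inst1E subst_comp -[RHS]subst_id; apply: Hp => // -[|i] Hi /=.
  by rewrite ltnn.
by rewrite ltnW.
Qed.

Lemma all2_fresh A G p n :
  (forall q, In q G -> bounded_vars n q) -> bounded_vars n p ->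
  proves A G (inst2 n p) -> proves A G (All2 p).
Proof.
move=> HG Hp H; apply: P_all2_i.
have := proves_subst H Var (fun i => if i < n then i.+1 else 0).
rewrite (_ : map _ G = map shift2 G); last first.
  by apply: List.map_ext_in => q /HG; apply=> // i ->.
congr proves; rewrite inst2E subst_comp -[RHS]subst_id; apply: Hp => // -[|i] Hi /=.
  by rewrite ltnn.
by rewrite /id2 ltnW.
Qed.

Lemma hyp A G p : In p G -> proves A G p.
Proof. exact: P_hyp. Qed.

Lemma modus_ponens A G p q : proves A G (Imp p q) -> proves A G p -> proves A G q.
Proof. exact: P_imp_e. Qed.

(** * Henkin's construction of a complete extension *)

Definition consistent (A : theory) (G : list form) : Prop := ~ proves A G Bot.

Lemma contradiction A G p : proves A (Neg p :: G) Bot -> proves A G p.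
Proof. by move=> H; apply/P_dn/P_imp_i. Qed.

Lemma hyp0 A G p : proves A (p :: G) p.
Proof. by apply: hyp; left. Qed.

Lemma proves_weak1 A G p q : proves A G p -> proves A (q :: G) p.
Proof. by move=> H; apply: weaken H _ _ => r; right. Qed.

Lemma exfalso_proves A G p : proves A G Bot -> proves A G p.
Proof. by move=> H; apply/contradiction/proves_weak1. Qed.

Definition henkin_step (A : theory) (f : form) (G G' : list form) : Prop :=
  [/\ incl G G', consistent A G', In f G' \/ In (Neg f) G',
      (forall p, f = All1 p -> In (Neg f) G' -> exists t, In (Neg (inst1 t p)) G')
    & (forall p, f = All2 p -> In (Neg f) G' -> exists Y, In (Neg (inst2 Y p)) G')].

Lemma henkin_step_ex A f G : consistent A G -> exists G', henkin_step A f G G'.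
Proof.
move=> cG; case: (pselect (consistent A (f :: G))) => cf.
  exists (f :: G); split=> //; first by move=> q; right.
  - by left; left.
  - move=> p fE [|] H.
      by move/(f_equal (fun q => if q is All1 _ then true else false)): H; rewrite fE.
    by case: cf; apply: modus_ponens (hyp0 _ _ _); apply/proves_weak1/hyp.
  - move=> p fE [|] H.
      by move/(f_equal (fun q => if q is All2 _ then true else false)): H; rewrite fE.
    by case: cf; apply: modus_ponens (hyp0 _ _ _); apply/proves_weak1/hyp.
have Nf : proves A G (Neg f).
  by apply: P_imp_i; apply: contrapT cf.
have cN : consistent A (Neg f :: G).
  by move=> H; apply/cG/modus_ponens/Nf/P_imp_i.
have [n Hn] := fresh_list (Neg f :: G).
(* A negated instance [g] may be added if provability of [g] would give back [f], since [Neg f] is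
   consistent with [G]. For an instance at a fresh variable the generalisation lemmas supply
   this. *)
have step g : (proves A (Neg f :: G) g -> proves A (Neg f :: G) f) ->
    consistent A (Neg g :: Neg f :: G).
  by move=> Hg /contradiction/Hg H; apply/cN/modus_ponens/H/hyp0.
case fE : f => [|t u|t u|t X|p q|p|p]; try by
  exists (Neg f :: G); rewrite -fE; split=> //; [by move=> q'; right|by right; left|
    by rewrite fE|by rewrite fE].
- have [k Hk] := fresh p.
  exists (Neg (inst1 (Var (maxn n k)) p) :: Neg f :: G); rewrite -fE; split.
  + by move=> q Hq; right; right.
  + apply: step; rewrite fE; apply: all1_fresh; rewrite -?fE.
      by move=> q /Hn; apply: bounded_vars_le; rewrite leq_maxl.
    by apply: bounded_vars_le Hk; rewrite leq_maxr.
  + by right; right; left.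
  + by move=> q; rewrite fE => -[<-] _; eexists; left.
  + by move=> q; rewrite fE.
- have [k Hk] := fresh p.
  exists (Neg (inst2 (maxn n k) p) :: Neg f :: G); rewrite -fE; split.
  + by move=> q Hq; right; right.
  + apply: step; rewrite fE; apply: all2_fresh; rewrite -?fE.
      by move=> q /Hn; apply: bounded_vars_le; rewrite leq_maxl.
    by apply: bounded_vars_le Hk; rewrite leq_maxr.
  + by right; right; left.
  + by move=> q; rewrite fE.
  + by move=> q; rewrite fE => -[<-] _; eexists; left.
Qed.

Definition npair (i j : nat) : nat := Cantor.to_nat (i, j).

Lemma npair_inj i j k l : npair i j = npair k l -> i = k /\ j = l.
Proof. by move/Cantor.to_nat_inj => [-> ->]. Qed.

Local Opaque npair.

Fixpoint tm_code (t : tm) : nat :=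
  match t with
  | Var i => npair 0 (i)
  | Zero => npair 1 (0)
  | One => npair 2 (0)
  | Plus t u => npair 3 (npair (tm_code t) (tm_code u))
  | Times t u => npair 4 (npair (tm_code t) (tm_code u))
  end.

Fixpoint form_code (p : form) : nat :=
  match p with
  | Bot => npair 0 (0)
  | Eq t u => npair 1 (npair (tm_code t) (tm_code u))
  | Lt t u => npair 2 (npair (tm_code t) (tm_code u))
  | Mem t X => npair 3 (npair (tm_code t) X)
  | Imp p q => npair 4 (npair (form_code p) (form_code q))
  | All1 p => npair 5 (form_code p)
  | All2 p => npair 6 (form_code p)
  end.

Lemma tm_code_inj t u : tm_code t = tm_code u -> t = u.
Proof.
elim: t u => [i|||t IHt t' IHt'|t IHt t' IHt'] [j|||u u'|u u'] //= /npair_inj [] //.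
- by move=> _ ->.
- by move=> _ /npair_inj [/IHt -> /IHt' ->].
- by move=> _ /npair_inj [/IHt -> /IHt' ->].
Qed.

Lemma form_code_inj p q : form_code p = form_code q -> p = q.
Proof.
elim: p q => [|t t'|t t'|t X|p IHp p' IHp'|p IHp|p IHp] [|u u'|u u'|u Y|q q'|q|q] //=
  /npair_inj [] // _.
- by move=> /npair_inj [/tm_code_inj -> /tm_code_inj ->].
- by move=> /npair_inj [/tm_code_inj -> /tm_code_inj ->].
- by move=> /npair_inj [/tm_code_inj -> ->].
- by move=> /npair_inj [/IHp -> /IHp' ->].
- by move=> /IHp ->.
- by move=> /IHp ->.
Qed.

(** A preimage under the injective coding is chosen; at numbers that code no formula the value is
    arbitrary. *)
Lemma form_enum : exists enm : nat -> form, forall p, exists n, enm n = p.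
Proof.
exists (fun n => epsilon (inhabits Bot) (fun p => form_code p = n)) => p.
exists (form_code p); apply: form_code_inj.
exact: (epsilon_spec _ (fun q => form_code q = form_code p) (ex_intro _ p erefl)).
Qed.

Section Completion.
Variables (A : theory) (G0 : list form).
Hypothesis cG0 : consistent A G0.

Lemma henkin_sequence : exists (enm : nat -> form) (G : nat -> list form),
  [/\ forall p, exists n, enm n = p, G 0 = G0 &
      forall n, henkin_step A (enm n) (G n) (G n.+1)].
Proof.
have [enm He] := form_enum; exists enm.
have nxt f (G : {G | consistent A G}) : {G' | consistent A G' /\ henkin_step A f (proj1_sig G) G'}.
  apply: constructive_indefinite_description.
  by have [G' HG'] := henkin_step_ex f (proj2_sig G); exists G'; split=> //; case: HG'.
pose fix G n : {G | consistent A G} :=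
  if n is n'.+1 then
    let H := nxt (enm n') (G n') in exist _ (proj1_sig H) (proj1 (proj2_sig H))
  else exist _ G0 cG0.
exists (fun n => proj1_sig (G n)); split=> // n /=.
by case: (proj2_sig (nxt (enm n) (G n))).
Qed.

(** Tarski's truth conditions, with terms and set variables as the instances of the two quantifiers,
    together with the replacement property by which equality in [T] can be divided out. *)
Definition complete_extension (T : form -> Prop) : Prop :=
  [/\ forall p, In p G0 -> T p,
      forall p q, T (Imp p q) <-> (T p -> T q), ~ T Bot,
      forall p, T (All1 p) <-> forall t, T (inst1 t p)
    & forall p, T (All2 p) <-> forall Y, T (inst2 Y p)]
  /\ [/\ forall p, valid A p -> T p, forall t, T (Eq t t)
    & forall t u p, T (Eq t u) -> T (inst1 t p) -> T (inst1 u p)].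

Lemma complete_extension_ex : exists T, complete_extension T.
Proof.
have [enm [G [He G0E HG]]] := henkin_sequence.
have Gmono n k : n <= k -> incl (G n) (G k).
  elim: k => [|k IH]; first by rewrite leqn0 => /eqP ->.
  rewrite leq_eqVlt => /orP [/eqP -> //|/IH H].
  by move=> q /H; case: (HG k) => + _ _ _ _; apply.
have Gcons n : consistent A (G n).
  case: n => [|n]; first by rewrite G0E.
  by case: (HG n).
pose T p := exists n, In p (G n).
have Tdec p : T p \/ T (Neg p).
  have [n <-] := He p; case: (HG n) => _ _ [] H _ _; [left|right]; by exists n.+1.
(* A formula proved at some stage is decided later, and its negation would contradict the
   consistency of the later stage. *)
have Tded n p : proves A (G n) p -> T p.
  move=> H; case: (Tdec p) => // -[k Hk]; exfalso; apply: (Gcons (maxn n k)).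
  apply: (@modus_ponens _ _ p); first by apply: hyp; apply: Gmono Hk; rewrite leq_maxr.
  by apply: weaken H _ (Gmono _ _ _); rewrite leq_maxl.
have Tded2 p q r : (forall G, In p G -> In q G -> proves A G r) -> T p -> T q -> T r.
  move=> H [n Hn] [k Hk]; apply: (Tded (maxn n k)); apply: H.
    by apply: Gmono Hn; rewrite leq_maxl.
  by apply: Gmono Hk; rewrite leq_maxr.
have Tbot : ~ T Bot by move=> [n Hn]; apply: (Gcons n); apply: hyp.
have Tneg p : T (Neg p) -> ~ T p.
  move=> H1 H2; apply: Tbot; apply: Tded2 H1 H2 => G' H1 H2.
  by apply: modus_ponens (hyp _ H1) (hyp _ H2).
have Tded1 p r : (forall G, In p G -> proves A G r) -> T p -> T r.
  by move=> H [n Hn]; apply: (Tded n); apply: H.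
exists T; split; split.
- by move=> p Hp; exists 0; rewrite G0E.
- move=> p q; split.
    by apply: Tded2 => G' H1 H2; apply: modus_ponens (hyp _ H1) (hyp _ H2).
  case: (Tdec p) => [Tp /(_ Tp)|Tp _].
    by apply: Tded1 => G' H; apply/P_imp_i/proves_weak1/hyp.
  apply: Tded1 Tp => G' H; apply/P_imp_i/exfalso_proves.
  by apply: modus_ponens (hyp0 _ _ _); apply/proves_weak1/hyp.
- by [].
- move=> p; split.
    by move=> H t; apply: Tded1 H => G' H; apply/P_all1_e/hyp.
  (* If the universal formula is refuted at its stage, that stage also holds a negated instance,
     against [H]. *)
  move=> H; have [n fE] := He (All1 p); case: (HG n) => _ _ D W _.
  case: D; first by rewrite fE => D; exists n.+1.
  move=> /(W _ fE) [t Ht]; have := H t; have : T (Neg (inst1 t p)) by exists n.+1.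
  by move=> /Tneg.
- move=> p; split.
    by move=> H t; apply: Tded1 H => G' H; apply/P_all2_e/hyp.
  move=> H; have [n fE] := He (All2 p); case: (HG n) => _ _ D _ W.
  case: D; first by rewrite fE => D; exists n.+1.
  move=> /(W _ fE) [t Ht]; have := H t; have : T (Neg (inst2 t p)) by exists n.+1.
  by move=> /Tneg.
- by move=> p H; apply: (Tded 0).
- by move=> t; apply: (Tded 0); apply: P_eq_refl.
- move=> t u p; apply: Tded2 => G' H1 H2.
  by apply: P_eq_e (hyp _ H1) (hyp _ H2).
Qed.

End Completion.

(** * The term model *)

Section TermModel.
Variables (A : theory) (G0 : list form) (T : form -> Prop).
Hypothesis HT : complete_extension A G0 T.

Let Trefl t : T (Eq t t).
Proof. by case: HT => _ []. Qed.

Let Trepl t u p : T (Eq t u) -> T (inst1 t p) -> T (inst1 u p).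
Proof. by case: HT => _ [_ _]; apply. Qed.

Let liftK t u : tsubst (t .: Var) (lift 1 u) = u.
Proof. by rewrite /lift tsubst_comp tsubst_id. Qed.

Let Tsym t u : T (Eq t u) -> T (Eq u t).
Proof.
move=> H; have := Trepl (p := Eq (Var 0) (lift 1 t)) H.
by rewrite !inst1E /= !liftK; apply.
Qed.

Let Ttrans t u v : T (Eq t u) -> T (Eq u v) -> T (Eq t v).
Proof.
move=> H K; have := Trepl (p := Eq (lift 1 t) (Var 0)) K.
by rewrite !inst1E /= !liftK; apply.
Qed.

Definition tclass (t : tm) : tm -> Prop := fun u => T (Eq t u).
Definition term_dom : Type := {C : tm -> Prop | exists t, C = tclass t}.
Definition cls (t : tm) : term_dom := exist _ (tclass t) (ex_intro _ t erefl).

Lemma cls_eq t u : cls t = cls u <-> T (Eq t u).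
Proof.
split=> [H|H].
  have : tclass t = tclass u by case: H.
  by move/(f_equal (@^~ u)); rewrite /tclass => ->.
apply: eq_exist; apply: funext => v; apply: propext; split.
- by apply: Ttrans; apply: Tsym.
- exact: Ttrans.
Qed.

Lemma cls_surj (x : term_dom) : exists t, cls t = x.
Proof. by case: x => C CE; have [t Ct] := CE; exists t; apply: eq_exist; rewrite Ct. Qed.

Definition rep (x : term_dom) : tm :=
  proj1_sig (constructive_indefinite_description _ (cls_surj x)).

Lemma repK x : cls (rep x) = x.
Proof. by rewrite /rep; case: constructive_indefinite_description. Qed.

(** Equality is primitive for numbers only: terms are divided by equality in [T], while the set
    variables themselves form the second sort. *)
Definition term_model : model := {|
  dom := term_dom;
  sets := nat;
  mzero := cls Zero;
  mone := cls One;
  madd x y := cls (Plus (rep x) (rep y));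
  mmul x y := cls (Times (rep x) (rep y));
  mlt x y := T (Lt (rep x) (rep y));
  mset := 0;
  mem x X := T (Mem (rep x) X) |}.

Let Trep t : T (Eq (rep (cls t)) t).
Proof. by apply/cls_eq; rewrite repK. Qed.

Lemma eval_term (s : nat -> tm) t : eval (m := term_model) (fun i => cls (s i)) t = cls (tsubst s t).
Proof.
elim: t => //= [t -> u ->|t -> u ->]; apply/cls_eq.
- have := Trepl (p := Eq (Plus (lift 1 (rep (cls (tsubst s t)))) (lift 1 (rep (cls (tsubst s u)))))
     (Plus (Var 0) (lift 1 (rep (cls (tsubst s u)))))) (Trep (tsubst s t)).
  rewrite !inst1E /= !liftK => /(_ (Trefl _)) H.
  have := Trepl (p := Eq (Plus (lift 1 (rep (cls (tsubst s t)))) (lift 1 (rep (cls (tsubst s u)))))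
     (Plus (lift 1 (tsubst s t)) (Var 0))) (Trep (tsubst s u)).
  by rewrite !inst1E /= !liftK; apply.
- have := Trepl (p := Eq (Times (lift 1 (rep (cls (tsubst s t)))) (lift 1 (rep (cls (tsubst s u)))))
     (Times (Var 0) (lift 1 (rep (cls (tsubst s u)))))) (Trep (tsubst s t)).
  rewrite !inst1E /= !liftK => /(_ (Trefl _)) H.
  have := Trepl (p := Eq (Times (lift 1 (rep (cls (tsubst s t)))) (lift 1 (rep (cls (tsubst s u)))))
     (Times (lift 1 (tsubst s t)) (Var 0))) (Trep (tsubst s u)).
  by rewrite !inst1E /= !liftK; apply.
Qed.

Lemma T_lt t u : T (Lt (rep (cls t)) (rep (cls u))) <-> T (Lt t u).
Proof.
have aux v w v' w' : T (Eq v v') -> T (Eq w w') -> T (Lt v w) -> T (Lt v' w').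
  move=> H K L; have := Trepl (p := Lt (Var 0) (lift 1 w)) H.
  rewrite !inst1E /= !liftK => /(_ L) {}L.
  have := Trepl (p := Lt (lift 1 v') (Var 0)) K.
  by rewrite !inst1E /= !liftK => /(_ L).
by split; apply: aux => //; apply: Tsym.
Qed.

Lemma T_mem t X : T (Mem (rep (cls t)) X) <-> T (Mem t X).
Proof.
have aux v v' : T (Eq v v') -> T (Mem v X) -> T (Mem v' X).
  by move=> H; have := Trepl (p := Mem (Var 0) X) H; rewrite !inst1E.
by split; apply: aux => //; apply: Tsym.
Qed.

Lemma truth p s r :
  sat (m := term_model) (fun i => cls (s i)) r p <-> T (subst s r p).
Proof.
have [[_ Timp Tbot Tall1 Tall2] _] := HT.
elim: p s r => [|t u|t u|t X|p IHp q IHq|p IH|p IH] s r; cbn [sat subst].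
- by split.
- by rewrite !eval_term cls_eq.
- by rewrite !eval_term -T_lt.
- by rewrite !eval_term -T_mem.
- by rewrite Timp IHp IHq.
- rewrite Tall1.
  have E t : inst1 t (subst (up1 s) r p) = subst (t .: s) r p.
    rewrite inst1E subst_comp; congr subst; apply: funext => -[|i] //=.
  have C t : cls t .: (fun i => cls (s i)) = (fun i => cls ((t .: s) i)).
    by apply: funext => -[|i].
  split=> [H t|H x]; first by rewrite E -IH -C.
  by have [t <-] := cls_surj x; rewrite C IH -E.
- rewrite Tall2.
  have E Y : inst2 Y (subst s (up2 r) p) = subst s (Y .: r) p.
    rewrite inst2E subst_comp; congr subst; apply: funext => -[|i] //=;
    by rewrite tsubst_id.
  split=> H Y; by have := H Y; rewrite E IH.
Qed.

End TermModel.

Theorem completeness A q :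
  (forall m : model, models m A -> forall e E, sat (m := m) e E q) -> provable A q.
Proof.
move=> H; apply: contrapT => Nq.
have cG : consistent A [:: Neg q] by move=> /contradiction.
have [T HT] := complete_extension_ex cG.
have [[TG Timp Tbot _ _] [Tval _ _]] := HT.
have : T q.
  rewrite -(subst_id q) -(truth HT); apply: H => p e E Ap.
  (* Every valuation of the term model comes from a substitution, so an axiom holds under it because
     validity is closed under substitution. *)
  pose s i := rep (e i).
  rewrite (_ : e = fun i => cls T (s i)); last by apply: funext => i; rewrite repK.
  by rewrite (truth HT); apply/Tval/valid_subst => G; apply: P_ax.
by move=> Tq; apply: Tbot; move: Tq; rewrite -Timp; apply: TG; left.
Qed.

(** * Definability with parameters *)

Section Connectives.
Variables (m : model) (e : nat -> m) (E : nat -> sets m).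

Lemma sat_neg p : sat e E (Neg p) <-> ~ sat e E p.
Proof. by []. Qed.

Lemma sat_imp p q : sat e E (Imp p q) <-> (sat e E p -> sat e E q).
Proof. by []. Qed.

Lemma sat_all1 p : sat e E (All1 p) <-> forall x, sat (x .: e) E p.
Proof. by []. Qed.

Lemma sat_all2 p : sat e E (All2 p) <-> forall X, sat e (X .: E) p.
Proof. by []. Qed.

Lemma sat_and p q : sat e E (And p q) <-> sat e E p /\ sat e E q.
Proof.
split=> [/= H|[Hp Hq] /=]; last by apply.
by split; apply: contrapT => K; apply: H => Hp Hq; apply: K.
Qed.

Lemma sat_or p q : sat e E (Or p q) <-> sat e E p \/ sat e E q.
Proof.
split=> [/= H|[Hp|Hq] //=].
by case: (pselect (sat e E p)) => Hp; [left|right; apply: H].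
Qed.

Lemma sat_iff p q : sat e E (Iff p q) <-> (sat e E p <-> sat e E q).
Proof. by rewrite sat_and. Qed.

Lemma sat_ex1 p : sat e E (Ex1 p) <-> exists x, sat (x .: e) E p.
Proof.
split=> [/= H|[x Hx] /= H]; last by apply: (H x).
by apply: contrapT => N; apply: H => x Hx; apply: N; exists x.
Qed.

Lemma sat_ex2 p : sat e E (Ex2 p) <-> exists X, sat e (X .: E) p.
Proof.
split=> [/= H|[x Hx] /= H]; last by apply: (H x).
by apply: contrapT => N; apply: H => x Hx; apply: N; exists x.
Qed.

Lemma eval_lift k t e' : (forall i, e' (k + i) = e i) -> eval e' (lift k t) = eval e t.
Proof. by move=> H; rewrite /lift eval_subst; congr eval; apply: funext. Qed.

Lemma sat_ball t p : sat e E (Ball t p) <-> forall x, mlt x (eval e t) -> sat (x .: e) E p.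
Proof. by split=> H x; have := H x => /=; rewrite eval_lift. Qed.

Lemma sat_bex t p : sat e E (Bex t p) <-> exists x, mlt x (eval e t) /\ sat (x .: e) E p.
Proof.
rewrite sat_neg sat_ball; split=> [H|[x [Hx Hp]] H]; last exact: H Hx Hp.
by apply: contrapT => N; apply: H => x Hx Hp; apply: N; exists x.
Qed.

End Connectives.

Lemma Delta0_neg p : Delta0 p -> Delta0 (Neg p).
Proof. by move=> H; apply: Defs.D0_imp => //; apply: Defs.D0_bot. Qed.

Lemma Delta0_subst p s r : Delta0 p -> Delta0 (subst s r p).
Proof.
move=> H; elim: H s r => {p} /=; try by constructor.
move=> t p _ IH s r.
rewrite /lift tsubst_comp.
rewrite (_ : tsubst _ t = lift 1 (tsubst s t)); first by constructor.
by rewrite /lift tsubst_comp; congr tsubst.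
Qed.

Definition tail {A : Type} (e : nat -> A) : nat -> A := fun i => e i.+1.

Definition mix {A : Type} (e a : nat -> A) (i : nat) : A :=
  if odd i then a i./2 else e i./2.

Lemma mix_even {A : Type} (e a : nat -> A) i : mix e a i.*2 = e i.
Proof. by rewrite /mix odd_double doubleK. Qed.

Lemma mix_odd {A : Type} (e a : nat -> A) i : mix e a i.*2.+1 = a i.
Proof. by rewrite /mix /= odd_double /= uphalf_double. Qed.

Lemma nat_parity (Q : nat -> Prop) :
  (forall i, Q i.*2) -> (forall i, Q i.*2.+1) -> forall i, Q i.
Proof.
by move=> He Ho i; rewrite -(odd_double_half i); case: odd => /=; rewrite ?add1n ?add0n.
Qed.

(** When the parameters [a] and [b] are merged into [mix a b], parameter [k] of [a] becomes number
    [2k] and parameter [k] of [b] becomes number [2k+1]; even variables, the arguments, stay in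
    place. *)
Definition ren_left (i : nat) : nat := if odd i then (i./2).*2.*2.+1 else i.
Definition ren_right (i : nat) : nat := if odd i then (i./2).*2.+1.*2.+1 else i.

Lemma mix_left {A : Type} (e a b : nat -> A) i : mix e (mix a b) (ren_left i) = mix e a i.
Proof.
elim/nat_parity: i => i; rewrite /ren_left /= odd_double /= ?mix_even //.
by rewrite uphalf_double mix_odd mix_even mix_odd.
Qed.

Lemma mix_right {A : Type} (e a b : nat -> A) i : mix e (mix a b) (ren_right i) = mix e b i.
Proof.
elim/nat_parity: i => i; rewrite /ren_right /= odd_double /= ?mix_even //.
by rewrite uphalf_double !mix_odd.
Qed.

Section Definability.
Variable m : model.
Local Notation M := (dom m).
Local Notation env := (nat -> M).
Local Notation senv := (nat -> sets m).

(* In [mix e a] the even variables are the arguments and the odd ones the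
   parameters, so that parameters can be merged without touching arguments. *)
Definition represents_tm (a : env) (t : tm) (f : env -> M) : Prop :=
  forall e, f e = eval (mix e a) t.

Definition represents (a : env) (E : senv) (p : form) (P : env -> Prop) : Prop :=
  forall e, P e <-> sat (mix e a) E p.

Definition Tm (f : env -> M) : Prop := exists a t, represents_tm a t f.

(** Definability is a property of predicates on valuations, so that later arguments use ordinary
    predicates and meet formulas only through closure lemmas. *)
Definition D0 (P : env -> Prop) : Prop :=
  exists a E p, Delta0 p /\ represents a E p P.

Definition S1 (P : env -> Prop) : Prop :=
  exists Q : M -> env -> Prop,
    D0 (fun e => Q (e 0) (tail e)) /\ forall e, P e <-> exists x, Q x e.

Lemma represents_tm_left a b t f :
  represents_tm a t f -> represents_tm (mix a b) (tsubst (fun i => Var (ren_left i)) t) f.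
Proof.
by move=> H e; rewrite H eval_subst; congr eval; apply: funext => i /=; rewrite mix_left.
Qed.

Lemma represents_tm_right a b t f :
  represents_tm b t f -> represents_tm (mix a b) (tsubst (fun i => Var (ren_right i)) t) f.
Proof.
by move=> H e; rewrite H eval_subst; congr eval; apply: funext => i /=; rewrite mix_right.
Qed.

Lemma represents_left a b E F p P : represents a E p P ->
  represents (mix a b) (mix E F)
    (subst (fun i => Var (ren_left i)) (fun i => i.*2) p) P.
Proof.
move=> H e; rewrite H sat_subst.
rewrite (_ : (fun i => _) = mix e a); last by apply: funext => i /=; rewrite mix_left.
by rewrite (_ : (fun X => _) = E) //; apply: funext => i /=; rewrite mix_even.
Qed.

Lemma represents_right a b E F p P : represents b F p P ->
  represents (mix a b) (mix E F)
    (subst (fun i => Var (ren_right i)) (fun i => i.*2.+1) p) P.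
Proof.
move=> H e; rewrite H sat_subst.
rewrite (_ : (fun i => _) = mix e b); last by apply: funext => i /=; rewrite mix_right.
by rewrite (_ : (fun X => _) = F) //; apply: funext => i /=; rewrite mix_odd.
Qed.

Lemma Tm_common f g : Tm f -> Tm g ->
  exists a t u, represents_tm a t f /\ represents_tm a u g.
Proof.
move=> [a [t Ht]] [b [u Hu]]; exists (mix a b); do 2 eexists.
by split; [exact: represents_tm_left Ht|exact: represents_tm_right Hu].
Qed.

Lemma D0_common P Q : D0 P -> D0 Q -> exists a E p q,
  [/\ Delta0 p, Delta0 q, represents a E p P & represents a E q Q].
Proof.
move=> [a [E [p [Dp Hp]]]] [b [F [q [Dq Hq]]]]; exists (mix a b), (mix E F); do 2 eexists.
split; [| |exact: represents_left Hp|exact: represents_right Hq]; exact: Delta0_subst.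
Qed.

Lemma Tm_var i : Tm (fun e => e i).
Proof.
exists (fun=> mzero m), (Var i.*2) => e /=.
by rewrite mix_even.
Qed.

Lemma Tm_const c : Tm (fun=> c).
Proof. by exists (fun=> c), (Var 1). Qed.

Lemma Tm_add f g : Tm f -> Tm g -> Tm (fun e => madd (f e) (g e)).
Proof.
move=> Hf Hg; have [a [t [u [Ht Hu]]]] := Tm_common Hf Hg.
by exists a, (Plus t u) => e /=; rewrite Ht Hu.
Qed.

Lemma Tm_mul f g : Tm f -> Tm g -> Tm (fun e => mmul (f e) (g e)).
Proof.
move=> Hf Hg; have [a [t [u [Ht Hu]]]] := Tm_common Hf Hg.
by exists a, (Times t u) => e /=; rewrite Ht Hu.
Qed.

Lemma Tm_eval (s : env -> env) t : (forall i, Tm (fun e => s e i)) -> Tm (fun e => eval (s e) t).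
Proof.
move=> Hs; elim: t => [i|||u IHu v IHv|u IHu v IHv] /=; try exact: Tm_const.
- exact: Hs.
- exact: Tm_add.
- exact: Tm_mul.
Qed.

Lemma Tm_subst f (s : env -> env) : Tm f -> (forall i, Tm (fun e => s e i)) ->
  Tm (fun e => f (s e)).
Proof.
move=> [a [t Ht]] Hs.
rewrite (_ : (fun e => f (s e)) = fun e => eval (mix (s e) a) t); last first.
  by apply: funext => e; rewrite Ht.
apply: Tm_eval.
by apply: nat_parity => i; rewrite /mix /= odd_double /= ?doubleK ?uphalf_double;
  [exact: Hs|exact: Tm_const].
Qed.

Lemma D0_ext P Q : (forall e, P e <-> Q e) -> D0 P -> D0 Q.
Proof.
move=> H [a [E [p [Dp Hp]]]]; exists a, E, p; split=> // e.
by rewrite -H Hp.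
Qed.

Lemma D0_atom2 (R : M -> M -> Prop) (c : tm -> tm -> form) f g :
  (forall e E t u, sat e E (c t u) <-> R (eval e t) (eval e u)) ->
  (forall t u, Delta0 (c t u)) ->
  Tm f -> Tm g -> D0 (fun e => R (f e) (g e)).
Proof.
move=> Hc Dc Hf Hg; have [a [t [u [Ht Hu]]]] := Tm_common Hf Hg.
exists a, (fun=> mset m), (c t u); split=> // e.
by rewrite Hc Ht Hu.
Qed.

Lemma D0_eq_tm f g : Tm f -> Tm g -> D0 (fun e => f e = g e).
Proof. by apply: (D0_atom2 (c := Eq)) => //; constructor. Qed.

Lemma D0_lt_tm f g : Tm f -> Tm g -> D0 (fun e => mlt (f e) (g e)).
Proof. by apply: (D0_atom2 (c := Lt)) => //; constructor. Qed.

Lemma D0_mem_tm f X : Tm f -> D0 (fun e => mem (f e) X).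
Proof.
move=> [a [t Ht]]; exists a, (fun=> X), (Mem t 0); split; first by constructor.
by move=> e /=; rewrite Ht.
Qed.

Lemma D0_false : D0 (fun=> False).
Proof.
by exists (fun=> mzero m), (fun=> mset m), Bot; split; first by constructor.
Qed.

Lemma D0_imp P Q : D0 P -> D0 Q -> D0 (fun e => P e -> Q e).
Proof.
move=> HP HQ; have [a [E [p [q [Dp Dq Hp Hq]]]]] := D0_common HP HQ.
exists a, E, (Imp p q); split; first by constructor.
by move=> e /=; rewrite Hp Hq.
Qed.

Lemma D0_not P : D0 P -> D0 (fun e => ~ P e).
Proof. by move=> H; apply: D0_imp => //; apply: D0_false. Qed.

Lemma D0_and P Q : D0 P -> D0 Q -> D0 (fun e => P e /\ Q e).
Proof.
move=> HP HQ; apply: (D0_ext (P := fun e => ~ (P e -> ~ Q e))).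
  by move=> e; split=> [/not_implyP [? /contrapT ?]|[HPe HQe] /(_ HPe)].
by apply/D0_not/D0_imp/D0_not.
Qed.

Lemma D0_or P Q : D0 P -> D0 Q -> D0 (fun e => P e \/ Q e).
Proof.
move=> HP HQ; apply: (D0_ext (P := fun e => ~ P e -> Q e)).
  move=> e; split=> [H|[]] //.
  by case: (pselect (P e)) => HPe; [left|right; apply: H].
by apply: D0_imp => //; apply: D0_not.
Qed.

Lemma D0_iff P Q : D0 P -> D0 Q -> D0 (fun e => P e <-> Q e).
Proof. by move=> HP HQ; apply: D0_and; apply: D0_imp. Qed.

Lemma D0_true : D0 (fun=> True).
Proof. by apply: (D0_ext _ (D0_not D0_false)) => e; split=> // _ []. Qed.

Lemma D0_ball_tm f (Q : M -> env -> Prop) :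
  Tm f -> D0 (fun e => Q (e 0) (tail e)) -> D0 (fun e => forall x, mlt x (f e) -> Q x e).
Proof.
move=> [b [t0 Ht0]] [a0 [E0 [p0 [Dp0 Hp0]]]].
have [a [E [p [t [Dp Hp Ht]]]]] : exists a E p t,
    [/\ Delta0 p, represents a E p (fun e => Q (e 0) (tail e)) & represents_tm a t f].
  exists (mix a0 b), (mix E0 E0); do 2 eexists.
  split; [|exact: represents_left Hp0|exact: represents_tm_right Ht0]; exact: Delta0_subst.
(* The quantified variable shifts [mix e a] by one and thereby swaps parities: a parameter with odd
   index [i] is found at [i + 1], an argument with positive even index [i] at [i - 1]. *)
pose u i := if odd i then i.+1 else i.-1.
exists a, E, (Ball t (subst (fun i => Var (if i == 0 then 0 else u i)) id2 p)).
split; first by constructor; apply: Delta0_subst.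
move=> e; rewrite sat_ball Ht.
have H x : sat (x .: mix e a) E (subst (fun i => Var (if i == 0 then 0 else u i)) id2 p)
    <-> Q x e.
  rewrite sat_subst (_ : (fun i => _) = mix (x .: e) a); first exact: iff_sym (Hp _).
  apply: funext; apply: nat_parity => i; rewrite /u /= ?odd_double /=.
  - rewrite mix_even; case: i => [|i] //=.
    exact: mix_even.
  - by rewrite !mix_odd.
by split=> K x Hx; apply/H/K.
Qed.

Lemma D0_sat (s : env -> env) E p : Delta0 p -> (forall i, Tm (fun e => s e i)) ->
  D0 (fun e => sat (s e) E p).
Proof.
move=> Dp; elim: Dp s => /= {p} [|t u|t u|t X|p q _ IHp _ IHq|t p _ IH] s Hs.
- exact: D0_false.
- by apply: D0_eq_tm; apply: Tm_eval.
- by apply: D0_lt_tm; apply: Tm_eval.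
- by apply: D0_mem_tm; apply: Tm_eval.
- by apply: D0_imp; [apply: IHp|apply: IHq].
- apply: (D0_ext (P := fun e => forall x, mlt x (eval (s e) t) -> sat (x .: s e) E p)).
    by move=> e; rewrite -sat_ball.
  apply: D0_ball_tm; first exact: Tm_eval.
  apply: (IH (fun e => e 0 .: s (tail e))) => -[|i] /=; first exact: Tm_var.
  apply: (Tm_subst (f := fun e => s e i) (s := tail)) => // j; exact: Tm_var.
Qed.

Lemma D0_subst P (s : env -> env) : D0 P -> (forall i, Tm (fun e => s e i)) ->
  D0 (fun e => P (s e)).
Proof.
move=> [a [E [p [Dp Hp]]]] Hs.
apply: (D0_ext (P := fun e => sat (mix (s e) a) E p)); first by move=> e; rewrite Hp.
apply: (D0_sat (s := fun e => mix (s e) a)) => //.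
by apply: nat_parity => i; rewrite /mix /= odd_double /= ?doubleK ?uphalf_double;
  [exact: Hs|exact: Tm_const].
Qed.

End Definability.

(** * Arithmetic in models of RCA0 *)

Declare Scope M_scope.
Delimit Scope M_scope with M.
Notation "0" := (mzero _) : M_scope.
Notation "1" := (mone _) : M_scope.
Notation "x + y" := (madd x y) : M_scope.
Notation "x * y" := (mmul x y) : M_scope.
Notation "x < y" := (mlt x y) : M_scope.
Notation "x <= y" := (mlt x (madd y (mone _))) : M_scope.
Bind Scope M_scope with dom.

Record rca := Rca { rca_model :> model; rcaP : models rca_model RCA0 }.

Ltac d0_tm := repeat first
  [ exact: Tm_const | exact: Tm_var | apply: Tm_add | apply: Tm_mul ].

Section Arithmetic.
Variable m : rca.
Local Notation M := (dom m).
Local Notation env := (nat -> M).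
Local Open Scope M_scope.

(* Moves the parameters behind the first [k] arguments. *)
Definition flat (k i : nat) : nat := if odd i then (k + i./2)%N else minn i./2 k.-1.

Lemma flat2 (x y : M) a : (fun i => (x .: y .: a) (flat 2 i)) = mix (x .: fun=> y) a.
Proof.
apply: funext; apply: nat_parity => i; rewrite /flat /= ?odd_double /=.
- by rewrite mix_even doubleK; case: i => [|[|]].
- by rewrite mix_odd uphalf_double.
Qed.

Lemma flat3 (x y z : M) a :
  (fun i => (x .: y .: z .: a) (flat 3 i)) = mix (x .: y .: fun=> z) a.
Proof.
apply: funext; apply: nat_parity => i; rewrite /flat /= ?odd_double /=.
- by rewrite mix_even doubleK; case: i => [|[|[|]]].
- by rewrite mix_odd uphalf_double.
Qed.

(** Converts a definable predicate of one argument into an actual Sigma^0_1 formula, as needed to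
    instantiate the axiom schemes. *)
Lemma sat_flat2 a E p (Q : M -> env -> Prop) (P : M -> Prop) :
  represents a E p (fun e : env => Q (e 0%N) (tail e)) ->
  (forall e, P (e 0%N) <-> exists x, Q x e) ->
  forall n, sat (n .: a) E (Ex1 (subst (fun i => Var (flat 2 i)) id2 p)) <-> P n.
Proof.
move=> Hp HQ n; rewrite sat_ex1 (HQ (fun=> n)).
suff H w : sat (w .: n .: a) E (subst (fun i => Var (flat 2 i)) id2 p) <-> Q w (fun=> n).
  by split=> -[w /H Hw]; exists w.
by rewrite sat_subst /= flat2 -/id2; exact: iff_sym (Hp _).
Qed.

Lemma S1_induction (P : M -> Prop) : S1 (fun e : env => P (e 0%N)) ->
  P 0 -> (forall x, P x -> P (x + 1)) -> forall x, P x.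
Proof.
move=> [Q [[a [E [p [Dp Hp]]]] HQ]] P0 PS x.
have Hq := sat_flat2 Hp HQ.
set q := subst _ _ _ in Hq.
have Sq : Sigma01 (Ex1 q) by exists q; split=> //; apply: Delta0_subst.
have H : sat a E (induction (Ex1 q)) by apply: rcaP; apply: RCA0_induction.
apply/Hq; move: H x; rewrite /induction.
set q1 := Ex1 q; set A := And _ _ => H x; move: x; apply: (H : sat a E A -> sat a E (All1 q1)).
rewrite /A sat_and inst1E sat_subst; split.
  rewrite (_ : (fun i => _) = 0 .: a); last by apply: funext => -[].
  by apply/Hq.
apply/sat_all1 => n; apply/sat_imp => /Hq Hn; rewrite sat_subst (_ : (fun i => _) = (n + 1) .: a).
  by apply/Hq/PS.
by apply: funext => -[].
Qed.

Lemma S1_comprehension (P : M -> Prop) :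
  S1 (fun e : env => P (e 0%N)) -> S1 (fun e : env => ~ P (e 0%N)) ->
  exists X : sets m, forall x, mem x X <-> P x.
Proof.
move=> [Q [DQ HQ]] [R [DR HR]].
have [a [E [p [r [Dp Dr Hp Hr]]]]] := D0_common DQ DR.
have := sat_flat2 Hp HQ; set p' := subst _ _ p => {}Hp.
have := sat_flat2 (P := fun x => ~ P x) Hr HR; set r' := subst _ _ r => {}Hr.
have Sp : Sigma01 (Ex1 p') by exists p'; split=> //; apply: Delta0_subst.
have Pr : Pi01 (All1 (Neg r')).
  by exists (Neg r'); split=> //; apply/Delta0_neg/Delta0_subst.
have H : sat a E (comprehension (Ex1 p') (All1 (Neg r'))).
  by apply: rcaP; apply: RCA0_comprehension.
move: H; rewrite /comprehension; set A := All1 (Iff _ _).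
move=> /sat_imp H; have : sat a E A.
  apply/sat_all1 => x; rewrite sat_iff Hp; split.
    by move=> Px w Hw; apply: (proj1 (Hr x)) Px; rewrite sat_ex1; exists w.
  by move=> Hw; apply: contrapT; rewrite -Hr sat_ex1 => -[w /Hw].
move=> /H /sat_ex2 [X HX]; exists X => x.
have /sat_iff := proj1 (sat_all1 _ _ _) HX x; rewrite /shift2 sat_subst -Hp => <-.
by [].
Qed.

Lemma S1_bounding (P : M -> M -> Prop) : models m BSigma2 ->
  S1 (fun e : env => ~ P (e 1%N) (e 0%N)) ->
  forall n, (forall x, x < n -> exists y, P x y) ->
  exists b, forall x, x < n -> exists y, y < b /\ P x y.
Proof.
move=> HB [Q [[a [E [p [Dp Hp]]]] HQ]] n Hn.
(* Since [P] is Pi^0_1, a dummy existential quantifier makes it Sigma^0_2. Index 1 is the dummy and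
   index 4 is the bound [n]; the renaming skips both. *)
pose q := subst (fun i => Var (match flat 3 i with 0 => 0 | 1 => 2 | 2 => 3 | i.+3 => i.+4.+1 end)) id2 p.
have Hq (y x c z : M) : sat (z .: y .: x .: c .: a) E (All1 (Neg q)) <-> P x y.
  have E3 w : sat (w .: z .: y .: x .: c .: a) E q <-> Q w (y .: fun=> x).
    rewrite /q sat_subst (_ : (fun i => _) = mix (w .: y .: fun=> x) a).
      exact: iff_sym (Hp _).
    rewrite -flat3; apply: funext => i /=.
    by case: (flat 3 i) => [|[|[|j]]].
  have /= K := HQ (y .: fun=> x); split.
    by move=> H; apply: contrapT => /K [w /E3 Hw]; apply: H Hw.
  by move=> H w Hw; apply: (proj2 K) H; exists w; apply/E3.
pose s := Ex1 (All1 (Neg q)).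
have Hs (y x c : M) : sat (y .: x .: c .: a) E s <-> P x y.
  rewrite sat_ex1; split=> [[z /Hq] //|H]; exists 0; exact/Hq.
have Ss : Sigma02 s.
  exists (All1 (Neg q)); split=> //; exists (Neg q); split=> //.
  by apply/Delta0_neg/Delta0_subst.
have H : sat a E (bounding s) := HB _ a E (BSigma2_inst _ Ss).
have /sat_imp := proj1 (sat_all1 _ _ _) H n; set A := Ball _ _ => {}H.
have /H : sat (n .: a) E A.
  by rewrite sat_ball => x /Hn [y Hy]; rewrite sat_ex1; exists y; apply/Hs.
move=> /sat_ex1 [b /sat_ball Hb]; exists b => x Hx.
have /sat_bex [y [Hy]] := Hb x Hx; rewrite sat_subst => Py; exists y; split=> //.
apply/(Hs y x n); move: Py; congr sat.
by apply: funext => -[|[|]].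
Qed.

Lemma S1_D0 (P : env -> Prop) : D0 P -> S1 P.
Proof.
move=> DP; exists (fun x e => P e); split; last first.
  by move=> e; split=> [He|[]] //; exists 0.
by apply: (D0_subst (s := tail)) => // i; apply: Tm_var.
Qed.

Let basic p e : basic_axiom p -> sat e (fun=> mset m) p.
Proof. by move=> H; apply: rcaP; constructor. Qed.

Lemma succ_neq0 (x : M) : x + 1 <> 0.
Proof. exact: (basic (fun=> x) Ax_succ_nz). Qed.

Lemma succ_inj (x y : M) : x + 1 = y + 1 -> x = y.
Proof. exact: (basic (x .: fun=> y) Ax_succ_inj). Qed.

Lemma addx0 (x : M) : x + 0 = x.
Proof. exact: (basic (fun=> x) Ax_add_0). Qed.

Lemma addxS (x y : M) : x + (y + 1) = x + y + 1.
Proof. exact: (basic (x .: fun=> y) Ax_add_S). Qed.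

Lemma mulx0 (x : M) : x * 0 = 0.
Proof. exact: (basic (fun=> x) Ax_mul_0). Qed.

Lemma mulxS (x y : M) : x * (y + 1) = x * y + x.
Proof. exact: (basic (x .: fun=> y) Ax_mul_S). Qed.

Lemma mltx0 (x : M) : ~ x < 0.
Proof. exact: (basic (fun=> x) Ax_lt_0). Qed.

Lemma mltxS (x y : M) : x < y + 1 <-> x < y \/ x = y.
Proof. by have /sat_iff := basic (x .: fun=> y) Ax_lt_S; rewrite sat_or. Qed.

Ltac ind x := move: x; apply: S1_induction;
  [apply: S1_D0; apply: D0_eq_tm; d0_tm | | move=> x IH].

Lemma add0x (x : M) : 0 + x = x.
Proof. by ind x; rewrite ?addx0 ?addxS ?IH. Qed.

Lemma addSx (x y : M) : (x + 1) + y = x + y + 1.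
Proof. by ind y; rewrite ?addx0 ?addxS ?IH. Qed.

Lemma maddC (x y : M) : x + y = y + x.
Proof. by ind y; rewrite ?addx0 ?add0x ?addxS ?addSx ?IH. Qed.

Lemma maddA (x y z : M) : x + (y + z) = x + y + z.
Proof. by ind z; rewrite ?addx0 ?addxS ?IH. Qed.

Lemma mul0x (x : M) : 0 * x = 0.
Proof. by ind x; rewrite ?mulx0 ?mulxS ?IH ?addx0. Qed.

Lemma mulSx (x y : M) : (x + 1) * y = x * y + y.
Proof.
ind y; rewrite ?mulx0 ?addx0 // !mulxS IH !addxS.
by rewrite -(maddA _ y) (maddC y) maddA.
Qed.

Lemma mmulC (x y : M) : x * y = y * x.
Proof. by ind y; rewrite ?mulx0 ?mul0x ?mulxS ?mulSx ?IH. Qed.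

Lemma mmulDr (x y z : M) : x * (y + z) = x * y + x * z.
Proof. by ind z; rewrite ?mulx0 ?addx0 // addxS !mulxS IH maddA. Qed.

Lemma mmulA (x y z : M) : x * (y * z) = x * y * z.
Proof. by ind z; rewrite ?mulx0 // !mulxS mmulDr IH. Qed.

Lemma mmul1x (x : M) : 1 * x = x.
Proof. by rewrite -(add0x 1) mulSx mul0x add0x. Qed.

Lemma maddI (x y z : M) : x + z = y + z -> x = y.
Proof.
move: z; apply: S1_induction.
- by apply: S1_D0; apply: D0_imp; apply: D0_eq_tm; d0_tm.
- by rewrite !addx0.
- by move=> z IH; rewrite !addxS => /succ_inj.
Qed.

Lemma zero_or_succ (x : M) : x = 0 \/ exists y, x = y + 1.
Proof.
move: x; apply: S1_induction.
(* The order is not yet developed, so the predecessor is quantified without a bound and the whole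
   disjunction goes under that quantifier. *)
- exists (fun x e => e 0%N = 0 \/ e 0%N = x + 1); split.
    by apply: D0_or; apply: D0_eq_tm; rewrite /tail; d0_tm.
  by move=> e; split=> [[H|[y H]]|[y [H|H]]]; [exists 0; left|exists y; right|left|right; exists y].
- by left.
- by move=> x _; right; exists x.
Qed.

Lemma mlt_addS (x d : M) : x < x + (d + 1).
Proof.
move: d; apply: S1_induction.
- by apply: S1_D0; apply: D0_lt_tm; d0_tm.
- by rewrite add0x; apply/mltxS; right.
- by move=> d IH; rewrite addxS; apply/mltxS; left.
Qed.

Lemma mltP (x y : M) : x < y <-> exists d, x + (d + 1) = y.
Proof.
split=> [|[d <-]]; last exact: mlt_addS.
move: y; apply: S1_induction.
(* Prenex form of the implication; where its premise fails, any [d] is a witness. *)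
- exists (fun d e => x < e 0%N -> x + (d + 1) = e 0%N); split.
    by apply: D0_imp; [apply: D0_lt_tm|apply: D0_eq_tm]; rewrite /tail; d0_tm.
  move=> e; split=> [H|[d H] /H dE]; last by exists d.
  by case: (pselect (x < e 0%N)) => [/H [d dE]|N]; [exists d|exists 0].
- by move/mltx0.
- move=> y IH /mltxS [/IH [d <-]|->]; last by exists 0; rewrite add0x.
  by exists (d + 1); rewrite !addxS.
Qed.

Lemma mlt_total (x y : M) : x < y \/ x = y \/ y < x.
Proof.
move: x; apply: S1_induction.
- by apply: S1_D0; do 2 ?apply: D0_or; (apply: D0_lt_tm || apply: D0_eq_tm); d0_tm.
- by case: (zero_or_succ y) => [->|[z ->]]; [right; left|left; apply/mltP; exists z; rewrite add0x].
- move=> x [/mltP [d <-]|[->|H]].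
  + case: (zero_or_succ d) => [->|[z ->]]; first by rewrite add0x; right; left.
    by left; apply/mltP; exists z; rewrite !addxS addSx.
  + by right; right; apply/mltxS; right.
  + by right; right; apply/mltxS; left.
Qed.

Lemma mleP (x y : M) : x <= y <-> exists d, x + d = y.
Proof.
rewrite mltP; split=> -[d dE]; exists d; last by rewrite addxS dE.
by apply: succ_inj; rewrite -dE addxS.
Qed.

Lemma mle_total (x y : M) : x <= y \/ y <= x.
Proof. by rewrite !mltxS; case: (mlt_total x y) => [|[->|]]; auto. Qed.

Lemma madd_eq0 (x y : M) : x + y = 0 -> x = 0.
Proof.
by case: (zero_or_succ x) => [->|[z ->]] //; rewrite addSx => /succ_neq0.
Qed.

Lemma mmul_eq0 (x y : M) : x * y = 0 -> x = 0 \/ y = 0.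
Proof.
case: (zero_or_succ x) => [->|[z ->]]; first by left.
case: (zero_or_succ y) => [->|[w ->]]; first by right.
by rewrite mulxS addxS => /succ_neq0.
Qed.

End Arithmetic.

(** * The ordered ring of differences of a model *)

Definition semiring (m : rca) : Type := dom m.

Section Semiring.
Variable m : rca.

HB.instance Definition _ := gen_eqMixin (semiring m).
HB.instance Definition _ := gen_choiceMixin (semiring m).

HB.instance Definition _ := GRing.isNmodule.Build (semiring m)
  (@maddA m) (@maddC m) (@add0x m).

Lemma mmulDl : left_distributive (@mmul m) (@madd m).
Proof. by move=> x y z; rewrite mmulC mmulDr !(mmulC z). Qed.

HB.instance Definition _ := GRing.Nmodule_isComPzSemiRing.Build (semiring m)
  (@mmulA m) (@mmulC m) (@mmul1x m) mmulDl (@mul0x m).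

(** A pair stands for the formal difference [p.1 - p.2], as when the integers are built from the
    naturals. *)
Definition diff_eq (p q : semiring m * semiring m) : Prop :=
  (p.1 + q.2 = q.1 + p.2)%R.

Definition diff_add (p q : semiring m * semiring m) := (p.1 + q.1, p.2 + q.2)%R.
Definition diff_mul (p q : semiring m * semiring m) :=
  (p.1 * q.1 + p.2 * q.2, p.1 * q.2 + p.2 * q.1)%R.

Definition differences : Type :=
  {C : semiring m * semiring m -> Prop | exists p, C = diff_eq p}.

Definition diff (p : semiring m * semiring m) : differences :=
  exist _ (diff_eq p) (ex_intro _ p erefl).

Lemma diff_eq_sym p q : diff_eq p q -> diff_eq q p.
Proof. exact: esym. Qed.

Lemma diff_eq_trans p q r : diff_eq p q -> diff_eq q r -> diff_eq p r.
Proof.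
case: p q r => [a b] [c d] [e f]; rewrite /diff_eq /= => H K.
suff: (a + f + d = e + b + d)%R by exact: maddI.
have -> : (a + f + d = a + d + f)%R by ring.
rewrite H.
have -> : (c + b + f = c + f + b)%R by ring.
by rewrite K; ring.
Qed.

Lemma diffP p q : diff p = diff q <-> diff_eq p q.
Proof.
split=> [H|H].
  have : diff_eq p = diff_eq q by case: H.
  by move/(f_equal (@^~ q)) => ->.
apply: eq_exist; apply: funext => r; apply: propext; split.
- by apply: diff_eq_trans; apply: diff_eq_sym.
- exact: diff_eq_trans.
Qed.

Lemma diff_surj (x : differences) : exists p, diff p = x.
Proof. by case: x => C CE; have [p Cp] := CE; exists p; apply: eq_exist; rewrite Cp. Qed.

Definition drep (x : differences) := proj1_sig (constructive_indefinite_description _ (diff_surj x)).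

Lemma drepK x : diff (drep x) = x.
Proof. by rewrite /drep; case: constructive_indefinite_description. Qed.

Definition zadd x y := diff (diff_add (drep x) (drep y)).
Definition zmul x y := diff (diff_mul (drep x) (drep y)).
Definition zopp x := diff ((drep x).2, (drep x).1).

Lemma zaddE p q : zadd (diff p) (diff q) = diff (diff_add p q).
Proof.
apply/diffP; have /diffP := drepK (diff p); have /diffP := drepK (diff q).
case: p q (drep _) (drep _) => [a b] [c d] [a' b'] [c' d']; rewrite /diff_eq /= => H K.
have -> : (a' + c' + (b + d) = (a' + b) + (c' + d))%R by ring.
by rewrite H K; ring.
Qed.

Lemma zmulE p q : zmul (diff p) (diff q) = diff (diff_mul p q).
Proof.
apply/diffP; have /diffP := drepK (diff p); have /diffP := drepK (diff q).
case: p q (drep _) (drep _) => [a b] [c d] [a' b'] [c' d'] H K.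
(* The factors are changed to other representatives one at a time. *)
apply: (@diff_eq_trans _ (diff_mul (a, b) (c', d'))); rewrite /diff_eq /= in H K *.
- have -> : (a' * c' + b' * d' + (a * d' + b * c') = (a' + b) * c' + (a + b') * d')%R by ring.
  have -> : (a * c' + b * d' + (a' * d' + b' * c') = (a + b') * c' + (a' + b) * d')%R by ring.
  by rewrite K.
- have -> : (a * c' + b * d' + (a * d + b * c) = a * (c' + d) + b * (c + d'))%R by ring.
  have -> : (a * c + b * d + (a * d' + b * c') = a * (c + d') + b * (c' + d))%R by ring.
  by rewrite H.
Qed.

Lemma zoppE p : zopp (diff p) = diff (p.2, p.1).
Proof.
apply/diffP; have /diffP := drepK (diff p).
case: p (drep _) => [a b] [a' b']; rewrite /diff_eq /= => H.
by rewrite addrC -H addrC.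
Qed.

Ltac unclass := repeat match goal with
  | x : differences |- _ => let p := fresh "p" in have [p <-] := diff_surj x; clear x end.

Ltac diff_ring := move=> *; unclass; do 3 rewrite ?zoppE ?zaddE ?zmulE;
  apply/diffP; rewrite /diff_eq /diff_add /diff_mul /=; ring.

Definition zzero := diff (0, 0)%R.
Definition zone := diff (1, 0)%R.

HB.instance Definition _ := gen_eqMixin differences.
HB.instance Definition _ := gen_choiceMixin differences.

Lemma zaddA : associative zadd. Proof. diff_ring. Qed.
Lemma zaddC : commutative zadd. Proof. diff_ring. Qed.
Lemma zadd0 : left_id zzero zadd. Proof. rewrite /zzero; diff_ring. Qed.
Lemma zaddN : left_inverse zzero zopp zadd. Proof. rewrite /zzero; diff_ring. Qed.
Lemma zmulA : associative zmul. Proof. diff_ring. Qed.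
Lemma zmulC : commutative zmul. Proof. diff_ring. Qed.
Lemma zmul1 : left_id zone zmul. Proof. rewrite /zone; diff_ring. Qed.
Lemma zmulD : left_distributive zmul zadd.
Proof.
move=> x y z; have [p <-] := diff_surj x; have [q <-] := diff_surj y.
have [r <-] := diff_surj z; rewrite (zaddE p q) (zmulE p r) (zmulE q r) (zmulE (diff_add p q)).
by rewrite zaddE; apply/diffP; rewrite /diff_eq /diff_add /diff_mul /=; ring.
Qed.

HB.instance Definition _ := GRing.isZmodule.Build differences zaddA zaddC zadd0 zaddN.

Lemma zone_neq0 : zone != zzero.
Proof.
apply/eqP => /diffP; rewrite /diff_eq /= !addr0 => H.
by apply: (@succ_neq0 m (mzero m)); rewrite add0x.
Qed.

HB.instance Definition _ :=
  GRing.Zmodule_isComNzRing.Build differences zmulA zmulC zmul1 zmulD zone_neq0.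

Definition inj (x : m) : differences := diff (x : semiring m, 0%R).

Lemma inj_add (x y : m) : inj (madd x y) = (inj x + inj y)%R.
Proof. by rewrite /inj [RHS]zaddE; apply/diffP; rewrite /diff_eq /= !addr0. Qed.

Lemma inj_mul (x y : m) : inj (mmul x y) = (inj x * inj y)%R.
Proof.
by rewrite /inj [RHS]zmulE; apply/diffP; rewrite /diff_eq /= !mulr0 !mul0r !addr0.
Qed.

Lemma inj0 : inj (mzero m) = 0%R. Proof. by []. Qed.
Lemma inj1 : inj (mone m) = 1%R. Proof. by []. Qed.

Lemma inj_inj (x y : m) : inj x = inj y -> x = y.
Proof. by move/diffP; rewrite /diff_eq /= !addr0. Qed.

(** The order of the model is total, so the smaller component can be cancelled. Order and
    integrality of the ring thereby reduce to facts about the model. *)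
Lemma sign_cases (x : differences) : (exists a, x = inj a) \/ (exists a, x = - inj a)%R.
Proof.
have [[a b] <-] := diff_surj x.
have [/mleP [d H]|/mleP [d H]] := mle_total a b; [right|left]; exists d.
- rewrite /inj [RHS]zoppE /=; apply/diffP; rewrite /diff_eq /=.
  by rewrite add0r -H.
- apply/diffP; rewrite /diff_eq /= addr0.
  by rewrite addrC -H.
Qed.

Lemma inj_neg (a b : m) : (inj a = - inj b)%R -> a = mzero m.
Proof.
move=> H; apply: (@madd_eq0 m a b); apply: inj_inj; rewrite inj_add H.
by rewrite addNr.
Qed.

Lemma diff_integral (x y : differences) : (x * y = 0 -> (x == 0) || (y == 0))%R.
Proof.
have [[a ->]|[a ->]] := sign_cases x; have [[b ->]|[b ->]] := sign_cases y;
  rewrite ?mulNr ?mulrN ?opprK -inj_mul ?oppr_eq0;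
  move=> /(f_equal (fun z => z - 0 : differences)%R) /eqP; rewrite !subr0 ?oppr_eq0 => /eqP;
  rewrite -inj0 => /inj_inj /mmul_eq0 [->|->]; by rewrite inj0 eqxx ?orbT.
Qed.

(** The structure of an integral domain includes a partial inverse; it is chosen classically and is
    the identity off the units. *)
Definition zunit : pred differences := fun x => `[< exists y, y * x = 1 >]%R.
Definition zinv (x : differences) : differences :=
  if pselect (exists y, y * x = 1)%R is left H
  then proj1_sig (constructive_indefinite_description _ H) else x.

Lemma zmulV : {in zunit, left_inverse 1%R zinv *%R}.
Proof.
move=> x /asboolP H; rewrite /zinv; case: pselect => // H'.
by case: constructive_indefinite_description.
Qed.

Lemma zunitPl (x y : differences) : (y * x = 1)%R -> zunit x.
Proof. by move=> H; apply/asboolP; exists y. Qed.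

Lemma zinv_out : {in [predC zunit], zinv =1 id}.
Proof.
by move=> x /negP; rewrite /zinv; case: pselect => // H [] //; apply/asboolP.
Qed.

HB.instance Definition _ :=
  GRing.ComNzRing_hasMulInverse.Build differences zmulV zunitPl zinv_out.
HB.instance Definition _ :=
  GRing.ComUnitRing_isIntegral.Build differences diff_integral.

Definition zle (x y : differences) : bool := `[< exists a, y - x = inj a >]%R.
Definition zlt (x y : differences) : bool := (y != x) && zle x y.
Definition zabs (x : differences) : differences := if zle 0%R x then x else (- x)%R.

Lemma zle0P x : reflect (exists a, x = inj a) (zle 0%R x).
Proof. by rewrite /zle subr0; apply: asboolP. Qed.

Lemma zle0_add x y : zle 0%R x -> zle 0%R y -> zle 0%R (x + y)%R.
Proof.
by move=> /zle0P [a ->] /zle0P [b ->]; apply/zle0P; exists (madd a b); rewrite inj_add.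
Qed.

Lemma zle0_mul x y : zle 0%R x -> zle 0%R y -> zle 0%R (x * y)%R.
Proof.
by move=> /zle0P [a ->] /zle0P [b ->]; apply/zle0P; exists (mmul a b); rewrite inj_mul.
Qed.

Lemma zle0_anti x : zle 0%R x -> zle x 0%R -> x = 0%R.
Proof.
move=> /zle0P [a ->] /asboolP [b]; rewrite sub0r => H.
by rewrite (@inj_neg a b) // -H opprK.
Qed.

Lemma zsub_ge0 x y : zle 0%R (y - x)%R = zle x y.
Proof. by rewrite /zle subr0. Qed.

Lemma zle0_total x : zle 0%R x || zle x 0%R.
Proof.
have [[a ->]|[a ->]] := sign_cases x; apply/orP; [left|right].
- by apply/zle0P; exists a.
- by apply/asboolP; exists a; rewrite sub0r opprK.
Qed.

Lemma zabsN x : zabs (- x)%R = zabs x.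
Proof.
rewrite /zabs opprK; case: ifP => H; case: ifP => // K.
- suff -> : x = 0%R by rewrite oppr0.
  apply: zle0_anti => //.
  by apply/asboolP; move: H => /zle0P [a Ha]; exists a; rewrite sub0r.
- exfalso; have /orP [|/asboolP [a]] := zle0_total x; first by rewrite K.
  by rewrite sub0r => Ha; move/negP: H; apply; apply/zle0P; exists a.
Qed.

Lemma zabs_ge0 x : zle 0%R x -> zabs x = x.
Proof. by rewrite /zabs => ->. Qed.

Lemma zlt_def x y : zlt x y = (y != x) && zle x y.
Proof. by []. Qed.

HB.instance Definition _ := Num.IntegralDomain_isLeReal.Build differences
  zle0_add zle0_mul zle0_anti zsub_ge0 (zle0_total) zabsN zabs_ge0 zlt_def.

Lemma inj_ge0 (x : m) : (0 <= inj x)%R.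
Proof. by apply/zle0P; exists x. Qed.

Lemma inj_le (x y : m) : mlt x (madd y (mone m)) <-> (inj x <= inj y)%R.
Proof.
rewrite mleP; split=> [[d <-]|].
  by rewrite inj_add lerDl inj_ge0.
rewrite -subr_ge0 => /zle0P [a Ha]; exists a; apply: inj_inj.
by rewrite inj_add -Ha addrC subrK.
Qed.

Lemma inj_lt (x y : m) : mlt x y <-> (inj x + 1 <= inj y)%R.
Proof.
rewrite -inj1 -inj_add -inj_le; split; rewrite ?mleP mltP => -[d <-]; exists d.
- by rewrite addxS addSx.
- by rewrite addxS addSx.
Qed.

Lemma inj_not_lt (x y : m) : ~ mlt x y <-> (inj y <= inj x)%R.
Proof.
rewrite inj_lt; split=> [|H K]; last by lra.
case: (mlt_total x y) => [|[->|]]; rewrite ?inj_lt //.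
by move=> H _; lra.
Qed.

Lemma inj_eq (x y : m) : x = y <-> inj x = inj y.
Proof. by split=> [->|/inj_inj]. Qed.

End Semiring.


(* Moves the arithmetical hypotheses and goal from the model to its ring of
   differences, where [x < y] becomes [x + 1 <= y] and all atoms are nonnegative. *)
Ltac diff_hyps :=
  repeat match goal with
  | H : mlt _ (madd _ (mone _)) |- _ => move/inj_le in H
  | H : mlt _ _ |- _ => move/inj_lt in H
  | H : ~ mlt _ _ |- _ => move/inj_not_lt in H
  | H : @eq (dom _) _ _ |- _ => move/inj_eq in H
  end.

Ltac diff_goal :=
  lazymatch goal with
  | |- mlt _ (madd _ (mone _)) => apply/inj_le
  | |- mlt _ _ => apply/inj_lt
  | |- ~ mlt _ _ => apply/inj_not_lt
  | |- ~ _ => intro; diff_goal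
  | |- @eq (dom _) _ _ => apply/inj_eq
  | |- _ => exfalso
  end.

Ltac diff_push :=
  repeat match goal with
  | |- context [inj (madd ?x ?y)] => rewrite (inj_add x y)
  | |- context [inj (mmul ?x ?y)] => rewrite (inj_mul x y)
  | H : context [inj (madd ?x ?y)] |- _ => rewrite (inj_add x y) in H
  | H : context [inj (mmul ?x ?y)] |- _ => rewrite (inj_mul x y) in H
  end;
  rewrite ?(inj0, inj1, mulrDl, mulrDr, mul1r, mulr1);
  repeat match goal with
  | H : context [inj (mzero _)] |- _ => rewrite inj0 in H
  | H : context [inj (mone _)] |- _ => rewrite inj1 in H
  | H : context [((_ + _) * _)%R] |- _ => rewrite mulrDl in H
  | H : context [(_ * (_ + _))%R] |- _ => rewrite mulrDr in H
  | H : context [(1 * _)%R] |- _ => rewrite mul1r in H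
  | H : context [(_ * 1)%R] |- _ => rewrite mulr1 in H
  end.

(** Products are atoms for linear arithmetic, so their nonnegativity is recorded along with that of
    single elements. *)
Ltac diff_nonneg t :=
  lazymatch goal with
  | _ : is_true (0 <= t)%R |- _ => fail
  | |- _ => have : (0 <= t)%R by repeat apply: mulr_ge0; apply: inj_ge0
  end.

Ltac diff_atoms :=
  repeat match goal with
  | |- context [inj ?x] => diff_nonneg (inj x)  ; intro
  | |- context [(?x * ?y)%R] => diff_nonneg ((x * y)%R)  ; intro
  | _ : context [inj ?x] |- _ => diff_nonneg (inj x)  ; intro
  | _ : context [(?x * ?y)%R] |- _ => diff_nonneg ((x * y)%R)  ; intro
  end.

(* [lra] would try to read these as hypotheses on an ordered type. *)
Ltac diff_clear :=
  repeat match goal with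
  | H : ~ _ |- _ => clear H
  | H : _ \/ _ |- _ => clear H
  | H : _ /\ _ |- _ => clear H
  | H : ?P -> _ |- _ => lazymatch type of P with Prop => clear H end
  | H : @eq ?T _ _ |- _ => lazymatch T with differences _ => fail | _ => clear H end
  end.

Ltac to_diff := intros; diff_goal; diff_hyps; diff_clear; diff_push; diff_atoms.
Ltac mlra := to_diff; lra.
Ltac mnra := to_diff; nra.

(** * Bounded functions and closure properties of Sigma^0_1 predicates *)

Section Functions.
Variable m : rca.
Local Notation M := (dom m).
Local Notation env := (nat -> M).
Local Open Scope M_scope.

(* Functions with a Delta0 graph that are bounded by a term may be substituted
   into Delta0 predicates. *)
Definition Fn (f : env -> M) : Prop :=
  (exists t, Tm t /\ forall e, f e <= t e) /\ D0 (fun e => e 0%N = f (tail e)).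

Lemma Tm_tail f : Tm f -> Tm (fun e : env => f (tail e)).
Proof. by move=> H; apply: (Tm_subst (s := tail)) => // i; apply: Tm_var. Qed.

Lemma Fn_tm f : Tm f -> Fn f.
Proof.
move=> H; split; first by exists f; split=> // e; mlra.
by apply: D0_eq_tm; [apply: Tm_var|apply: Tm_tail].
Qed.

Lemma D0_bex_tm f (Q : M -> env -> Prop) : Tm f -> D0 (fun e => Q (e 0%N) (tail e)) ->
  D0 (fun e => exists x, x < f e /\ Q x e).
Proof.
move=> Hf HQ; apply: (D0_ext (P := fun e => ~ forall x, x < f e -> ~ Q x e)).
  move=> e; split=> [H|[x [Hx Qx]] /(_ x Hx)] //.
  by apply: contrapT => K; apply: H => x Hx Qx; apply: K; exists x.
by apply: D0_not; apply: (D0_ball_tm (Q := fun x e => ~ Q x e)) => //; apply: D0_not.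
Qed.

(** The value of [f] can be introduced by a quantifier bounded by a term, which keeps the predicate
    Delta0. *)
Lemma D0_fn f (Q : M -> env -> Prop) : Fn f -> D0 (fun e => Q (e 0%N) (tail e)) ->
  D0 (fun e => Q (f e) e).
Proof.
move=> [[t [Tt Ht]] Hf] HQ.
apply: (D0_ext (P := fun e => exists x, x < t e + 1 /\ (x = f e /\ Q x e))).
  by move=> e; split=> [[x [_ [->]]]|H] //; exists (f e).
apply: D0_bex_tm; first by apply: Tm_add => //; apply: Tm_const.
exact: D0_and.
Qed.

Lemma Fn_subst f (s : env -> env) : Fn f -> (forall i, Tm (fun e => s e i)) ->
  Fn (fun e => f (s e)).
Proof.
move=> [[t [Tt Ht]] Hf] Hs; split.
  by exists (fun e => t (s e)); split=> //; apply: Tm_subst.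
apply: (D0_subst (P := fun e => e 0%N = f (tail e)) (s := fun e => e 0%N .: s (tail e))) => //.
by case=> [|i] /=; [apply: Tm_var|apply: (Tm_tail (f := fun e => s e i))].
Qed.

Lemma Fn_tail f : Fn f -> Fn (fun e : env => f (tail e)).
Proof. by move=> H; apply: (Fn_subst (s := tail)) => // i; apply: Tm_var. Qed.

Lemma D0_tail P : D0 P -> D0 (fun e : env => P (tail e)).
Proof. by move=> H; apply: (D0_subst (s := tail)) => // i; apply: Tm_var. Qed.

Lemma Fn_var i : Fn (fun e => e i).
Proof. exact/Fn_tm/Tm_var. Qed.

Lemma Fn_const c : Fn (fun=> c).
Proof. exact/Fn_tm/Tm_const. Qed.

Lemma D0_const (P : Prop) : D0 (fun _ : env => P).
Proof.
case: (pselect P) => HP.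
- by apply: (D0_ext _ (D0_true _)).
- by apply: (D0_ext _ (D0_false _)).
Qed.

Lemma D0_eq f g : Fn f -> Fn g -> D0 (fun e => f e = g e).
Proof.
move=> Hf [_ Hg].
exact: (D0_fn (Q := fun x e => x = g e)).
Qed.

Lemma D0_fn2 f g (R : M -> M -> env -> Prop) : Fn f -> Fn g ->
  D0 (fun e => R (e 1%N) (e 0%N) (tail (tail e))) -> D0 (fun e => R (f e) (g e) e).
Proof.
move=> Hf Hg HR; apply: (D0_fn (Q := fun x e => R x (g e) e)) => //.
by apply: (D0_fn (f := fun e => g (tail e)) (Q := fun y e => R (e 0%N) y (tail e)));
  [apply: Fn_tail|].
Qed.

Lemma D0_lt f g : Fn f -> Fn g -> D0 (fun e => f e < g e).
Proof.
move=> Hf Hg; apply: (D0_fn2 (R := fun x y e => x < y)) => //.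
by apply: D0_lt_tm; apply: Tm_var.
Qed.

Lemma D0_mem f X : Fn f -> D0 (fun e => mem (f e) X).
Proof.
move=> Hf; apply: (D0_fn (Q := fun x e => mem x X)) => //.
by apply: D0_mem_tm; apply: Tm_var.
Qed.

Lemma Fn_add f g : Fn f -> Fn g -> Fn (fun e => f e + g e).
Proof.
move=> Hf Hg; have [[t [Tt Ht]] _] := Hf; have [[u [Tu Hu]] _] := Hg; split.
  exists (fun e => t e + u e); split; first exact: Tm_add.
  by move=> e; have := Ht e; have := Hu e; mlra.
apply: (D0_fn2 (f := fun e => f (tail e)) (g := fun e => g (tail e))
  (R := fun x y e => e 0%N = x + y)); try exact: Fn_tail.
by apply: D0_eq_tm; [apply: Tm_var|apply: Tm_add; apply: Tm_var].
Qed.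

Lemma Fn_mul f g : Fn f -> Fn g -> Fn (fun e => f e * g e).
Proof.
move=> Hf Hg; have [[t [Tt Ht]] _] := Hf; have [[u [Tu Hu]] _] := Hg; split.
  exists (fun e => t e * u e); split; first exact: Tm_mul.
  by move=> e; have := Ht e; have := Hu e; mnra.
apply: (D0_fn2 (f := fun e => f (tail e)) (g := fun e => g (tail e))
  (R := fun x y e => e 0%N = x * y)); try exact: Fn_tail.
by apply: D0_eq_tm; [apply: Tm_var|apply: Tm_mul; apply: Tm_var].
Qed.

Lemma D0_ball f (Q : env -> M -> Prop) : Fn f -> D0 (fun e => Q (tail e) (e 0%N)) ->
  D0 (fun e => forall x, x < f e -> Q e x).
Proof.
move=> Hf HQ; apply: (D0_fn (Q := fun y e => forall x, x < y -> Q e x)) => //.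
apply: (D0_ball_tm (f := fun e => e 0%N) (Q := fun x e => Q (tail e) x)).
  exact: Tm_var.
apply: (D0_subst (P := fun e => Q (tail e) (e 0%N)) (s := fun e => e 0%N .: tail (tail e))) => //.
by case=> [|i]; apply: Tm_var.
Qed.

Lemma D0_bex f (Q : env -> M -> Prop) : Fn f -> D0 (fun e => Q (tail e) (e 0%N)) ->
  D0 (fun e => exists x, x < f e /\ Q e x).
Proof.
move=> Hf HQ; apply: (D0_fn (Q := fun y e => exists x, x < y /\ Q e x)) => //.
apply: (D0_bex_tm (f := fun e => e 0%N) (Q := fun x e => Q (tail e) x)).
  exact: Tm_var.
apply: (D0_subst (P := fun e => Q (tail e) (e 0%N)) (s := fun e => e 0%N .: tail (tail e))) => //.
by case=> [|i]; apply: Tm_var.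
Qed.

Lemma S1_ext (P Q : env -> Prop) : (forall e, P e <-> Q e) -> S1 P -> S1 Q.
Proof.
by move=> H [R [DR HR]]; exists R; split=> // e; rewrite -H HR.
Qed.

(** Two unbounded witnesses become one: the new variable is a strict bound on both. No pairing
    function is used. *)
Lemma S1_ex (Q : env -> M -> Prop) : S1 (fun e => Q (tail e) (e 0%N)) ->
  S1 (fun e => exists x, Q e x).
Proof.
move=> [R [DR HR]].
exists (fun z e => exists x, x < z /\ exists y, y < z /\ R y (x .: e)); split.
  apply: (D0_bex (Q := fun e x => exists y, y < e 0%N /\ R y (x .: tail e))).
    exact: Fn_var.
  apply: (D0_bex (f := fun e => e 1%N) (Q := fun e y => R y (e 0%N .: tail (tail e)))).
    exact: Fn_var.
  apply: (D0_subst (P := fun e => R (e 0%N) (tail e))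
    (s := fun e => e 0%N .: e 1%N .: tail (tail (tail e)))) => //.
  by move=> [|[|i]]; apply: Tm_var.
move=> e; split=> [[x Qx]|[z [x [_ [y [_ Hy]]]]]].
  have [y Hy] := proj1 (HR (x .: e)) Qx.
  exists (x + y + 1), x; split; first mlra.
  by exists y; split; first mlra.
by exists x; apply: (proj2 (HR (x .: e))); exists y.
Qed.

Lemma S1_and P Q : S1 P -> S1 Q -> S1 (fun e : env => P e /\ Q e).
Proof.
move=> [R [DR HR]] [T [DT HT]].
apply: (S1_ext (P := fun e => exists x, exists y, R x e /\ T y e)).
  move=> e; rewrite HR HT; split=> [[x [y [H K]]]|[[x H] [y K]]]; last by exists x, y.
  by split; [exists x|exists y].
apply: (S1_ex (Q := fun e x => exists y, R x e /\ T y e)).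
apply: (S1_ex (Q := fun e y => R (e 0%N) (tail e) /\ T y (tail e))).
apply: S1_D0; apply: D0_and; first exact: (D0_tail DR).
apply: (D0_subst (P := fun e => T (e 0%N) (tail e)) (s := fun e => e 0%N .: tail (tail e))) => //.
by case=> [|i]; apply: Tm_var.
Qed.

Lemma S1_or P Q : S1 P -> S1 Q -> S1 (fun e : env => P e \/ Q e).
Proof.
move=> [R [DR HR]] [T [DT HT]].
exists (fun x e => R x e \/ T x e); split; first exact: D0_or.
move=> e; rewrite HR HT; split=> [[[x H]|[x H]]|[x [H|H]]].
- by exists x; left.
- by exists x; right.
- by left; exists x.
- by right; exists x.
Qed.

Lemma S1_imp P Q : D0 P -> S1 Q -> S1 (fun e : env => P e -> Q e).
Proof.
move=> DP SQ; apply: (S1_ext (P := fun e => ~ P e \/ Q e)).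
  move=> e; split=> [[|]|H] //.
  by case: (pselect (P e)) => HP; [right; apply: H|left].
by apply: S1_or => //; apply: S1_D0; apply: D0_not.
Qed.

(** Collection for bounded formulas follows from Sigma^0_1 induction on the initial segment of [n]
    for which a bound has been found. *)
Lemma S1_collection (R : M -> M -> Prop) n : D0 (fun e => R (e 0%N) (e 1%N)) ->
  (forall x, x < n -> exists y, R x y) ->
  exists b, forall x, x < n -> exists y, y < b /\ R x y.
Proof.
move=> DR Hn.
suff H k : k <= n -> exists b, forall x, x < k -> exists y, y < b /\ R x y.
  by apply: H; mlra.
move: k; apply: S1_induction.
- apply: S1_imp.
    by apply: D0_lt; [apply: Fn_var|apply: Fn_const].
  apply: S1_ex; apply: S1_D0; apply: (D0_ball (f := fun e => e 1%N)); first exact: Fn_var.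
  apply: (D0_bex (f := fun e => e 1%N)); first exact: Fn_var.
  apply: (D0_subst (P := fun e => R (e 0%N) (e 1%N))
    (s := fun e => e 1%N .: fun=> e 0%N)) => //.
  by case=> [|i]; apply: Tm_var.
- by move=> _; exists 0 => x /mltx0.
- move=> k IH Hk; have [|b Hb] := IH; first by mlra.
  have [|y Ry] := Hn k; first by mlra.
  exists (b + y + 1) => x /mltxS [/Hb [z [Hz Rz]]|->].
    by exists z; split=> //; mlra.
  by exists y; split=> //; mlra.
Qed.

(** Collection bounds the witnesses uniformly, so the existential quantifier moves in front of the
    bounded universal one. *)
Lemma S1_ball f (Q : env -> M -> Prop) : Fn f -> S1 (fun e => Q (tail e) (e 0%N)) ->
  S1 (fun e => forall x, x < f e -> Q e x).
Proof.
move=> Hf [R [DR HR]].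
apply: (S1_ext (P := fun e => exists b, forall x, x < f e -> exists y, y < b /\ R y (x .: e))).
  move=> e; split=> [[b Hb] x /Hb [y [_ Hy]]|H].
    by apply: (proj2 (HR (x .: e))); exists y.
  apply: (S1_collection (R := fun x y => R y (x .: e))); last first.
    by move=> x /H Hx; have [y Hy] := proj1 (HR (x .: e)) Hx; exists y.
  apply: (D0_subst (P := fun e => R (e 0%N) (tail e)) (s := fun e' => e' 1%N .: e' 0%N .: e)) => //.
  by move=> [|[|i]] /=; [apply: Tm_var|apply: Tm_var|apply: Tm_const].
apply: S1_ex; apply: S1_D0; apply: (D0_ball (f := fun e => f (tail e))); first exact: Fn_tail.
apply: (D0_bex (f := fun e => e 1%N)); first exact: Fn_var.
apply: (D0_subst (P := fun e => R (e 0%N) (tail e))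
  (s := fun e => e 0%N .: e 1%N .: tail (tail (tail e)))) => //.
by move=> [|[|i]]; apply: Tm_var.
Qed.

Lemma D0_rel1 (R : M -> Prop) f : D0 (fun e => R (e 0%N)) -> Fn f -> D0 (fun e => R (f e)).
Proof. by move=> HR Hf; apply: (D0_fn (Q := fun x e => R x)). Qed.

Lemma D0_rel2 (R : M -> M -> Prop) f g : D0 (fun e => R (e 0%N) (e 1%N)) -> Fn f -> Fn g ->
  D0 (fun e => R (f e) (g e)).
Proof.
move=> HR Hf Hg; apply: (D0_fn2 (R := fun x y e => R x y)) => //.
apply: (D0_subst (P := fun e => R (e 0%N) (e 1%N)) (s := fun e => e 1%N .: fun=> e 0%N)) => //.
by case=> [|i]; apply: Tm_var.
Qed.

Lemma D0_rel3 (R : M -> M -> M -> Prop) f g h :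
  D0 (fun e => R (e 0%N) (e 1%N) (e 2%N)) -> Fn f -> Fn g -> Fn h ->
  D0 (fun e => R (f e) (g e) (h e)).
Proof.
move=> HR Hf Hg Hh; apply: (D0_fn2 (R := fun x y e => R x y (h e))) => //.
apply: (D0_fn (f := fun e => h (tail (tail e))) (Q := fun z e => R (e 1%N) (e 0%N) z)).
  exact: (Fn_tail (f := fun e => h (tail e)) (Fn_tail Hh)).
apply: (D0_subst (P := fun e => R (e 0%N) (e 1%N) (e 2%N))
  (s := fun e => e 2%N .: e 1%N .: fun=> e 0%N)) => //.
by move=> [|[|i]]; apply: Tm_var.
Qed.

End Functions.

(** Hooks that are redefined as new functions and predicates acquire their closure lemmas. *)
Ltac fn_user := fail.
Ltac d0_user := fail.
Ltac s1_user := fail.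

Ltac fn_shift := match goal with
  | H : Fn ?f |- Fn (fun e => ?f _) => apply: (Fn_subst H) => ?; apply: Tm_var
  end.

Ltac d0_hyp :=
  match goal with
  | H : forall f, Fn f -> Fn _ |- Fn _ => apply: H
  | H : forall f, Fn f -> D0 _ |- D0 _ => apply: H
  | H : forall f, Fn f -> S1 _ |- S1 _ => apply: H
  | H : forall f g, Fn f -> Fn g -> Fn _ |- Fn _ => apply: H
  | H : forall f g, Fn f -> Fn g -> D0 _ |- D0 _ => apply: H
  | H : forall f g, Fn f -> Fn g -> S1 _ |- S1 _ => apply: H
  | H : forall f g h, Fn f -> Fn g -> Fn h -> D0 _ |- D0 _ => apply: H
  end.

Ltac d0 := rewrite /tail; cbn beta;
  lazymatch goal with
  | |- Fn (fun _ => ?c) => apply: Fn_const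
  | |- Fn (fun e => e _) => apply: Fn_var
  | |- Fn (fun e => madd _ _) => apply: Fn_add; d0
  | |- Fn (fun e => mmul _ _) => apply: Fn_mul; d0
  | |- Fn _ => first [assumption | fn_shift | fn_user; d0 | d0_hyp; d0 ]
  | |- D0 (fun _ => ?P) => apply: D0_const
  | |- D0 (fun e => _ /\ _) => apply: D0_and; d0
  | |- D0 (fun e => _ \/ _) => apply: D0_or; d0
  | |- D0 (fun e => _ <-> _) => apply: D0_iff; d0
  | |- D0 (fun e => ~ _) => apply: D0_not; d0
  | |- D0 (fun e => _ = _) => apply: D0_eq; d0
  | |- D0 (fun e => mlt _ _) => apply: D0_lt; d0
  | |- D0 (fun e => mem _ _) => apply: D0_mem; d0
  | |- D0 (fun e => forall x, mlt x _ -> _) => apply: D0_ball; d0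
  | |- D0 (fun e => exists x, mlt x _ /\ _) => apply: D0_bex; d0
  | |- D0 (fun e => _ -> _) => apply: D0_imp; d0
  | |- D0 _ => first [assumption | d0_user; d0 | d0_hyp; d0 ]
  end.

Ltac s1 := rewrite /tail; cbn beta;
  first [ apply: S1_D0; solve [d0] |
  lazymatch goal with
  | |- S1 (fun e => _ /\ _) => apply: S1_and; s1
  | |- S1 (fun e => _ \/ _) => apply: S1_or; s1
  | |- S1 (fun e => forall x, mlt x _ -> _) => apply: S1_ball; [d0|s1]
  | |- S1 (fun e => _ -> _) => apply: S1_imp; [d0|s1]
  | |- S1 (fun e => exists x, _) => apply: S1_ex; s1
  | |- S1 _ => first [assumption | s1_user | d0_hyp; d0 ]
  end ].

(** * Strong induction and least elements *)

Section Principles.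
Variable m : rca.
Local Notation M := (dom m).
Local Notation env := (nat -> M).
Local Open Scope M_scope.

Lemma D0_strong_induction (P : M -> Prop) : D0 (fun e => P (e 0%N)) ->
  (forall x, (forall y, y < x -> P y) -> P x) -> forall x, P x.
Proof.
move=> DP H x; suff K n : forall y, y < n -> P y by apply: (K (x + 1)); mlra.
move: n; apply: S1_induction.
- apply: S1_D0; apply: D0_ball; [d0|exact: DP].
- by move=> y /mltx0.
- by move=> n IH y /mltxS [/IH //|->]; apply: H.
Qed.

Lemma D0_least (P : M -> Prop) : D0 (fun e => P (e 0%N)) ->
  forall x, P x -> exists y, [/\ y <= x, P y & forall z, z < y -> ~ P z].
Proof.
move=> DP x Px; apply: contrapT => N.
suff K : ~ (x <= x /\ P x) by apply: K; split=> //; mlra.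
suff : forall y, ~ (y <= x /\ P y) by apply.
apply: D0_strong_induction; last first.
  move=> y IH [Hy Py]; apply: N; exists y; split=> // z Hz Pz.
  by apply: (IH z Hz); split=> //; mlra.
by apply: D0_not; apply: D0_and => //; d0.
Qed.

End Principles.

(** * Sequences *)

Section Beta.
Variable m : rca.
Local Notation M := (dom m).
Local Notation env := (nat -> M).
Local Open Scope M_scope.

Lemma mul_lt_mono (a b d : M) : a < b -> a * d + d <= b * d.
Proof. by move=> H; mnra. Qed.

Lemma division (a d : M) : 0 < d -> exists q r, [/\ a = q * d + r, r < d & q <= a].
Proof.
move=> Hd; suff: exists q, q < a + 1 /\ exists r, r < d /\ a = q * d + r.
  by move=> [q [Hq [r [Hr ->]]]]; exists q, r; split=> //; mnra.
move: a; apply: S1_induction; first s1.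
- by exists 0; split; first mlra; exists 0; split=> //; mlra.
- move=> a [q [Hq [r [Hr aE]]]]; case: (pselect (r + 1 < d)) => H.
  + by exists q; split; first mlra; exists (r + 1); split=> //; mlra.
  + by exists (q + 1); split; first mlra; exists 0; split=> //; mlra.
Qed.

Lemma division_unique (q q' d r r' : M) : r < d -> r' < d ->
  q * d + r = q' * d + r' -> r = r'.
Proof.
move=> Hr Hr' E; case: (mlt_total q q') => [H|[H|H]].
- have K := mul_lt_mono d H; exfalso; mlra.
- by rewrite H in E; mlra.
- have K := mul_lt_mono d H; exfalso; mlra.
Qed.

(* There is no subtraction in the model: hence multiples of [d] on both sides. *)
Definition cong (d x y : M) : Prop := exists u v, x + u * d = y + v * d.

Lemma cong_refl d x : cong d x x.
Proof. by exists 0, 0. Qed.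

Lemma cong_sym d x y : cong d x y -> cong d y x.
Proof. by move=> [u [v E]]; exists v, u. Qed.

Lemma cong_trans d x y z : cong d x y -> cong d y z -> cong d x z.
Proof. by move=> [u [v E]] [u' [v' E']]; exists (u + u'), (v + v'); mlra. Qed.

Lemma cong_add d x y x' y' : cong d x y -> cong d x' y' -> cong d (x + x') (y + y').
Proof. by move=> [u [v E]] [u' [v' E']]; exists (u + u'), (v + v'); mlra. Qed.

Lemma cong_mull d x y z : cong d x y -> cong d (z * x) (z * y).
Proof.
move=> [u [v E]]; exists (z * u), (z * v).
have K : z * (x + u * d) = z * (y + v * d) by rewrite E.
by mlra.
Qed.

Lemma cong_mul d x y x' y' : cong d x y -> cong d x' y' -> cong d (x * x') (y * y').
Proof.
move=> H K; apply: (@cong_trans _ _ (x * y')); first exact: cong_mull.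
by rewrite !(mmulC _ y'); apply: cong_mull.
Qed.

Lemma cong_multiple d x : cong d (x * d) 0.
Proof. by exists 0, x; mlra. Qed.

(* Coprimality to [d], in a form that is closed under products without
   any appeal to primes or common divisors. *)
Definition invertible (d x : M) : Prop := exists u, cong d (u * x) 1.

Lemma invertible_cong d x y : cong d x y -> invertible d x -> invertible d y.
Proof.
move=> H [u Hu]; exists u; apply: cong_trans Hu; apply: cong_mull; exact: cong_sym.
Qed.

Lemma invertible_mul d x y : invertible d x -> invertible d y -> invertible d (x * y).
Proof.
move=> [u Hu] [v Hv]; exists (u * v).
have -> : u * v * (x * y) = (u * x) * (v * y) by mlra.
by rewrite -[X in cong d _ X](mmul1x 1); apply: cong_mul.
Qed.

Lemma invertible_divisor d x y : invertible d (x * y) -> invertible d x.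
Proof. by move=> [u Hu]; exists (u * y); rewrite (_ : u * y * x = u * (x * y)) //; mlra. Qed.

(** Here [z] is congruent to -1 and hence is its own inverse. *)
Lemma invertible_minus1 d z : cong d (z + 1) 0 -> invertible d z.
Proof.
move=> H; exists z; have [u [v E]] := cong_mull z H.
case: H => u' [v' E']; exists (u + v'), (v + u').
by mlra.
Qed.

(** If [u] inverts [y], then [x * u] is congruent to -1. *)
Lemma invertible_opp d x y : cong d (x + y) 0 -> invertible d y -> invertible d x.
Proof.
move=> H [u Hu]; apply: (@invertible_divisor _ _ u); apply: invertible_minus1.
rewrite (_ : 0 = u * 0); last by mlra.
apply: (@cong_trans _ _ (u * (x + y))); last exact: cong_mull.
rewrite (_ : u * (x + y) = x * u + u * y); last by mlra.
by apply: cong_add; [apply: cong_refl|apply: cong_sym].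
Qed.

(** [L] replaces the factorial of [n], which no term expresses; its mere existence is a Sigma^0_1
    statement and can be proved by induction. *)
Lemma common_multiple (n : M) : exists L, 0 < L /\ forall j, j < n -> exists q, L = q * (j + 1).
Proof.
move: n; apply: S1_induction; first s1.
- by exists 1; split=> [|j /mltx0] //; mlra.
- move=> n [L [HL H]]; exists (L * (n + 1)); split; first by mnra.
  move=> j /mltxS [/H [q ->]|->]; last by exists L.
  by exists (q * (n + 1)); mlra.
Qed.

Section Chinese.
Variables (n c : M) (f : M -> M).
Hypothesis Hc : forall i, i < n -> f i <= c.
Hypothesis Hf : Fn (fun e : env => f (e 0%N)).

(** The two moduli differ by [(k + 1) * b], where [k + 1] is the distance of [i] and [j]. Modulo [d]
    the product [(j + 1) * b] is -1, so [b] is invertible, and with [b] its divisor [k + 1]. *)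
Lemma moduli_invertible b : (forall j, j < n -> exists q, b = q * (j + 1)) ->
  forall i j, i < n -> j < n -> i <> j ->
  invertible (1 + (j + 1) * b) (1 + (i + 1) * b).
Proof.
move=> Hb i j Hi Hj Nij; set d := 1 + (j + 1) * b.
have Ib : invertible d b.
  apply: (@invertible_divisor _ _ (j + 1)); apply: invertible_minus1.
  by exists 0, 1; rewrite /d; mlra.
have Idiff k : k < n -> invertible d ((k + 1) * b).
  move=> /Hb [q E]; apply: invertible_mul => //.
  by apply: (@invertible_divisor _ _ q); rewrite mmulC -E.
case: (mlt_total i j) => [/mltP [k kE]|[//|/mltP [k kE]]].
- apply: (@invertible_opp _ _ ((k + 1) * b)); last by apply: Idiff; mlra.
  by rewrite /d -kE; exists 0, 1; mlra.
- apply: (@invertible_cong _ ((k + 1) * b)); last by apply: Idiff; mlra.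
  by rewrite /d -kE; exists 1, 0; mlra.
Qed.

Lemma s1_cong (g h k : env -> M) : Fn g -> Fn h -> Fn k ->
  S1 (fun e => cong (g e) (h e) (k e)).
Proof.
move=> Hg Hh Hk; apply: S1_ex; apply: S1_ex; apply: S1_D0; rewrite /tail.
have T (l : env -> M) : Fn l -> Fn (fun e => l (fun i => e i.+2)).
  by move=> Hl; apply: (Fn_subst (s := fun e i => e i.+2)) => // i; apply: Tm_var.
by apply: D0_eq; apply: Fn_add;
  first [by apply: T|apply: Fn_mul; [exact: Fn_var|by apply: T]].
Qed.

Ltac s1_user ::= first [apply: s1_cong; d0].

Lemma chinese : exists a b, forall i, i < n ->
  f i < 1 + (i + 1) * b /\ exists q, a = q * (1 + (i + 1) * b) + f i.
Proof.
(* The factor [L] makes [b] divisible by all differences of indices; the factor [c + 1] makes every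
   modulus exceed the values of [f]. *)
have [L [L0 HL]] := common_multiple n; pose b := L * (c + 1).
have Hb j : j < n -> exists q, b = q * (j + 1).
  by move=> /HL [q E]; exists (q * (c + 1)); rewrite /b E; mlra.
have bc i : i < n -> f i < 1 + (i + 1) * b.
  move=> /Hc H; have K : c + 1 <= b by rewrite /b; mnra.
  clearbody b; mnra.
pose d i := 1 + (i + 1) * b.
(* [P] plays the product of the first [k] moduli. Keeping only the properties that matter, and not
   the product itself, leaves a Sigma^0_1 statement to be proved by induction. *)
suff H k : k <= n -> exists a P, (forall i, i < k -> cong (d i) a (f i) /\ cong (d i) P 0) /\
    (forall j, j < n -> k <= j -> invertible (d j) P).
  have [|a [P [Ha _]]] := H n; first mlra.
  exists a, b => i Hi; split; first exact: bc.
  have [u [v E]] := proj1 (Ha i Hi).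
  have [|q [r [aE Hr _]]] := @division a (d i); first by rewrite /d; mnra.
  exists q; rewrite {1}aE; congr madd.
  apply: (@division_unique (q + u) v (d i)) => //; first exact: bc.
  by move: E; rewrite aE; mlra.
rewrite /d in bc * => {d}.
move: k; apply: S1_induction.
- rewrite /invertible.
  apply: S1_imp; first d0.
  have Hf1 : Fn (fun e : env => f (e 0%N)) by [].
  apply: S1_ex; apply: S1_ex; apply: S1_and.
    apply: S1_ball; first d0.
    apply: S1_and; last s1.
    by apply: s1_cong; d0.
  s1.
- move=> _; exists 0, 1; split=> [i /mltx0 //|j Hj _].
  by exists 1; rewrite mmul1x; apply: cong_refl.
- move=> k IH Hk; have [|a [P [H1 H2]]] := IH; first mlra.
  have [||u Hu] := H2 k; [mlra|mlra|].
  (* Modulo the new modulus, [(k + 1) * b] is -1 and [u * P] is 1, so the correction amounts to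
     [f k - a]; modulo the earlier ones [P] is 0 and nothing changes. *)
  exists (a + u * (f k + (k + 1) * b * a) * P), (P * (1 + (k + 1) * b)); split.
  + move=> i /mltxS [Hi|->].
    * have [Ha HP] := H1 i Hi; split.
        rewrite -[X in cong _ _ X](addx0 (f i)); apply: cong_add => //.
        by rewrite -(mulx0 (u * (f k + (k + 1) * b * a))); apply: cong_mull.
      by rewrite (mmulC P) -(mulx0 (1 + (k + 1) * b)); apply: cong_mull.
    * split; last exact: cong_multiple.
      have := cong_mull (f k + (k + 1) * b * a) Hu; move=> [v [w E]].
      exists v, (w + a); mlra.
  + move=> j Hj Hkj; apply: invertible_mul; first by apply: H2 => //; mlra.
    apply: moduli_invertible => //; first mlra.
    by move=> E; rewrite E in Hkj; mlra.
Qed.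

End Chinese.
End Beta.

(** * Codes of sequences, their length and entries *)

Section Sequences.
Variable m : rca.
Local Notation M := (dom m).
Local Notation env := (nat -> M).
Local Open Scope M_scope.

Definition mpair (x y : M) : M := (x + y) * (x + y) + x.

(** This definition and the next three copy the formulas of the language quantifier by quantifier:
    satisfaction unfolds to them, and they are visibly Delta0. *)
Definition Len (s n : M) : Prop :=
  exists a, a <= s /\ exists b, b <= s /\ s = mpair n (mpair a b).

Definition Entry (s i x : M) : Prop :=
  exists n, n <= s /\ exists a, a <= s /\ exists b, b <= s /\
  (s = mpair n (mpair a b) /\ (i < n /\ (x < 1 + (i + 1) * b /\
   exists q, q <= a /\ a = q * (1 + (i + 1) * b) + x))).

Definition Initial (t s : M) : Prop :=
  exists k, k <= t /\ exists n, n <= s /\ (Len t k /\ (Len s n /\ (k <= n /\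
    forall i, i < k -> exists x, x <= s /\ (Entry t i x /\ Entry s i x)))).

Definition IsSeq (s : M) : Prop :=
  (exists n, n <= s /\ Len s n) /\ forall t, t < s -> ~ (Initial t s /\ Initial s t).

(** The code lies between the squares of [x + y] and [x + y + 1], and so determines this sum. *)
Lemma mpair_inj x y x' y' : mpair x y = mpair x' y' -> x = x' /\ y = y'.
Proof.
rewrite /mpair => E.
have S : x + y = x' + y'.
  case: (mlt_total (x + y) (x' + y')) => [H|[//|H]]; exfalso.
  - have H1 : x + y + 1 <= x' + y' by mlra.
    have H2 : (x + y + 1) * (x + y + 1) <= (x' + y') * (x' + y') by mnra.
    mlra.
  - have H1 : x' + y' + 1 <= x + y by mlra.
    have H2 : (x' + y' + 1) * (x' + y' + 1) <= (x + y) * (x + y) by mnra.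
    mlra.
rewrite S in E; split; mlra.
Qed.

Lemma le_square (x : M) : x <= x * x.
Proof. case: (zero_or_succ x) => [->|[y ->]]; mlra. Qed.

Lemma mpair_lel x y : x <= mpair x y.
Proof. rewrite /mpair; mlra. Qed.

Lemma mpair_ler x y : y <= mpair x y.
Proof. by rewrite /mpair; have := le_square (x + y); mlra. Qed.

Lemma mpair_monol x x' y : x <= x' -> mpair x y <= mpair x' y.
Proof. by rewrite /mpair => H; mnra. Qed.

Lemma LenP s n : Len s n <-> exists a b, s = mpair n (mpair a b).
Proof.
split=> [[a [_ [b [_ E]]]]|[a [b E]]]; first by exists a, b.
exists a; split; last first.
  exists b; split=> //; rewrite E.
  by have := mpair_ler n (mpair a b); have := mpair_ler a b; mlra.
by rewrite E; have := mpair_ler n (mpair a b); have := mpair_lel a b; mlra.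
Qed.

Lemma EntryP s i x : Entry s i x <-> exists n a b, s = mpair n (mpair a b) /\ i < n /\
   x < 1 + (i + 1) * b /\ exists q, a = q * (1 + (i + 1) * b) + x.
Proof.
split=> [[n [_ [a [_ [b [_ [E [Hi [Hx [q [_ Hq]]]]]]]]]]]|].
  by exists n, a, b; do 3 split=> //; exists q.
move=> [n [a [b [E [Hi [Hx [q Hq]]]]]]].
exists n; split; first by rewrite E; apply: mpair_lel.
have Hab := mpair_ler n (mpair a b).
exists a; split; first by rewrite E; have := mpair_lel a b; mlra.
exists b; split; first by rewrite E; have := mpair_ler a b; mlra.
do 3 split=> //; exists q; split=> //.
by clear Hx E; mlra.
Qed.

Lemma Len_unique s n k : Len s n -> Len s k -> n = k.
Proof. by move=> /LenP [a [b ->]] /LenP [a' [b' /mpair_inj []]]. Qed.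

Lemma Entry_unique s i x y : Entry s i x -> Entry s i y -> x = y.
Proof.
move=> /EntryP [n [a [b [-> [_ [Hx [q Hq]]]]]]] /EntryP [n' [a' [b' [E [_ [Hy [q' Hq']]]]]]].
have [_ /mpair_inj [aE bE]] := mpair_inj E.
rewrite -aE -bE in Hy Hq'; apply: (@division_unique _ q q' _ _ _ Hx Hy).
by rewrite -Hq.
Qed.

Lemma Entry_le s i x : Entry s i x -> x <= s.
Proof.
move=> /EntryP [n [a [b [-> [_ [_ [q Hq]]]]]]].
have := mpair_ler n (mpair a b); have := mpair_lel a b; mlra.
Qed.

Definition Rep (s : M) : Prop := exists n, n <= s /\ Len s n.

(* Both functions take the value [0] outside their domain. *)
Definition ln (s : M) : M := epsilon (inhabits 0) (fun n => Len s n \/ ~ Rep s /\ n = 0).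

Definition nth (s i : M) : M :=
  epsilon (inhabits 0) (fun x => Entry s i x \/ ~ (exists y, y <= s /\ Entry s i y) /\ x = 0).

Lemma Len_le s n : Len s n -> n <= s.
Proof. by move=> /LenP [a [b ->]]; apply: mpair_lel. Qed.

Lemma lnP s : Len s (ln s) \/ ~ Rep s /\ ln s = 0.
Proof.
apply: (epsilon_spec (inhabits 0) (fun n => Len s n \/ ~ Rep s /\ n = 0)).
case: (pselect (Rep s)) => [[n [_ H]]|H]; first by exists n; left.
by exists 0; right.
Qed.

Lemma nthP s i : Entry s i (nth s i) \/ ~ (exists y, y <= s /\ Entry s i y) /\ nth s i = 0.
Proof.
apply: (epsilon_spec (inhabits 0)
  (fun x => Entry s i x \/ ~ (exists y, y <= s /\ Entry s i y) /\ x = 0)).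
case: (pselect (exists y, y <= s /\ Entry s i y)) => [[n [_ H]]|H]; first by exists n; left.
by exists 0; right.
Qed.

Lemma LenE s n : Len s n <-> Rep s /\ n = ln s.
Proof.
case: (lnP s) => [H|[NR E]]; split.
- by move=> K; split; [exists n; split=> //; apply: Len_le|apply: Len_unique H].
- by move=> [_ ->].
- by move=> K; case: NR; exists n; split=> //; apply: Len_le.
- by case.
Qed.

Lemma EntryE s i x : Entry s i x <-> Rep s /\ i < ln s /\ x = nth s i.
Proof.
split=> [H|[R [Hi ->]]].
  have /EntryP [n [a [b [sE [Hi _]]]]] := H.
  have /LenE [R nE] : Len s n by apply/LenP; exists a, b.
  rewrite -nE; do 2 split=> //; case: (nthP s i) => [/Entry_unique/(_ H)|[N _]] //.
  by case: N; exists x; split=> //; apply: Entry_le H.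
case: (nthP s i) => [//|[N _]]; case: N.
have /LenP [a [b sE]] : Len s (ln s) by apply/LenE.
have [|q [r [aE Hr _]]] := @division _ a (1 + (i + 1) * b); first mlra.
have H : Entry s i r by apply/EntryP; exists (ln s), a, b; do 3 split=> //; exists q.
by exists r; split=> //; apply: Entry_le H.
Qed.

Lemma D0_Len f g : Fn f -> Fn g -> D0 (fun e : env => Len (f e) (g e)).
Proof. by apply: D0_rel2; rewrite /Len /mpair; d0. Qed.

Lemma D0_Entry f g h : Fn f -> Fn g -> Fn h -> D0 (fun e : env => Entry (f e) (g e) (h e)).
Proof. by apply: D0_rel3; rewrite /Entry /mpair; d0. Qed.

Ltac d0_user ::= lazymatch goal with
  | |- D0 (fun e => Len _ _) => apply: D0_Len
  | |- D0 (fun e => Entry _ _ _) => apply: D0_Entry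
  end.

Lemma D0_Rep f : Fn f -> D0 (fun e : env => Rep (f e)).
Proof. by apply: D0_rel1; rewrite /Rep; d0. Qed.

Lemma ln_le s : ln s <= s.
Proof. by case: (lnP s) => [/Len_le //|[_ ->]]; mlra. Qed.

Lemma nth_le s i : nth s i <= s.
Proof. by case: (nthP s i) => [/Entry_le //|[_ ->]]; mlra. Qed.

End Sequences.

Ltac d0_user ::= lazymatch goal with
  | |- D0 (fun e => Len _ _) => apply: D0_Len
  | |- D0 (fun e => Entry _ _ _) => apply: D0_Entry
  | |- D0 (fun e => Rep _) => apply: D0_Rep
  end.

Section SequenceTheory.
Variable m : rca.
Local Notation M := (dom m).
Local Notation env := (nat -> M).
Local Open Scope M_scope.

Lemma Fn_rel1 (F : M -> M) f : (forall x, F x <= x) -> D0 (fun e : env => e 0%N = F (e 1%N)) ->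
  Fn f -> Fn (fun e => F (f e)).
Proof.
move=> HF DF Hf; have [[t [Tt Ht]] _] := Hf; split.
  by exists t; split=> // e; have := HF (f e); have := Ht e; mlra.
apply: (D0_rel2 (R := fun x y => x = F y) (f := fun e => e 0%N) (g := fun e => f (tail e))) => //.
  exact: Fn_var.
exact: Fn_tail.
Qed.

Lemma Fn_rel2 (F : M -> M -> M) f g : (forall x y, F x y <= x) ->
  D0 (fun e : env => e 0%N = F (e 1%N) (e 2%N)) ->
  Fn f -> Fn g -> Fn (fun e => F (f e) (g e)).
Proof.
move=> HF DF Hf Hg; have [[t [Tt Ht]] _] := Hf; split.
  by exists t; split=> // e; have := HF (f e) (g e); have := Ht e; mlra.
apply: (D0_rel3 (R := fun x y z => x = F y z) (f := fun e => e 0%N)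
  (g := fun e => f (tail e)) (h := fun e => g (tail e))) => //.
- exact: Fn_var.
- exact: Fn_tail.
- exact: Fn_tail.
Qed.

Lemma Fn_ln f : Fn f -> Fn (fun e : env => ln (f e)).
Proof.
apply: Fn_rel1; first exact: ln_le.
apply: (D0_ext (P := fun e : env => Len (e 1%N) (e 0%N) \/ ~ Rep (e 1%N) /\ e 0%N = 0)); last d0.
move=> e; split=> [[/LenE [] //|[N ->]]|->]; last exact: lnP.
by case: (lnP (e 1%N)) => [/LenE [/N]|[]].
Qed.

Lemma Fn_nth f g : Fn f -> Fn g -> Fn (fun e : env => nth (f e) (g e)).
Proof.
apply: Fn_rel2; first exact: nth_le.
apply: (D0_ext (P := fun e : env => Entry (e 1%N) (e 2%N) (e 0%N) \/
  ~ (exists y, y <= e 1%N /\ Entry (e 1%N) (e 2%N) y) /\ e 0%N = 0)); last d0.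
move=> e; split=> [[/EntryE [_ [_]] //|[N ->]]|->]; last exact: nthP.
case: (nthP (e 1%N) (e 2%N)) => [H|[] //].
by case: N; exists (nth (e 1%N) (e 2%N)); split=> //; apply: nth_le.
Qed.

Definition ite (P : Prop) (x y : M) : M := if pselect P is left _ then x else y.

Lemma ite_true P x y : P -> ite P x y = x.
Proof. by rewrite /ite; case: pselect. Qed.

Lemma ite_false P x y : ~ P -> ite P x y = y.
Proof. by rewrite /ite; case: pselect. Qed.

Lemma Fn_ite P f g : D0 P -> Fn f -> Fn g -> Fn (fun e : env => ite (P e) (f e) (g e)).
Proof.
move=> HP Hf Hg; have [[t [Tt Ht]] _] := Hf; have [[u [Tu Hu]] _] := Hg; split.
  exists (fun e => t e + u e); split; first exact: Tm_add.
  by move=> e; have := Ht e; have := Hu e; rewrite /ite; case: pselect => _; mlra.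
apply: (D0_ext (P := fun e => P (tail e) /\ e 0%N = f (tail e) \/
                            ~ P (tail e) /\ e 0%N = g (tail e))).
  move=> e; split=> [[[H ->]|[H ->]]|].
  - by rewrite ite_true.
  - by rewrite ite_false.
  - by rewrite /ite; case: pselect => H E; [left|right].
have HP' := D0_tail HP; have Hf' := Fn_tail Hf; have Hg' := Fn_tail Hg.
by apply: D0_or; apply: D0_and => //; try (by apply: D0_not);
  apply: D0_eq => //; apply: Fn_var.
Qed.

Lemma Fn_mpair f g : Fn f -> Fn g -> Fn (fun e : env => mpair (f e) (g e)).
Proof. by move=> Hf Hg; rewrite /mpair; d0. Qed.

Ltac fn_user ::= lazymatch goal with
  | |- Fn (fun e => ln _) => apply: Fn_ln
  | |- Fn (fun e => nth _ _) => apply: Fn_nth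
  | |- Fn (fun e => ite _ _ _) => apply: Fn_ite
  | |- Fn (fun e => mpair _ _) => apply: Fn_mpair
  end.

Lemma InitialE (t s : M) : Initial t s <->
  Rep t /\ Rep s /\ ln t <= ln s /\ forall i, i < ln t -> nth t i = nth s i.
Proof.
split=> [[k [_ [n [_ [/LenE [Rt ->] [/LenE [Rs ->] [Hkn H]]]]]]]|[Rt [Rs [Hle H]]]].
  do 3 split=> //; move=> i /H [x [_ [/EntryE [_ [_ <-]] /EntryE [_ [_ <-]]]]] //.
exists (ln t); split; first exact: ln_le.
exists (ln s); split; first exact: ln_le.
do 2 (split; first by apply/LenE); split=> // i Hi.
exists (nth t i); split; first by rewrite (H _ Hi); apply: nth_le.
by split; apply/EntryE; do 2 split=> //; [mlra|apply: H].
Qed.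

Lemma D0_Initial f g : Fn f -> Fn g -> D0 (fun e : env => Initial (f e) (g e)).
Proof. by apply: D0_rel2; rewrite /Initial; d0. Qed.

Ltac d0_user ::= lazymatch goal with
  | |- D0 (fun e => Len _ _) => apply: D0_Len
  | |- D0 (fun e => Entry _ _ _) => apply: D0_Entry
  | |- D0 (fun e => Rep _) => apply: D0_Rep
  | |- D0 (fun e => Initial _ _) => apply: D0_Initial
  end.

Lemma D0_IsSeq f : Fn f -> D0 (fun e : env => IsSeq (f e)).
Proof. by apply: D0_rel1; rewrite /IsSeq; d0. Qed.

Ltac d0_user ::= lazymatch goal with
  | |- D0 (fun e => Len _ _) => apply: D0_Len
  | |- D0 (fun e => Entry _ _ _) => apply: D0_Entry
  | |- D0 (fun e => Rep _) => apply: D0_Rep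
  | |- D0 (fun e => Initial _ _) => apply: D0_Initial
  | |- D0 (fun e => IsSeq _) => apply: D0_IsSeq
  end.

Lemma Initial_refl (s : M) : Rep s -> Initial s s.
Proof. by move=> R; apply/InitialE; do 3 split=> //; mlra. Qed.

Lemma Initial_trans (s t u : M) : Initial s t -> Initial t u -> Initial s u.
Proof.
move=> /InitialE [Rs [Rt [H1 H2]]] /InitialE [_ [Ru [H3 H4]]]; apply/InitialE.
do 2 split=> //; split; first mlra.
by move=> i Hi; rewrite H2 // H4 //; mlra.
Qed.

Lemma IsSeq_Rep (s : M) : IsSeq s -> Rep s.
Proof. by case. Qed.

(** Take the least number that represents the same sequence, sameness meaning that each is an
    initial segment of the other. *)
Lemma canonical (s : M) : Rep s -> exists t, [/\ IsSeq t, t <= s, ln t = ln s &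
  forall i, i < ln s -> nth t i = nth s i].
Proof.
move=> R.
have [|t [Hle [I1 I2] Hmin]] :=
  @D0_least m (fun t => Initial t s /\ Initial s t) _ s (conj (Initial_refl R) (Initial_refl R)).
  by d0.
have /InitialE [Rt [_ [L1 N1]]] := I1; have /InitialE [_ [_ [L2 N2]]] := I2.
exists t; split=> //; last by move=> i Hi; rewrite N1 //; mlra.
  split=> // u Hu [J1 J2]; apply: (Hmin u Hu).
  by split; [apply: Initial_trans J1 I1|apply: Initial_trans I2 J2].
by mlra.
Qed.

(** Shortening the length component of [s] while keeping [a] and [b] gives a representation of [t]
    that is at most [s], and [t] is the least of its representations. *)
Lemma IsSeq_le (t s : M) : IsSeq t -> Initial t s -> t <= s.
Proof.
move=> [_ Hmin] /InitialE [Rt [Rs [Hl Hn]]].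
have /LenP [a [b sE]] : Len s (ln s) by apply/LenE.
pose u := mpair (ln t) (mpair a b).
have us : u <= s by rewrite sE; apply: mpair_monol.
have uE i x : Entry u i x <-> i < ln t /\ Entry s i x.
  rewrite !EntryP; split.
    move=> [n [a' [b' [/mpair_inj [<- /mpair_inj [<- <-]] [Hi H]]]]].
    by split=> //; exists (ln s), a, b; split=> //; split=> //; mlra.
  move=> [Hi [n [a' [b' []]]]]; rewrite {1}sE => /mpair_inj [_ /mpair_inj [<- <-]] [_ H].
  by exists (ln t), a, b; split.
have /LenE [Ru lu] : Len u (ln t) by apply/LenP; exists a, b.
have nu i : i < ln t -> nth u i = nth t i.
  move=> Hi; have /EntryE [_ [_ ->]] : Entry u i (nth t i); last by [].
  by apply/uE; split=> //; apply/EntryE; do 2 split=> //; [mlra|apply: Hn].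
apply: contrapT => N; apply: (Hmin u); first mlra.
split; apply/InitialE; rewrite -lu; do 2 split=> //; split; try mlra.
- exact: nu.
- by move=> i Hi; rewrite nu.
Qed.

Lemma mlt_asym (x y : M) : x <= y -> y <= x -> x = y.
Proof. by move=> H K; mlra. Qed.

Lemma IsSeq_eq (t s : M) : IsSeq t -> IsSeq s -> ln t = ln s ->
  (forall i, i < ln t -> nth t i = nth s i) -> t = s.
Proof.
move=> Ht Hs Hl Hn; apply: mlt_asym; apply: IsSeq_le => //; apply/InitialE.
- by do 2 (split; first exact: IsSeq_Rep); split=> //; rewrite Hl; mlra.
- do 2 (split; first exact: IsSeq_Rep); split; first by rewrite Hl; mlra.
  by move=> i Hi; rewrite Hn // Hl.
Qed.

Lemma mkseq_Fn (f : M -> M) n : (forall g, Fn g -> Fn (fun e : env => f (g e))) ->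
  exists s, [/\ IsSeq s, ln s = n & forall i, i < n -> nth s i = f i].
Proof.
move=> Hf.
(* Collection provides the common bound on the values that the choice of moduli requires. *)
have [||c Hc] := @S1_collection m (fun x y => y = f x) n; first d0.
  by move=> x _; exists (f x).
have [i Hi||a [b Hab]] := @chinese m n c f.
- by have [y [Hy <-]] := Hc i Hi; mlra.
- by apply: Hf; apply: Fn_var.
pose s := mpair n (mpair a b).
have /LenE [Rs ls] : Len s n by apply/LenP; exists a, b.
have ns i : i < n -> nth s i = f i.
  move=> Hi; have [Hx [q Hq]] := Hab i Hi.
  have /EntryE [_ [_ ->]] : Entry s i (f i); last by [].
  by apply/EntryP; exists n, a, b; do 3 split=> //; exists q.
have [t [Ht _ lt nt]] := canonical Rs.
exists t; rewrite lt -ls; split=> // i Hi; rewrite nt -?ls //.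
exact: ns.
Qed.

Lemma seq_rcons (s x : M) : exists t, [/\ IsSeq t, ln t = ln s + 1, nth t (ln s) = x &
  forall i, i < ln s -> nth t i = nth s i].
Proof.
have [|t [Ht lt nt]] := @mkseq_Fn (fun i => ite (i < ln s) (nth s i) x) (ln s + 1).
  by move=> g Hg; d0.
exists t; split=> //.
- by rewrite nt ?ite_false //; mlra.
- by move=> i Hi; rewrite nt ?ite_true //; mlra.
Qed.

(** Finite choice for Sigma^0_1 relations: induction on the length appends one witness at a time. *)
Lemma mkseq_S1 (R : M -> M -> Prop) n :
  (forall f g, Fn f -> Fn g -> S1 (fun e : env => R (f e) (g e))) ->
  (forall i, i < n -> exists x, R i x) ->
  exists s, [/\ IsSeq s, ln s = n & forall i, i < n -> R i (nth s i)].
Proof.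
move=> HR Hn.
suff H k : k <= n -> exists s, (IsSeq s /\ ln s = k) /\ forall i, i < k -> R i (nth s i).
  by have [|s [[Hs ls] H1]] := H n; [mlra|exists s].
move: k; apply: S1_induction; first s1.
- move=> _; have [|s [Hs ls _]] := @mkseq_Fn id 0; first by [].
  by exists s; split=> // i /mltx0.
- move=> k IH Hk; have [|s [[Hs ls] H]] := IH; first mlra.
  have [|x Rx] := Hn k; first mlra.
  have [t [Ht lt nt1 nt2]] := seq_rcons s x.
  exists t; split; first by rewrite lt ls.
  move=> i /mltxS [Hi|->]; last by rewrite -ls nt1 ls.
  by rewrite nt2 ?ls //; apply: H.
Qed.

End SequenceTheory.

(** * Semantics of the principles *)

Section Translation.
Variable m : rca.
Local Notation M := (dom m).
Local Open Scope M_scope.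
Implicit Types (e : nat -> M) (E : nat -> sets m).

Definition FinSet (F : M) : Prop :=
  IsSeq F /\ forall i j x y, i < j /\ Entry F i x /\ Entry F j y -> x < y.

Definition CardLe (P : sets m) (c : M) : Prop :=
  forall F, FinSet F /\ (forall i x, Entry F i x -> mem x P) -> forall n, Len F n -> n <= c.

Definition Function (G : sets m) : Prop :=
  (forall z, mem z G -> exists x y, z = mpair x y) /\
  (forall x, exists y, mem (mpair x y) G /\ forall z, mem (mpair x z) G -> z = y).

Definition Tree (C : M -> Prop) : Prop :=
  forall s, C s -> IsSeq s /\ forall t, IsSeq t /\ Initial t s -> C t.

Definition Infinite (C : M -> Prop) : Prop := forall x, exists y, x < y /\ C y.

Definition PrefixFree (P : sets m) : Prop :=
  forall x y, ~ (mem x P /\ mem y P /\ Initial x y /\ x <> y).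

Definition PFBounded (C : M -> Prop) : Prop :=
  exists c, forall P, PrefixFree P /\ (forall x, mem x P -> C x) -> CardLe P c.

Definition Path (C : M -> Prop) (G : sets m) : Prop :=
  Function G /\ forall s, IsSeq s /\ (forall i x, Entry s i x -> mem (mpair i x) G) -> C s.

Definition Binary (s : M) : Prop := IsSeq s /\ forall i x, Entry s i x -> x < 1 + 1.

Definition Range (X : sets m) (y : M) : Prop := exists n, mem (mpair n y) X.

Lemma eval_liftE e k t : eval e (lift k t) = eval (fun i => e (Nat.add k i)) t.
Proof. by rewrite /lift eval_subst. Qed.

Lemma eval_cpair e t u : eval e (cpair t u) = mpair (eval e t) (eval e u).
Proof. by []. Qed.

Ltac sat_user := fail.

Ltac sat_unfold := repeat first
  [ sat_user | setoid_rewrite sat_and | setoid_rewrite sat_bex | setoid_rewrite sat_ball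
  | setoid_rewrite sat_ex1 | setoid_rewrite sat_ex2 | setoid_rewrite sat_neg
  | progress cbn [sat eval] | setoid_rewrite eval_cpair | setoid_rewrite eval_liftE
  | progress cbn [scons Nat.add] ].

Lemma sat_len e E s n : sat e E (len s n) <-> Len (eval e s) (eval e n).
Proof. by rewrite /len /Len; sat_unfold. Qed.

Lemma sat_entry e E s i x : sat e E (entry s i x) <-> Entry (eval e s) (eval e i) (eval e x).
Proof. by rewrite /entry /Entry; sat_unfold. Qed.

Ltac sat_user ::= first [ setoid_rewrite sat_len | setoid_rewrite sat_entry ].

Lemma sat_initial e E s t : sat e E (initial s t) <-> Initial (eval e s) (eval e t).
Proof. by rewrite /initial /Initial; sat_unfold. Qed.

Ltac sat_user ::= first
  [ setoid_rewrite sat_len | setoid_rewrite sat_entry | setoid_rewrite sat_initial ].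

Lemma sat_is_seq e E s : sat e E (is_seq s) <-> IsSeq (eval e s).
Proof. by rewrite /is_seq /IsSeq; sat_unfold. Qed.

Ltac sat_user ::= first
  [ setoid_rewrite sat_len | setoid_rewrite sat_entry | setoid_rewrite sat_initial
  | setoid_rewrite sat_is_seq ].

Lemma sat_finset e E s : sat e E (finset s) <-> FinSet (eval e s).
Proof. by rewrite /finset /FinSet; sat_unfold. Qed.

Lemma sat_binary e E s : sat e E (binary s) <-> Binary (eval e s).
Proof. by rewrite /binary /Binary; sat_unfold. Qed.

Ltac sat_user ::= first
  [ setoid_rewrite sat_len | setoid_rewrite sat_entry | setoid_rewrite sat_initial
  | setoid_rewrite sat_is_seq | setoid_rewrite sat_finset ].

Lemma sat_card_le e E P c : sat e E (card_le P c) <-> CardLe (E P) (eval e c).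
Proof. by rewrite /card_le /CardLe; sat_unfold. Qed.

Lemma sat_function e E F : sat e E (function F) <-> Function (E F).
Proof. by rewrite /function /Function; sat_unfold. Qed.

Lemma sat_prefix_free e E P : sat e E (prefix_free P) <-> PrefixFree (E P).
Proof. by rewrite /prefix_free /PrefixFree; sat_unfold. Qed.

Lemma sat_as_range e E X t : sat e E (as_range X t) <-> Range (E X) (eval e t).
Proof. by rewrite /as_range /Range; sat_unfold. Qed.

Section Class.
Variables (C : class) (S : sets m -> M -> Prop).
Hypothesis CS : forall e E X t, sat e E (C X t) <-> S (E X) (eval e t).

Ltac sat_user ::= first
  [ setoid_rewrite sat_len | setoid_rewrite sat_entry | setoid_rewrite sat_initial
  | setoid_rewrite sat_is_seq | setoid_rewrite CS ].

(** With an arbitrary class [C] of meaning [S], trees that are sets and trees that are enumerated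
    are translated at once. *)
Lemma sat_tree e E T : sat e E (tree C T) <-> Tree (S (E T)).
Proof. by rewrite /tree /Tree; sat_unfold. Qed.

Lemma sat_infinite e E T : sat e E (infinite C T) <-> Infinite (S (E T)).
Proof. by rewrite /infinite /Infinite; sat_unfold. Qed.

Lemma sat_pf_bounded e E T : sat e E (pf_bounded C T) <-> PFBounded (S (E T)).
Proof.
rewrite sat_ex1; split=> -[c H]; exists c.
- move=> P [HP HC]; have /sat_imp := proj1 (sat_all2 _ _ _) H P.
  rewrite sat_and sat_prefix_free sat_card_le; apply; split=> // x Hx.
  by apply/CS/HC.
- apply/sat_all2 => P; apply/sat_imp; rewrite sat_and sat_prefix_free sat_card_le => -[HP HC].
  by apply: H; split=> // x Hx; have /CS := HC x Hx.
Qed.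

Lemma sat_path e E T G : sat e E (path C T G) <-> Path (S (E T)) (E G).
Proof. by rewrite /path /Path sat_and sat_function; sat_unfold. Qed.

End Class.

Definition WKL_pf : Prop := forall X : sets m,
  Function X /\ (forall y, Range X y -> Binary y) /\ Tree (Range X) /\
  Infinite (Range X) /\ PFBounded (Range X) -> exists G, Path (Range X) G.

Definition KL_pf : Prop := forall X : sets m,
  Tree (fun t => mem t X) /\ Infinite (fun t => mem t X) /\ PFBounded (fun t => mem t X) -> exists G, Path (fun t => mem t X) G.

Lemma sat_WKL e E : sat e E Sigma01_WKL_pf_bd <-> WKL_pf.
Proof.
have H X : sat e (X .: E) (All1 (Imp (as_range O (Var O)) (binary (Var O)))) <->
    forall y, Range X y -> Binary y.
  split=> H; last by apply/sat_all1 => y; apply/sat_imp => /sat_as_range /H Hy; apply/sat_binary.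
  move=> y Hy; apply/(sat_binary (y .: e) (X .: E) (Var O)).
  by have /sat_imp := proj1 (sat_all1 _ _ _) H y; apply; apply/sat_as_range.
rewrite sat_all2; split=> K X; have := K X;
  rewrite sat_imp sat_and sat_function sat_and H sat_and (sat_tree sat_as_range) sat_and
    (sat_infinite sat_as_range) (sat_pf_bounded sat_as_range) sat_ex2 => K' /K' [G HG];
  by exists G; first [by move/(sat_path sat_as_range): HG|by apply/(sat_path sat_as_range)].
Qed.

Lemma sat_KL e E : sat e E KL_pf_bd <-> KL_pf.
Proof.
pose S (X : sets m) t := mem t X.
have SS e' E' X t : sat e' E' (as_set X t) <-> S (E' X) (eval e' t) by [].
rewrite sat_all2; split=> K X; have := K X;
  rewrite sat_imp sat_and (sat_tree SS) sat_and (sat_infinite SS) (sat_pf_bounded SS) sat_ex2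
    => K' /K' [G HG];
  by exists G; first [by move/(sat_path SS): HG|by apply/(sat_path SS)].
Qed.

End Translation.

Ltac d0_user ::= lazymatch goal with
  | |- D0 (fun e => Len _ _) => apply: D0_Len
  | |- D0 (fun e => Entry _ _ _) => apply: D0_Entry
  | |- D0 (fun e => Rep _) => apply: D0_Rep
  | |- D0 (fun e => Initial _ _) => apply: D0_Initial
  | |- D0 (fun e => IsSeq _) => apply: D0_IsSeq
  end.

Ltac fn_user ::= lazymatch goal with
  | |- Fn (fun e => ln _) => apply: Fn_ln
  | |- Fn (fun e => nth _ _) => apply: Fn_nth
  | |- Fn (fun e => ite _ _ _) => apply: Fn_ite
  | |- Fn (fun e => mpair _ _) => apply: Fn_mpair
  end.

(** * Sorting and the pigeonhole principle *)

Section Sorting.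
Variable m : rca.
Local Notation M := (dom m).
Local Notation env := (nat -> M).
Local Open Scope M_scope.

Definition Increasing (F : M) : Prop :=
  forall j, j < ln F -> forall i, i < j -> nth F i < nth F j.

Lemma FinSetE F : FinSet F <-> IsSeq F /\ Increasing F.
Proof.
split=> -[HF H]; split=> //.
- move=> j Hj i Hi; apply: (H i j); split=> //.
  by split; apply/EntryE; split; try exact: IsSeq_Rep; split=> //; mlra.
- by move=> i j x y [Hi [/EntryE [_ [_ ->]] /EntryE [_ [Hj ->]]]]; apply: H.
Qed.

Lemma insert_increasing F x : IsSeq F -> Increasing F ->
  (forall i, i < ln F -> nth F i <> x) ->
  exists F', [/\ IsSeq F', Increasing F', ln F' = ln F + 1 &
    forall i, i < ln F' -> nth F' i = x \/ exists j, j < ln F /\ nth F' i = nth F j].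
Proof.
move=> HF IF Nx.
(* [p] is the place of insertion; the first disjunct makes it the end of [F] when no entry exceeds
   [x]. *)
have [||p [Hp Pp Hmin]] := @D0_least m (fun p => ln F <= p \/ x < nth F p) _ (ln F).
- by d0.
- by left; mlra.
have Hlt i : i < p -> i < ln F /\ nth F i < x.
  move=> Hi; have Hi' : i < ln F by mlra.
  split=> //; have [//|[E|H]] := mlt_total (nth F i) x; first by case: (Nx i).
  by case: (Hmin i Hi); right.
have Hge i : p <= i -> i < ln F -> x < nth F i.
  move=> Hi Hi'; case: Pp => [H|H]; first by mlra.
  case: (mlt_total p i) => [K|[<- //|K]]; last by mlra.
  by have := IF i Hi' p K; mlra.
(* The graph of the new sequence: entries below [p] are kept, [x] stands at [p], and later entries
   are moved up by one from index [j] to [j + 1]. *)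
pose R i y := (i < p /\ y = nth F i) \/ (i = p /\ y = x) \/
  exists j, j < i /\ (i = j + 1 /\ p <= j /\ y = nth F j).
have [f g Hf Hg|i Hi|F' [HF' lF' H]] := @mkseq_S1 m R (ln F + 1).
- by rewrite /R; s1.
- case: (mlt_total i p) => [K|[K|K]]; first by exists (nth F i); left.
    by exists x; right; left.
  case: (zero_or_succ i) => [E|[j E]]; first by mlra.
  by exists (nth F j); right; right; exists j; split; [mlra|split=> //; split=> //; mlra].
exists F'; split=> //.
- move=> j Hj i Hi; have Hj' : j < ln F + 1 by rewrite -lF'.
  have [[K1 ->]|[[E1 ->]|[j' [Hj1 [Ej [Kj ->]]]]]] := H j Hj'; have Hi' : i < ln F + 1 by mlra.
  + have [[K2 ->]|[[E2 ->]|[i' [Hi1 [Ei [Ki ->]]]]]] := H i Hi'; [|mlra|mlra].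
    by apply: IF => //; case: (Hlt j K1).
  + have [[K2 ->]|[[E2 ->]|[i' [Hi1 [Ei [Ki ->]]]]]] := H i Hi'; [|mlra|mlra].
    by case: (Hlt i K2).
  + have Hj2 : j' < ln F by mlra.
    have Kx := Hge j' Kj Hj2.
    have [[K2 ->]|[[E2 ->]|[i' [Hi1 [Ei [Ki ->]]]]]] := H i Hi' => //.
    * by case: (Hlt i K2) => _; mlra.
    * by apply: IF => //; mlra.
- move=> i Hi; have Hi' : i < ln F + 1 by rewrite -lF'.
  have [[K1 ->]|[[E1 ->]|[j' [Hj1 [Ej [Kj ->]]]]]] := H i Hi'; [right|by left|right].
  + by exists i; split=> //; case: (Hlt i K1).
  + by exists j'; split=> //; mlra.
Qed.

Lemma D0_Increasing f : Fn f -> D0 (fun e : env => Increasing (f e)).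
Proof. by apply: D0_rel1; rewrite /Increasing; d0. Qed.

Definition Injective (s : M) : Prop :=
  forall i j, i < ln s -> j < ln s -> nth s i = nth s j -> i = j.

(** Finite sets are coded by increasing sequences, whereas antichains and lists of colours arise in
    arbitrary order. *)
Lemma sort s : Injective s -> exists F, [/\ IsSeq F, Increasing F, ln F = ln s &
  forall i, i < ln F -> exists j, j < ln s /\ nth F i = nth s j].
Proof.
move=> Inj.
(* Entries come from the first [k] entries of [s], so injectivity guarantees that the next one,
   [nth s k], is new and can be inserted. *)
suff H k : k <= ln s -> exists F, (IsSeq F /\ Increasing F /\ ln F = k) /\
    forall i, i < k -> exists j, j < k /\ nth F i = nth s j.
  have [|F [[HF [IF lF]] H1]] := H (ln s); first mlra.
  by exists F; split=> //; rewrite lF.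
have HI := D0_Increasing.
move: k; apply: S1_induction; first s1.
- move=> _; have [|F [HF lF _]] := @mkseq_Fn m id 0; first by [].
  exists F; split; last by move=> i /mltx0.
  by split=> //; split=> //; rewrite /Increasing lF => j /mltx0.
- move=> k IH Hk; have [|F [[HF [IF lF]] H]] := IH; first mlra.
  have [i Hi E|F' [HF' IF' lF' H']] := @insert_increasing F (nth s k) HF IF.
    have [|j [Hj E']] := H i; first by rewrite -lF.
    have jk : j = k by apply: Inj; [mlra|mlra|rewrite -E' E].
    by mlra.
  exists F'; split; first by split=> //; split=> //; rewrite lF' lF.
  move=> i Hi; have [|->|[j [Hj ->]]] := H' i; first by rewrite lF' lF.
    by exists k; split=> //; mlra.
  have [|j' [Hj' ->]] := H j; first by rewrite -lF.
  by exists j'; split=> //; mlra.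
Qed.

Lemma Increasing_ge F i : Increasing F -> i < ln F -> i <= nth F i.
Proof.
move=> IF; move: i; apply: S1_induction; first s1.
- by move=> _; mlra.
- move=> i IH Hi; have K : i < ln F by mlra.
  have K' : i < i + 1 by mlra.
  by have := IF _ Hi _ K'; have := IH K; mlra.
Qed.

(** If the sequence were longer than [n], its sorted version would have an entry at index [n], and
    that entry would be at least [n]. *)
Lemma pigeonhole s n : Injective s -> (forall i, i < ln s -> nth s i < n) -> ln s <= n.
Proof.
move=> /sort [F [HF IF lF H]] Hn; apply: contrapT => N.
have Hl : n < ln F by rewrite lF; mlra.
have := Increasing_ge IF Hl; have [j [Hj ->]] := H n Hl.
by have := Hn j Hj; mlra.
Qed.

Lemma CardLeE P c : CardLe P c <-> forall s, IsSeq s -> Injective s ->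
  (forall i, i < ln s -> mem (nth s i) P) -> ln s <= c.
Proof.
split=> [H s Hs Inj Hm|H F [/FinSetE [HF IF] Hm] n /LenE [_ ->]].
- have [F [HF IF lF K]] := sort Inj; rewrite -lF; apply: (H F).
    split; first exact/FinSetE.
    by move=> i x /EntryE [_ [/K [j [/Hm Hj E]] ->]]; rewrite E.
  by apply/LenE; split=> //; apply: IsSeq_Rep.
- apply: H => //.
    move=> i j Hi Hj E; have [K|[//|K]] := mlt_total i j.
      by have := IF j Hj i K; rewrite E; mlra.
    by have := IF i Hi j K; rewrite E; mlra.
  by move=> i Hi; apply: (Hm i); apply/EntryE; split=> //; apply: IsSeq_Rep.
Qed.

End Sorting.

(** * Bounding yields paths *)

Section Paths.
Variable m : rca.
Local Notation M := (dom m).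
Local Notation env := (nat -> M).
Local Open Scope M_scope.

Definition Incomparable (s t : M) : Prop := ~ Initial s t /\ ~ Initial t s.

Lemma Incomparable_sym s t : Incomparable s t -> Incomparable t s.
Proof. by case. Qed.

Lemma Initial_linear (a b t : M) : Initial a t -> Initial b t -> Initial a b \/ Initial b a.
Proof.
move=> /InitialE [Ra [_ [la na]]] /InitialE [Rb [_ [lb nb]]].
have [H|H] := mle_total (ln a) (ln b); [left|right]; apply/InitialE; do 3 split=> //.
- by move=> i Hi; rewrite na ?nb //; mlra.
- by move=> i Hi; rewrite nb ?na //; mlra.
Qed.

(** A finite prefix-free set listed as a sequence, so that the property is Delta0 in the code. *)
Definition Antichain (s : M) : Prop :=
  forall i, i < ln s -> forall j, j < ln s -> i <> j -> Incomparable (nth s i) (nth s j).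

Lemma D0_Antichain f : Fn f -> D0 (fun e : env => Antichain (f e)).
Proof. by apply: D0_rel1; rewrite /Antichain /Incomparable; d0. Qed.

Section Tree.
Variable C : M -> Prop.
Hypothesis SC : forall f, Fn f -> S1 (fun e : env => C (f e)).
Hypothesis TC : Tree C.

(** The boundedness hypothesis speaks of sets, so comprehension first collects the entries of [s]
    into one. *)
Lemma antichain_bound c :
  (forall P, PrefixFree P /\ (forall x, mem x P -> C x) -> CardLe P c) ->
  forall s, IsSeq s -> Antichain s -> (forall i, i < ln s -> C (nth s i)) -> ln s <= c.
Proof.
move=> HP s Hs As Cs.
have [||P memP] := @S1_comprehension m (fun x => exists i, i < ln s /\ x = nth s i); try s1.
apply: (proj1 (CardLeE P c)) => //.
- apply: HP; split; last by move=> x /memP [i [Hi ->]]; apply: Cs.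
  move=> x y [/memP [i [Hi ->]] [/memP [j [Hj ->]] [I N]]].
  by have [] := As i Hi j Hj; [move=> E; apply: N; rewrite E|].
- move=> i j Hi Hj E; apply: contrapT => N; have [] := As i Hi j Hj N.
  by rewrite E => -[]; apply: Initial_refl; apply: IsSeq_Rep; case: (TC (Cs j Hj)).
- by move=> i Hi; apply/memP; exists i.
Qed.

Hypothesis bounded : PFBounded C.

(** If every antichain in [C] could be replaced by one with one more element, Sigma^0_1 induction on
    the length would reach [c + 1]. *)
Lemma maximal_antichain : exists s, [/\ IsSeq s, Antichain s, forall i, i < ln s -> C (nth s i) &
  forall t, IsSeq t -> Antichain t -> (forall i, i < ln t -> C (nth t i)) -> ln t <> ln s + 1].
Proof.
have [c HP] := bounded; apply: contrapT => N.
have HA := D0_Antichain.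
suff [s [[Hs [As ls]] Cs]] : exists s, (IsSeq s /\ Antichain s /\ ln s = c + 1) /\
    forall i, i < ln s -> C (nth s i).
  by have := antichain_bound HP Hs As Cs; rewrite ls; mlra.
move: (c + 1); apply: S1_induction; first s1.
- have [|s [Hs ls _]] := @mkseq_Fn m id 0; first by [].
  exists s; split; last by move=> i; rewrite ls => /mltx0.
  by split=> //; split=> // i; rewrite ls => /mltx0.
- move=> k [s [[Hs [As ls]] Cs]]; apply: contrapT => N'; apply: N; exists s; split=> //.
  by move=> t Ht At Ct lt; apply: N'; exists t; do 2 split=> //; rewrite lt ls.
Qed.

Section MaximalAntichain.
Variable s : M.
Hypotheses (Hs : IsSeq s) (As : Antichain s) (Cs : forall i, i < ln s -> C (nth s i)).
Hypothesis maxs : forall t, IsSeq t -> Antichain t -> (forall i, i < ln t -> C (nth t i)) ->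
  ln t <> ln s + 1.

Lemma maximal_comparable t : C t ->
  exists i, i < ln s /\ (Initial t (nth s i) \/ Initial (nth s i) t).
Proof.
move=> Ct; apply: contrapT => N.
have inc i : i < ln s -> Incomparable (nth s i) t.
  by move=> Hi; split=> I; apply: N; exists i; split=> //; [right|left].
have [u [Hu lu nu1 nu2]] := seq_rcons s t.
apply: (maxs Hu) => //; rewrite /Antichain lu.
- move=> i /mltxS [Hi|->] j /mltxS [Hj|->] Nij; rewrite ?nu1 ?nu2 //.
  + exact: As.
  + exact: inc.
  + by apply: Incomparable_sym; apply: inc.
- by move=> i /mltxS [Hi|->]; rewrite ?nu1 ?nu2 //; apply: Cs.
Qed.

(** Two incomparable extensions could replace the [i]-th element and yield a longer antichain. They
    are incomparable with every other element, since comparability would pass down to the [i]-th. *)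
Lemma cone_linear i t u : i < ln s -> C t -> C u -> Initial (nth s i) t -> Initial (nth s i) u ->
  Initial t u \/ Initial u t.
Proof.
move=> Hi Ct Cu It Iu; apply: contrapT => N.
have tu : Incomparable t u by split=> I; apply: N; [left|right].
have off v j : Initial (nth s i) v -> j < ln s -> j <> i -> Incomparable v (nth s j).
  move=> Iv Hj Nj; have [I1 I2] := As Hi Hj (nesym Nj); split=> I.
    by apply: I1; apply: Initial_trans Iv I.
  by case: (Initial_linear Iv I).
(* [t] takes the place of the [i]-th element and [u] is appended at the end. *)
have [|w [Hw lw nw]] :=
  @mkseq_Fn m (fun j => ite (j = i) t (ite (j < ln s) (nth s j) u)) (ln s + 1).
  by move=> g Hg; d0.
have wi : nth w i = t by rewrite nw ?ite_true //; mlra.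
have wu : nth w (ln s) = u.
  by rewrite nw ?ite_false //; [mlra| move=> E; rewrite -E in Hi; mlra|mlra].
have wj j : j < ln s -> j <> i -> nth w j = nth s j.
  by move=> Hj Nj; rewrite nw ?(ite_false _ _ Nj) ?ite_true //; mlra.
have cases j : j < ln s + 1 -> j = i \/ (j < ln s /\ j <> i) \/ j = ln s.
  move=> /mltxS [Hj|->]; last by right; right.
  by case: (pselect (j = i)) => E; [left|right; left].
apply: (maxs Hw) => //; rewrite /Antichain lw.
- move=> a /cases [->|[[Ha Na]|->]] b /cases [->|[[Hb Nb]|->]] Nab //; rewrite ?wi ?wu ?(wj a) ?(wj b) //.
  + exact: off.
  + by apply: Incomparable_sym; apply: off.
  + exact: As.
  + by apply: Incomparable_sym; apply: off.
  + exact: Incomparable_sym.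
  + exact: off.
- move=> a /cases [->|[[Ha Na]|->]]; rewrite ?wi ?wu ?(wj a) //; exact: Cs.
Qed.

Hypothesis infC : Infinite C.

Lemma infinite_cone : models m BSigma2 ->
  exists i, i < ln s /\ forall b, exists t, [/\ C t, Initial (nth s i) t & b <= t].
Proof.
move=> BS; apply: contrapT => N.
(* The instance of bounding says that [b] exceeds all extensions of the [i]-th element. Its negation
   asks for a node of the Sigma^0_1 class [C], so it is Pi^0_1. *)
have [||B HB] := @S1_bounding m
   (fun i b => forall t, C t /\ Initial (nth s i) t -> t < b) BS _ (ln s).
- apply: (S1_ext (P := fun e : env => exists t, C t /\ (Initial (nth s (e 1%N)) t /\ ~ t < e 0%N))).
    move=> e; split=> [[t [Ct [It Ht]]] /(_ t (conj Ct It)) //|H].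
    apply: contrapT => K; apply: H => t [Ct It]; apply: contrapT => Ht.
    by apply: K; exists t.
  by s1.
- move=> i Hi; apply: contrapT => K; apply: N; exists i; split=> // b.
  apply: contrapT => K'; apply: K; exists b => t [Ct It]; apply: contrapT => Ht.
  by apply: K'; exists t; split=> //; mlra.
(* Exceeding [s] excludes that [t] is an initial segment of an element of the antichain; exceeding
   [B] contradicts the bound on extensions. *)
have [t [Ht Ct]] := infC (B + s).
have [i [Hi [I|I]]] := maximal_comparable Ct.
- have := IsSeq_le (proj1 (TC Ct)) I; have := nth_le s i; mlra.
- have [b [Hb /(_ t (conj Ct I)) Htb]] := HB i Hi; mlra.
Qed.

(** In N^{<N} infinitely many codes can share a length, but the cone is linear: a member with a
    larger code than [t] must be a proper extension of [t]. *)
Lemma long_extensions i : i < ln s ->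
  (forall b, exists t, [/\ C t, Initial (nth s i) t & b <= t]) ->
  forall n, exists t, C t /\ (Initial (nth s i) t /\ n <= ln t).
Proof.
move=> Hi H; apply: S1_induction; first s1.
- by have [t [Ct It _]] := H 0; exists t; do 2 split=> //; mlra.
- move=> n [t [Ct [It lt]]]; have [u [Cu Iu Hu]] := H (t + 1).
  exists u; do 2 split=> //.
  have [I|I] := cone_linear Hi Ct Cu It Iu; last first.
    by have := IsSeq_le (proj1 (TC Cu)) I; mlra.
  have /InitialE [_ [_ [K1 K2]]] := I.
  case: (pselect (ln u <= ln t)) => K; last by mlra.
  have E : t = u by apply: IsSeq_eq; [case: (TC Ct)|case: (TC Cu)|mlra|].
  by rewrite -E in Hu; mlra.
Qed.

Lemma cone_path i : i < ln s ->
  (forall b, exists t, [/\ C t, Initial (nth s i) t & b <= t]) -> exists G, Path C G.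
Proof.
move=> Hi /(long_extensions Hi) H.
have agree t u j : C t -> C u -> Initial (nth s i) t -> Initial (nth s i) u ->
    j < ln t -> j < ln u -> nth t j = nth u j.
  move=> Ct Cu It Iu Ht Hu.
  by have [/InitialE [_ [_ [_ ->]]]|/InitialE [_ [_ [_ ->]]]] := cone_linear Hi Ct Cu It Iu.
pose P z := exists t, C t /\ (Initial (nth s i) t /\
  exists j, j < ln t /\ z = mpair j (nth t j)).
have [||G memG] := @S1_comprehension m P; rewrite /P; first s1.
(* The complement of [P] is Sigma^0_1: either [z] is not a pair, or some node of the cone has at
   place [j] an entry other than [x]. Nodes that reach [j] exist and agree there. *)
- apply: (S1_ext (P := fun e : env =>
    (forall j, j <= e 0%N -> forall x, x <= e 0%N -> e 0%N <> mpair j x) \/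
    exists t, C t /\ (Initial (nth s i) t /\
      exists j, j < ln t /\ exists x, x <= e 0%N /\ (e 0%N = mpair j x /\ x <> nth t j)))).
    move=> e; move: (e 0%N) => z; split.
    + move=> [K [t [_ [_ [j [_ E]]]]]|[t [Ct [It [j [Hj [x [_ [-> Nx]]]]]]]] [u [Cu [Iu [j' [Hj' E]]]]]].
        by apply: (K j _ (nth t j)); rewrite ?E //; [apply: mpair_lel|apply: mpair_ler].
      have [jE xE] := mpair_inj E; rewrite -jE in Hj' xE.
      by apply: Nx; rewrite xE; apply: agree.
    + move=> K; case: (pselect (exists j x, z = mpair j x)) => [[j [x E]]|N].
        right; have [t [Ct [It lt]]] := H (j + 1).
        exists t; do 2 split=> //; exists j; split; first mlra.
        exists x; split; first by rewrite E; apply: mpair_ler.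
        split=> // xE; apply: K; exists t; do 2 split=> //; exists j; split; first mlra.
        by rewrite E xE.
      by left=> j _ x _ E; apply: N; exists j, x.
  by s1.
exists G; split; first split.
- by move=> z /memG [t [_ [_ [j [_ ->]]]]]; exists j, (nth t j).
- move=> j; have [t [Ct [It lt]]] := H (j + 1); exists (nth t j); split.
    by apply/memG; exists t; do 2 split=> //; exists j; split=> //; mlra.
  move=> z /memG [u [Cu [Iu [j' [Hj' /mpair_inj [jE ->]]]]]].
  by rewrite -jE in Hj' *; apply: agree => //; mlra.
- move=> u [Hu Gu]; have [t [Ct [It lt]]] := H (ln u).
  apply: (proj2 (TC Ct)); split=> //; apply/InitialE.
  split; first exact: IsSeq_Rep.
  split; first by apply: IsSeq_Rep; case: (TC Ct).
  split=> // j Hj.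
  have /memG [v [Cv [Iv [j' [Hj' /mpair_inj [jE ->]]]]]] : mem (mpair j (nth u j)) G.
    by apply: Gu; apply/EntryE; split=> //; apply: IsSeq_Rep.
  by rewrite -jE in Hj' *; apply: agree => //; mlra.
Qed.

End MaximalAntichain.

(** Assuming only that [C] is Sigma^0_1 covers the trees of both principles. *)
Theorem BSigma2_path : models m BSigma2 -> Infinite C -> exists G, Path C G.
Proof.
move=> BS infC; have [s [Hs As Cs maxs]] := maximal_antichain.
by have [i [Hi H]] := infinite_cone As Cs maxs infC BS; apply: cone_path H.
Qed.

End Tree.
End Paths.

(** * Paths yield bounding *)

Section Converse.
Variable m : rca.
Local Notation M := (dom m).
Local Notation env := (nat -> M).
Local Open Scope M_scope.

(** Stage [mpair v s] lists [s] if [v] witnesses that [s] is in [C]; every other stage repeats [s0],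
    so that the enumeration is total. *)
Lemma S1_range (C : M -> Prop) s0 : S1 (fun e : env => C (e 0%N)) -> C s0 ->
  exists X, Function X /\ Range X = C.
Proof.
move=> [Q [DQ HQ]] C0.
pose T v s := Q v (fun=> s).
have HT f g : Fn f -> Fn g -> D0 (fun e : env => T (f e) (g e)).
  apply: D0_rel2; apply: (D0_subst (P := fun e => Q (e 0%N) (tail e))
    (s := fun e => e 0%N .: fun=> e 1%N)) => //.
  by case=> [|i]; apply: Tm_var.
have CT s : C s <-> exists v, T v s by apply: (HQ (fun=> s)).
pose W k s := exists v, v <= k /\ (k = mpair v s /\ T v s).
have HW f g : Fn f -> Fn g -> D0 (fun e : env => W (f e) (g e)).
  by apply: D0_rel2; rewrite /W; d0.
pose Y k y := W k y \/ ~ (exists s, s <= k /\ W k s) /\ y = s0.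
have HY f g : Fn f -> Fn g -> D0 (fun e : env => Y (f e) (g e)).
  by apply: D0_rel2; rewrite /Y; d0.
have W_le k s : W k s -> s <= k by move=> [v [_ [-> _]]]; apply: mpair_ler.
have W_fun k s t : W k s -> W k t -> s = t.
  by move=> [v [_ [-> _]]] [v' [_ [/mpair_inj [_ ->]]]].
have Yex k : exists y, Y k y.
  case: (pselect (exists s, s <= k /\ W k s)) => [[s [_ H]]|H]; first by exists s; left.
  by exists s0; right.
have Yfun k y z : Y k y -> Y k z -> y = z.
  move=> [H|[N ->]] [K|[N' ->]] //; first exact: W_fun H K.
    by case: N'; exists y; split=> //; apply: W_le H.
  by case: N; exists z; split=> //; apply: W_le K.
have [||X memX] := @S1_comprehension m (fun z => exists k, k <= z /\
    exists y, y <= z /\ (z = mpair k y /\ Y k y)); try s1.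
have memXP k y : mem (mpair k y) X <-> Y k y.
  rewrite memX; split=> [[k' [_ [y' [_ [/mpair_inj [-> ->]]]]]] //|H].
  exists k; split; first exact: mpair_lel.
  by exists y; split; first exact: mpair_ler.
exists X; split; first split.
- by move=> z /memX [k [_ [y [_ [-> _]]]]]; exists k, y.
- by move=> k; have [y Hy] := Yex k; exists y; split=> [|z /memXP Hz]; [apply/memXP|exact: Yfun Hz Hy].
- apply: funext => y; apply: propext; split.
    move=> [k /memXP [[v [_ [_ H]]]|[_ ->]]] //.
    by apply/CT; exists v.
  move=> /CT [v H]; exists (mpair v y); apply/memXP; left; exists v.
  by split; first exact: mpair_lel.
Qed.

(* Elements of the same colour are comparable, so a prefix-free set has at most
   as many elements as there are colours. *)
Lemma colored_bounded (C : M -> Prop) (K : M -> M -> Prop) c : Tree C ->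
  (forall f g, Fn f -> Fn g -> S1 (fun e : env => K (f e) (g e))) ->
  (forall t, C t -> exists i, i < c /\ K t i) ->
  (forall t u i, C t -> C u -> K t i -> K u i -> Initial t u \/ Initial u t) ->
  PFBounded C.
Proof.
move=> TC HK Kex Kcomp; exists c => P [PF PC]; apply/CardLeE => s Hs Inj Ps.
(* One colour is chosen for each entry of [s], as an element may have several. A repeated colour
   would make two entries comparable, so the list of colours is injective. *)
have [||k [Hk lk nk]] := @mkseq_S1 m (fun i x => x < c /\ K (nth s i) x) (ln s).
- by move=> f g Hf Hg; s1.
- by move=> i /Ps /PC /Kex.
rewrite -lk; apply: pigeonhole; last by move=> i Hi; rewrite lk in Hi; case: (nk i Hi).
move=> i j Hi Hj E; rewrite lk in Hi Hj.
apply: Inj => //; apply: contrapT => N.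
have [_ Ki] := nk i Hi; have [_ Kj] := nk j Hj; rewrite -E in Kj.
have [I|I] := Kcomp _ _ _ (PC _ (Ps i Hi)) (PC _ (Ps j Hj)) Ki Kj.
- by apply: (PF (nth s i) (nth s j)); split; [|split; [|split]] => //; apply: Ps.
- by apply: (PF (nth s j) (nth s i)); split; [|split; [|split]]; try exact: Ps;
    [|apply: nesym].
Qed.

Lemma path_prefix (C : M -> Prop) G k : Path C G ->
  exists s : M, [/\ IsSeq s, ln s = k, C s & forall i, i < k -> mem (mpair i (nth s i)) G].
Proof.
move=> [[_ FG] PG].
have [||s [Hs ls ns]] := @mkseq_S1 m (fun i x => mem (mpair i x) G) k.
- by move=> f g Hf Hg; s1.
- by move=> i _; have [y [Hy _]] := FG i; exists y.
exists s; split=> //; apply: PG; split=> // i x /EntryE [_ [Hi ->]].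
by apply: ns; rewrite -ls.
Qed.

Lemma Function_unique G (i x y : M) : Function G -> mem (mpair i x) G -> mem (mpair i y) G -> x = y.
Proof. by move=> [_ FG]; have [z [_ Hz]] := FG i => /Hz -> /Hz ->. Qed.

Definition Pi1_bounding : Prop := forall (D : M -> M -> M -> Prop) n,
  (forall f g h, Fn f -> Fn g -> Fn h -> D0 (fun e : env => D (f e) (g e) (h e))) ->
  (forall x, x < n -> exists w, forall u, D x w u) ->
  exists b, forall x, x < n -> exists w, w < b /\ forall u, D x w u.

(** The pair of [y] and the witness [z] of the leading quantifier of [p] satisfies a Pi^0_1
    condition. A bound on the pairs is also one on [y]. *)
Lemma Pi1_bounding_models : Pi1_bounding -> models m BSigma2.
Proof.
move=> PB _ e E [p [q [[r [Dr ->]] ->]]].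
apply/sat_all1 => n; apply/sat_imp => /sat_ball Hn.
pose D x w u := exists y, y <= w /\ exists z, z <= w /\
  (w = mpair y z /\ sat (u .: z .: y .: x .: n .: e) E r).
have [f g h||b Hb] := PB D n.
- apply: D0_rel3; rewrite /D; do 2 (apply: D0_bex; first d0).
  apply: D0_and; first d0.
  apply: D0_sat => // -[|[|[|[|[|i]]]]]; rewrite /tail /=; try exact: Tm_var; exact: Tm_const.
- move=> x /Hn /sat_ex1 [y /sat_ex1 [z Hz]]; exists (mpair y z) => u.
  exists y; split; first exact: mpair_lel.
  by exists z; split; first exact: mpair_ler.
apply/sat_ex1; exists b; apply/sat_ball => x /Hb [w [Hw H]].
(* [D] decodes [w] afresh for every [u]; the components found for [u = 0] are the right ones
   throughout because pairing is injective. *)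
have [y [Hy [z [Hz [wE _]]]]] := H 0.
apply/sat_bex; exists y; split; first by rewrite /=; mlra.
apply/sat_subst/sat_ex1; exists z; apply/sat_all1 => u.
have [y' [_ [z' [_ [wE' Hr]]]]] := H u.
have [yE zE] : y = y' /\ z = z' by apply: mpair_inj; rewrite -wE.
move: Hr; rewrite -yE -zE; congr sat.
by apply: funext => -[|[|[|[|]]]].
Qed.

(** * Trees whose paths refute every candidate *)

Section Branches.
Variables (D : M -> M -> M -> Prop) (n : M).
Hypothesis HD : forall f g h, Fn f -> Fn g -> Fn h -> D0 (fun e : env => D (f e) (g e) (h e)).
Hypothesis Dex : forall x, x < n -> exists w, forall u, D x w u.
Hypothesis unbounded : forall b, exists x, x < n /\ forall w, w < b -> exists u, ~ D x w u.

(** Leastness makes the refuter unique, so that the first entry determines the whole branch. It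
    costs only a bounded quantifier, so [KLtree] stays Delta0 and exists as a set. *)
Definition LeastRefuter (x w u : M) : Prop := ~ D x w u /\ forall v, v < u -> D x w v.

Lemma D0_LeastRefuter f g h : Fn f -> Fn g -> Fn h ->
  D0 (fun e : env => LeastRefuter (f e) (g e) (h e)).
Proof. by apply: D0_rel3; rewrite /LeastRefuter; d0. Qed.

Lemma LeastRefuter_unique x w u v : LeastRefuter x w u -> LeastRefuter x w v -> u = v.
Proof.
move=> [Nu Hu] [Nv Hv]; have [H|[//|H]] := mlt_total u v.
  by case: Nu; apply: Hv.
by case: Nv; apply: Hu.
Qed.

Lemma LeastRefuter_ex x w u : ~ D x w u -> exists v, LeastRefuter x w v.
Proof.
move=> H; have [|v [_ Nv Hv]] := @D0_least m (fun v => ~ D x w v) _ u H; first d0.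
by exists v; split=> // z Hz; apply: contrapT; apply: Hv.
Qed.

(* The branch [x < n] consists of the sequences [x, u_0, u_1, ...] in which [u_w]
   is the least refutation of the candidate [w] for [x]. *)
Definition KLtree (s : M) : Prop := IsSeq s /\ forall j, j < ln s ->
  (j = 0 /\ nth s 0 < n) \/ exists w, w < j /\ (j = w + 1 /\ LeastRefuter (nth s 0) w (nth s j)).

Lemma KL_contradiction : KL_pf m -> False.
Proof.
have HL := D0_LeastRefuter.
move=> KL; have [||T memT] := @S1_comprehension m KLtree; try (by rewrite /KLtree; s1).
have memTE : (fun t => mem t T) = KLtree by apply: funext => t; apply: propext.
have n0 : 0 < n by have [x [Hx _]] := unbounded 0; mlra.
have TT : Tree KLtree.
  move=> s [Hs H]; split=> // t [Ht /InitialE [_ [_ [lt nt]]]]; split=> // j Hj.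
  have [|[E Hn]|[w [Hw [jE Hr]]]] := H j; first by mlra.
    by left; rewrite nt -?E //; split=> //; rewrite E.
  by right; exists w; do 2 split=> //; rewrite !nt //; mlra.
have head t : KLtree t -> 0 < ln t -> nth t 0 < n.
  by move=> [_ H] /H [[_ //]|[w [Hw _]]]; mlra.
move: (KL T); rewrite memTE => {memTE} {}KL; have [|G HG] := KL.
  split=> //; split.
  (* The first [x] candidates for [a] are refuted, which gives a node of length [x + 1]; a code is
     at least the length. *)
  - move=> x; have [a [Ha Hr]] := unbounded x.
    have [f g Hf Hg|i Hi|s [Hs ls ns]] := @mkseq_S1 m (fun i y => (i = 0 /\ y = a) \/
      exists w, w < i /\ (i = w + 1 /\ LeastRefuter a w y)) (x + 1).
    + by s1.
    + have [->|[w wE]] := zero_or_succ i; first by exists a; left.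
      have [|u Hu] := Hr w; first by mlra.
      have [v Hv] := LeastRefuter_ex Hu.
      by exists v; right; exists w; split=> //; mlra.
    have s0 : nth s 0 = a.
      by have [|[_ //]|[w [Hw _]]] := ns 0; mlra.
    exists s; split; first by have := ln_le s; mlra.
    split=> // j; rewrite ls s0 => /ns [[-> E]|H]; last by right.
    by left.
  (* The colour is the first entry. The empty sequence has every colour, being comparable with all
     nodes. *)
  - apply: (@colored_bounded KLtree (fun t i => ln t = 0 \/ nth t 0 = i) n) => //.
    + by move=> f g Hf Hg; s1.
    + move=> t Ht; have [E|[k kE]] := zero_or_succ (ln t); first by exists 0; split=> //; left.
      by exists (nth t 0); split; [apply: head => //; mlra|right].
    + move=> t u i Ct Cu Kt Ku.
      have triv v v' : KLtree v -> KLtree v' -> ln v = 0 -> Initial v v'.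
        move=> [/IsSeq_Rep Hv _] [/IsSeq_Rep Hv' _] lv; apply/InitialE; do 2 split=> //.
        by rewrite lv; split=> [|j /mltx0] //; mlra.
      case: Kt => [E|Et]; first by left; apply: triv.
      case: Ku => [E|Eu]; first by right; apply: triv.
      have agree j : j < ln t -> j < ln u -> nth t j = nth u j.
        move=> jt ju; have [[-> _]|[w [Hw [jE Hr]]]] := proj2 Ct j jt; first by rewrite Et Eu.
        have [[E _]|[w' [Hw' [jE' Hr']]]] := proj2 Cu j ju; first by mlra.
        have wE : w = w' by mlra.
        rewrite -wE Eu -Et in Hr'; exact: LeastRefuter_unique Hr Hr'.
      have [Rt Ru] : Rep t /\ Rep u by split; apply: IsSeq_Rep; [case: Ct|case: Cu].
      have [H|H] := mle_total (ln t) (ln u); [left|right]; apply/InitialE; do 3 split=> //.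
        by move=> j Hj; apply: agree => //; mlra.
      by move=> j Hj; rewrite agree //; mlra.
have [FG _] := HG.
have [x [Gx _]] := (proj2 FG) 0.
have xE k : exists s, [/\ KLtree s, ln s = k + 1 & nth s 0 = x].
  have [s [Hs ls Cs Gs]] := path_prefix (k + 1) HG; exists s; split=> //.
  by apply: (Function_unique FG) Gx; apply: Gs; mlra.
have xn : x < n by have [s [Cs ls <-]] := xE 0; apply: head => //; rewrite ls; mlra.
(* [w] is a true witness for [x], but the prefix of length [w + 2] has a refuter of [w] at index
   [w + 1]. *)
have [w Hw] := Dex xn; have [s [[_ Hs] ls sx]] := xE (w + 1).
have [|[E _]|[w' [_ [wE [Nr _]]]]] := Hs (w + 1); first by rewrite ls; mlra.
  by mlra.
by apply: Nr; rewrite sx (_ : w' = w) //; mlra.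
Qed.

(** The value [x = n] describes strings without a 1: [WKLtree] limits them to length [n], so
    position [n] is never reached. *)
Definition OneAt (x s : M) : Prop := (forall j, j < ln s -> nth s j = ite (j = x) 1 0) /\
  (x < ln s \/ x = n).

(* The branch [x < n] consists of the strings [0^x 1 0^j] such that the first
   [j] candidates for [x] are refuted; [x = n] stands for the strings [0^j]. *)
Definition WKLtree (s : M) : Prop := IsSeq s /\ exists x, x < n + 1 /\ (OneAt x s /\
  ((x = n -> ln s <= n) /\
   forall w, w < ln s -> x + 1 + w < ln s -> exists u, ~ D x w u)).

Lemma WKL_contradiction : WKL_pf m -> False.
Proof.
move=> WKL.
have HO f g : Fn f -> Fn g -> D0 (fun e : env => OneAt (f e) (g e)).
  by apply: D0_rel2; rewrite /OneAt; d0.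
have n0 : 0 < n by have [x [Hx _]] := unbounded 0; mlra.
have [|nil [Hnil lnil _]] := @mkseq_Fn m id 0; first by [].
have Cnil : WKLtree nil.
  split=> //; exists n; split; first mlra.
  split; first by split; [move=> j; rewrite lnil => /mltx0|right].
  by split; [rewrite lnil; mlra|move=> w; rewrite lnil => /mltx0].
(* Refuters are quantified existentially in [WKLtree] and not stored in the string, so the tree is
   only Sigma^0_1 and is given by an enumeration. The empty string is its default value. *)
have [|X [FX RX]] := @S1_range WKLtree nil _ Cnil; first by rewrite /WKLtree; s1.
move: (WKL X); rewrite RX => {RX} {}WKL.
have TT : Tree WKLtree.
  move=> s [Hs [x [Hx [[Os Bs] [Zs Rs]]]]]; split=> // t [Ht /InitialE [_ [_ [lt nt]]]].
  (* An initial segment that stops before the 1 of [s] consists of zeros and is shorter than [n], so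
     it belongs to the case [x = n]. *)
  split=> //; have [H|H] := pselect (x < ln t \/ x = n).
    exists x; split=> //; split; first by split=> // j Hj; rewrite nt // Os //; mlra.
    split; first by move=> /Zs; mlra.
    by move=> w Hw Hxw; apply: Rs; mlra.
  have xt : ~ x < ln t by move=> K; apply: H; left.
  have xn : x < n by case: (mlt_total x n) => [//|[K|K]]; [case: H; right|mlra].
  exists n; split; first mlra.
  split.
    split; last by right.
    by move=> j Hj; rewrite nt // Os ?ite_false //; mlra.
  by split; [mlra|move=> w Hw Hxw; mlra].
have [|G HG] := WKL.
  split=> //; split.
    move=> y [Hy [x [_ [[Oy _] _]]]]; split=> // i z /EntryE [_ [Hi ->]].
    by rewrite Oy // /ite; case: pselect => _; mlra.
  split=> //; split.
  - move=> b; have [x [Hx Hr]] := unbounded b.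
    (* The 1 at position [x] is followed by [b] zeros, one for each refuted candidate; the length
       [x + 1 + b] forces the code above [b]. *)
    have [|s [Hs ls ns]] := @mkseq_Fn m (fun j => ite (j = x) 1 0) (x + 1 + b).
      by move=> g Hg; d0.
    exists s; split; first by have := ln_le s; mlra.
    split=> //; exists x; split; first mlra.
    split; first by split; [move=> j; rewrite ls; apply: ns|left; mlra].
    by split; [mlra|move=> w _ Hw; apply: Hr; mlra].
  - apply: (@colored_bounded WKLtree (fun t i => OneAt i t) (n + 1)) => //.
    + by move=> f g Hf Hg; s1.
    + by move=> t [_ [x [Hx [Ox _]]]]; exists x.
    + move=> t u i [/IsSeq_Rep Rt _] [/IsSeq_Rep Ru _] [Ot _] [Ou _].
      have [H|H] := mle_total (ln t) (ln u); [left|right]; apply/InitialE; do 3 split=> //.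
        by move=> j Hj; rewrite Ot // Ou //; mlra.
      by move=> j Hj; rewrite Ot ?Ou //; mlra.
have [FG _] := HG.
(* A prefix of the path longer than [n] cannot consist of zeros only, so it carries a 1 at some
   [x < n]. *)
have one k : exists s x, [/\ x < n, nth s x = 1, ln s = n + 1 + k,
    (forall j, j < ln s -> mem (mpair j (nth s j)) G) /\
    (forall j, j < ln s -> nth s j = ite (j = x) 1 0) &
    forall w, w < ln s -> x + 1 + w < ln s -> exists u, ~ D x w u].
  have [s [Hs ls [_ [x [Hx [[Ox Bx] [Zx Rx]]]]] Gs]] := path_prefix (n + 1 + k) HG.
  have xn : x < n by case: (mlt_total x n) => [//|[/Zx K|K]]; mlra.
  exists s, x; split=> //; last by split=> // j; rewrite ls; apply: Gs.
  by rewrite Ox ?ite_true //; mlra.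
have [s [x [xn sx ls [Gs Os] _]]] := one 0.
have [w Hw] := Dex xn.
(* This prefix is long enough that the candidate [w] must be refuted for [x']; both prefixes lie on
   one path, so their 1 is at the same position. *)
have [s' [x' [xn' sx' ls' [Gs' Os'] Rs']]] := one (w + 1).
have xE : x = x'.
  have E : nth s x' = 1.
    rewrite -sx'; apply: (Function_unique FG (i := x')); [apply: Gs|apply: Gs']; mlra.
  apply: contrapT => N; move: E; rewrite Os ?ite_false; [mlra|exact: nesym|mlra].
have [||u Nu] := Rs' w; [mlra|mlra|].
by apply: Nu; rewrite -xE.
Qed.

End Branches.

Lemma bounding_of_contradiction :
  (forall D n, (forall f g h, Fn f -> Fn g -> Fn h -> D0 (fun e : env => D (f e) (g e) (h e))) ->
    (forall x, x < n -> exists w, forall u, D x w u) ->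
    (forall b, exists x, x < n /\ forall w, w < b -> exists u, ~ D x w u) -> False) ->
  models m BSigma2.
Proof.
move=> H; apply: Pi1_bounding_models => D n HD Dex.
apply: contrapT => N; apply: (H D n HD Dex) => b.
apply: contrapT => K; apply: N; exists b => x Hx.
apply: contrapT => K'; apply: K; exists x; split=> // w Hw.
apply: contrapT => K''; apply: K'; exists w; split=> // u.
by apply: contrapT => Nu; apply: K''; exists u.
Qed.

Lemma KL_BSigma2 : KL_pf m -> models m BSigma2.
Proof.
move=> KL; apply: bounding_of_contradiction => D n HD Dex unb; exact: KL_contradiction unb KL.
Qed.

Lemma WKL_BSigma2 : WKL_pf m -> models m BSigma2.
Proof.
move=> WKL; apply: bounding_of_contradiction => D n HD Dex unb; exact: WKL_contradiction unb WKL.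
Qed.

End Converse.

(** * From models back to provability *)

Lemma models_union m A B : models m (union A B) -> models m A /\ models m B.
Proof. by move=> H; split=> p e E Hp; apply: H; [left|right]. Qed.

Lemma implies_over_models (P Q : theory) :
  (forall m : rca, models m P -> models m Q) -> implies_over RCA0 P Q.
Proof.
move=> H q Qq; apply: completeness => m /models_union [mR mP] e E.
exact: (H (Rca mR)).
Qed.

Lemma models_WKL (m : rca) : models m (single Sigma01_WKL_pf_bd) <-> WKL_pf m.
Proof.
split=> [H|H p e E ->]; last exact/sat_WKL.
by apply/(sat_WKL (fun=> mzero m) (fun=> mset m)); apply: H.
Qed.

Lemma models_KL (m : rca) : models m (single KL_pf_bd) <-> KL_pf m.
Proof.
split=> [H|H p e E ->]; last exact/sat_KL.
by apply/(sat_KL (fun=> mzero m) (fun=> mset m)); apply: H.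
Qed.

Lemma BSigma2_WKL (m : rca) : models m BSigma2 -> WKL_pf m.
Proof.
move=> BS X [_ [_ [TX [IX BX]]]]; apply: (BSigma2_path _ TX BX BS IX) => f Hf.
by rewrite /Range; s1.
Qed.

Lemma BSigma2_KL (m : rca) : models m BSigma2 -> KL_pf m.
Proof.
move=> BS X [TX [IX BX]]; apply: (BSigma2_path _ TX BX BS IX) => f Hf.
by s1.
Qed.

Theorem theorem2p1 :
  equivalent_over RCA0 BSigma2 (single Sigma01_WKL_pf_bd)
  /\ equivalent_over RCA0 (single Sigma01_WKL_pf_bd) (single KL_pf_bd)
  /\ equivalent_over RCA0 BSigma2 (single KL_pf_bd).
Proof.
split; [|split]; split; apply: implies_over_models => m; rewrite ?models_WKL ?models_KL.
- exact: BSigma2_WKL.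
- exact: WKL_BSigma2.
- by move/WKL_BSigma2; apply: BSigma2_KL.
- by move/KL_BSigma2; apply: BSigma2_WKL.
- exact: BSigma2_KL.
- exact: KL_BSigma2.
Qed.
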